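(* Let $\alpha$, $a_n$, $t_n$, $L_\alpha$ and the $\alpha$-sum-level sets $\mathcal{L}^{(\alpha)}_n$ be as in the context. (1) The series $\sum_{n=1}^{\infty}\lambda(\mathcal{L}^{(\alpha)}_n)$ diverges, and \[\lim_{n\to\infty}\lambda(\mathcal{L}^{(\alpha)}_n)=\begin{cases}0, & \text{if } \alpha \text{ is of infinite type},\\ \left(\sum_{k=1}^\infty t_k\right)^{-1}, & \text{if } \alpha \text{ is of finite type}.\end{cases}\] (2) Suppose $\alpha$ is either expansive of exponent $\theta\in[0,1]$ or of finite type. (i) (Weak renewal law) With $K_\alpha:=(\Gamma(2-\theta)\Gamma(1+\theta))^{-1}$ if $\alpha$ is expansive of exponent $\theta\in[0,1]$, and $K_\alpha:=1$ if $\alpha$ is of finite type, we have \[\sum_{k=1}^{n}\lambda(\mathcal{L}^{(\alpha)}_k)\sim K_\alpha\cdot n\cdot\Big(\sum_{k=1}^{n}t_k\Big)^{-1}.\] (ii) (Strong renewal law) With $k_\alpha:=(\Gamma(2-\theta)\Gamma(\theta))^{-1}$ if $\alpha$ is expansive of exponent $\theta\in(1/2,1]$, and $k_\alpha:=1$ if $\alpha$ is of finite type, we have (in each of these two cases) \[\lambda(\mathcal{L}^{(\alpha)}_n)\sim k_\alpha\cdot\Big(\sum_{k=1}^{n}t_k\Big)^{-1}.\]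
   Context: Let $\mathcal{U}=[0,1]$ and $\lambda$ Lebesgue measure. $\alpha=\{A_n:n\in\mathbb{N}\}$ is a countable partition of $\mathcal U$ (up to the point $0$) into left-open, right-closed intervals of positive length, ordered from right to left starting with $A_1$ (so $A_1$ contains $1$), whose atoms accumulate only at $0$. Write $a_n:=\lambda(A_n)$ and $t_n:=\sum_{k\ge n}a_k$, so $A_n=(t_{n+1},t_n]$ and $t_1=1$. The $\alpha$-Lüroth map $L_\alpha:\mathcal U\to\mathcal U$ is $L_\alpha(x)=(t_n-x)/a_n$ for $x\in A_n$, and $L_\alpha(0)=0$. For $\ell_1,\dots,\ell_k\in\mathbb N$ let $C_\alpha(\ell_1,\dots,\ell_k):=\{x\in\mathcal U: L_\alpha^{i-1}(x)\in A_{\ell_i}\text{ for } i=1,\dots,k\}$. The $\alpha$-sum-level sets are $\mathcal{L}^{(\alpha)}_n:=\{x\in C_\alpha(\ell_1,\dots,\ell_k):\sum_{i=1}^k\ell_i=n \text{ for some } k\in\mathbb N\}$ for $n\in\mathbb N$. $\alpha$ is of finite type if $\sum_{n}t_n<\infty$, otherwise of infinite type. $\alpha$ is expansive of exponent $\theta\ge0$ if $t_n=\psi(n)n^{-\theta}$ for all $n\in\mathbb N$ for some slowly varying function $\psi$ (a measurable $f:\mathbb R^+\to\mathbb R^+$ with $\lim_{x\to\infty}f(xy)/f(x)=1$ for all $y>0$). $a_n\sim b_n$ means $\lim_{n\to\infty}a_n/b_n=1$. *)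

(* Defs.v *)
From HB Require Import structures.
From mathcomp Require Import all_boot all_order all_algebra.
From mathcomp Require Import all_classical all_reals all_analysis.
Set Implicit Arguments. Unset Strict Implicit. Unset Printing Implicit Defensive.
Import Order.TTheory GRing.Theory Num.Theory numFieldNormedType.Exports.
Local Open Scope classical_set_scope.
Local Open Scope ring_scope.

Section AlphaLuroth.
Variable R : realType.

(* The partition alpha is encoded by the sequence of interval lengths
   a n = lambda(A_n), n >= 1 (the value a 0 is irrelevant).  alpha is a
   partition of (0,1] into left-open right-closed intervals of positive
   length ordered from right to left accumulating only at 0 iff
   a n > 0 for n >= 1 and sum_{n>=1} a n = 1. *)
Definition is_partition (a : nat -> R) : Prop :=
  (forall n, (0 < n)%N -> 0 < a n) /\
  (fun N => \sum_(1 <= k < N) a k) @ \oo --> (1 : R).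

Definition tail (a : nat -> R) (n : nat) : R :=
  limn (fun N => \sum_(n <= k < N) a k).

Definition atom (a : nat -> R) (n : nat) : set R :=
  `](tail a n.+1), (tail a n)].

(* the index n >= 1 of the atom containing x (0 if there is none, e.g. x = 0) *)
Definition digit (a : nat -> R) (x : R) : nat :=
  xget 0%N [set n | (0 < n)%N /\ atom a n x].

Definition Lmap (a : nat -> R) (x : R) : R :=
  let n := digit a x in
  if n == 0%N then 0 else (tail a n - x) / a n.

Definition cylinder (a : nat -> R) (l : seq nat) : set R :=
  [set x | 0 <= x <= 1 /\
     forall i, (i < size l)%N -> atom a (nth 0%N l i) (iter i (Lmap a) x)].

Definition sumlevel (a : nat -> R) (n : nat) : set R :=
  [set x | exists l : seq nat,
     [/\ (0 < size l)%N, all (fun m => (0 < m)%N) l, sumn l = n & cylinder a l x]].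

(* lambda(L_n), as a real number (it is a measure of a subset of [0,1]) *)
Definition lam_sumlevel (a : nat -> R) (n : nat) : R :=
  fine (lebesgue_measure (sumlevel a n)).

Definition tsum (a : nat -> R) (n : nat) : R := \sum_(1 <= k < n.+1) tail a k.

Definition finite_type (a : nat -> R) : Prop := cvg (tsum a @ \oo).

Definition slowly_varying (psi : R -> R) : Prop :=
  [/\ measurable_fun (`]0%R, +oo[ : set R) psi,
      (forall x, 0 < x -> 0 < psi x) &
      forall y, 0 < y -> (fun x => psi (x * y) / psi x) @ +oo --> (1 : R)].

Definition expansive (a : nat -> R) (theta : R) : Prop :=
  0 <= theta /\
  exists psi : R -> R, slowly_varying psi /\
    forall n, (0 < n)%N -> tail a n = psi n%:R * (n%:R `^ (- theta)).

Definition Gamma (s : R) : R :=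
  fine (\int[lebesgue_measure]_(x in `]0%R, +oo[) ((x `^ (s - 1)) * expR (- x))%:E)%E.

Definition asymp (u v : nat -> R) : Prop := (fun n => u n / v n) @ \oo --> (1 : R).

End AlphaLuroth.

(* Main.v *)
(* Writing u_0 = 1 and u_n = \sum_(1 <= k <= n) a_k u_(n-k), each branch of the
   alpha-Lueroth map being affine gives lambda(L_n) = u_n, so the statement is a
   set of renewal theorems for u with U_n = \sum_(k <= n) u_k, T_n = tsum a n and
   W_n = n / T_n.

   (1) is the Erdos-Feller-Pollard theorem: u * t = 1, and along times where u
   is close to its limsup (liminf) all preceding values are close as well.

   (2)(i) Convolution gives (U * T)_n ~ n^2 / 2, and regular variation gives
   (W * T)_n ~ beta n^2 with beta = \int_0^1 x^(1-theta) (1-x)^theta dx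
   = Gamma(2-theta) Gamma(1+theta) / 2. Hence with K = 1 / (2 beta) the sequence
   D = U - K W satisfies D * T = o(n^2), and convolving with u, where u * T = n,
   shows that the double sums of D are o(n^2 W_n). Second differences and the
   monotonicity of U and W remove the double summation.

   (2)(ii) A finite Fourier inversion of u, with the lower bound c x T_{1/x} for
   the modulus of the symbol 1 - \sum_j a_j e^(i j x) (from its real part if
   theta < 1, from its imaginary part if theta = 1) and the Potter bound
   T_n <= C (n/m)^b T_m with b < 1/2, which makes the square of the inverse
   symbol summable, gives |u_n - u_(n+k)| <= e / T_n for k <= n / q. Hence u_n is
   close to (U_(n+k) - U_n) / k, which the weak law evaluates. *)
Require Import Defs.
From HB Require Import structures.
From mathcomp Require Import all_boot all_order all_algebra.
From mathcomp Require Import all_classical all_reals all_analysis.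
From mathcomp Require Import measurable_realfun.
From mathcomp.real_closed Require Import complex.
From mathcomp Require Import ring lra zify.
Set Implicit Arguments. Unset Strict Implicit. Unset Printing Implicit Defensive.
Import Order.TTheory GRing.Theory Num.Theory numFieldNormedType.Exports.
Import Normc.
Local Open Scope classical_set_scope.
Local Open Scope ring_scope.

(** The sequence u need not be monotone, so the weak law cannot simply be differentiated; slow
    oscillation over windows of length n/q takes the place of monotonicity. Regular variation is
    used in the form T(mk) / T(k) -> m^rho with integers m and rho = 1 - theta. Arguments in between
    are covered because T and W are both nondecreasing, and finite type enters the weak law as rho =
    0. The bound theta > 1/2 has one source. An increment of the inverse symbol is a product of two
    of its values times an increment of the symbol, so its squares have to be summed. At frequency
    l/n the square is of order (n / T_n)^2 l^(2b - 2), which is summable for b < 1/2, while the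
    Potter bound is obtained for b > 1 - theta. For theta = 1 one has n t_n = o(T_n), which makes
    the real part of the symbol too small; its imaginary part carries the truncated first moment,
    which is asymptotic to T_n. *)

Lemma cvgn_dist_lt (R : realType) (u : nat -> R) (l : R) : u @ \oo --> l ->
  forall e : R, 0 < e -> exists N, forall n, (N <= n)%N -> `|u n - l| < e.
Proof.
move=> /cvgrPdist_lt ul e /ul [N _ HN].
by exists N => n /HN; rewrite distrC.
Qed.

Lemma dist_lt_cvgn (R : realType) (u : nat -> R) (l : R) :
  (forall e : R, 0 < e -> exists N, forall n, (N <= n)%N -> `|u n - l| < e) ->
  u @ \oo --> l.
Proof.
move=> H; apply/cvgrPdist_lt => e /H [N HN].
by exists N => // n /HN; rewrite distrC.
Qed.

Section RenewalSequence.
Variable R : realType.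
Implicit Types a : nat -> R.

(* Course-of-values recursion: the list u_n, ..., u_0 of all values so far. *)
Fixpoint renewal_rev a n : seq R :=
  if n is m.+1 then
    (\sum_(k < m.+1) a k.+1 * (renewal_rev a m)`_k) :: renewal_rev a m
  else [:: 1].

Definition renewal a n : R := head 0 (renewal_rev a n).

Lemma nth_renewal_rev a n k : (k <= n)%N ->
  (renewal_rev a n)`_k = renewal a (n - k).
Proof.
elim: n k => [|n IHn] [|k] //= kn.
by rewrite IHn // subSS.
Qed.

Lemma renewal0 a : renewal a 0 = 1.
Proof. by []. Qed.

Lemma renewalS a n :
  renewal a n.+1 = \sum_(k < n.+1) a k.+1 * renewal a (n - k).
Proof.
rewrite /renewal /=; apply: eq_bigr => k _.
by rewrite nth_renewal_rev // -ltnS.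
Qed.

End RenewalSequence.

(** * Tails of the partition *)

Section Tail.
Variables (R : realType) (a : nat -> R).
Hypothesis a_part : is_partition a.

Lemma partition_gt0 n : (0 < n)%N -> 0 < a n.
Proof. by case: a_part => + _; apply. Qed.

Lemma cvg_tail_sum n :
  (fun N => \sum_(n.+1 <= k < N) a k) @ \oo --> 1 - \sum_(1 <= k < n.+1) a k.
Proof.
have [_ a1] := a_part.
have : (fun N => \sum_(1 <= k < N) a k - \sum_(1 <= k < n.+1) a k) @ \oo -->
    1 - \sum_(1 <= k < n.+1) a k by apply: cvgB => //; exact: cvg_cst.
apply: cvg_trans; apply: near_eq_cvg; near=> N.
rewrite (@big_cat_nat _ _ _ n.+1) //=.
- by rewrite addrAC subrr add0r.
- by near: N; exists n.+1.
Unshelve. all: by end_near. Qed.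

Lemma tailE n : tail a n.+1 = 1 - \sum_(1 <= k < n.+1) a k.
Proof. by apply/cvg_lim => //; exact: cvg_tail_sum. Qed.

Lemma tail1 : tail a 1 = 1.
Proof. by rewrite tailE big_nil subr0. Qed.

Lemma tailS n : (0 < n)%N -> tail a n = a n + tail a n.+1.
Proof.
by case: n => // n _; rewrite !tailE [in RHS]big_nat_recr //=; ring.
Qed.

Lemma tail_cvg0 : tail a @ \oo --> (0 : R).
Proof.
have [_ a1] := a_part; apply: dist_lt_cvgn => e e0.
have [N HN] := cvgn_dist_lt a1 e0; exists N.+1 => -[//|n] nN.
by rewrite subr0 tailE distrC HN // ltnW.
Qed.

Lemma tail_ltS n : (0 < n)%N -> tail a n.+1 < tail a n.
Proof. by move=> n0; rewrite [ltRHS]tailS // ltrDr partition_gt0. Qed.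

Lemma tail_le m n : (0 < m)%N -> (m <= n)%N -> tail a n <= tail a m.
Proof.
move=> m0 /subnK <-; elim: (n - m)%N => [|d IHd] //.
apply: le_trans IHd; rewrite addSn; apply/ltW/tail_ltS.
by rewrite addn_gt0 m0 orbT.
Qed.

Lemma tail_ge0 n : (0 < n)%N -> 0 <= tail a n.
Proof.
move=> n0; apply: (cvgr_to_le tail_cvg0).
by exists n => // m /= nm; exact: tail_le.
Qed.

Lemma tail_gt0 n : (0 < n)%N -> 0 < tail a n.
Proof. by move=> n0; rewrite (le_lt_trans _ (tail_ltS _)) ?tail_ge0. Qed.

Lemma tail_le1 n : (0 < n)%N -> tail a n <= 1.
Proof. by move=> n0; rewrite -tail1 tail_le. Qed.

End Tail.

(** * Lebesgue measure under affine maps *)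

Section AffineMeasure.
Variable R : realType.
Local Notation mu := (@lebesgue_measure R).

Lemma measurable_affine (c d : R) :
  measurable_fun [set: R] (fun x : R => c * x + d).
Proof. by apply: measurable_funD => //; exact: measurable_funM. Qed.

(** Uniqueness of Lebesgue measure: c times the image measure gives half-open intervals their
    length. The decreasing branches are reduced to c > 0 by a separate reflection. *)
Lemma lebesgue_measure_affine (c d : R) (A : set R) : 0 < c -> measurable A ->
  mu ((fun x => c * x + d) @^-1` A) = (c^-1%:E * mu A)%E.
Proof.
move=> c0 mA; have cn : 0 <= c by exact: ltW.
have mf := measurable_affine c d.
have h : mu A = (c%:E * mu ((fun x => (c * x + d)%R) @^-1` A))%E.
  rewrite (_ : (c%:E * _)%E = mscale (NngNum cn)
      (pushforward mu (fun x : measurableTypeR R => c * x + d : measurableTypeR R))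
      A) //.
  apply: lebesgue_measure_unique => // _ [[x y]] _ <-.
  transitivity (c%:E * mu `]((x - d) / c)%R, ((y - d) / c)%R]%classic)%E; last first.
    congr (_ * mu _)%E; apply/seteqP; split => z; rewrite /= !in_itv /=;
    by rewrite ltr_pdivrMr // ler_pdivlMr // ltrBlDr lerBrDr mulrC.
  rewrite !lebesgue_measure_itv /= !lte_fin ltr_pM2r ?invr_gt0 // ltrD2r.
  case: ifPn => _; last by rewrite mule0.
  by rewrite -!EFinB -EFinM; congr EFin; field; rewrite gt_eqF.
by rewrite h muleA -EFinM mulVf ?gt_eqF // mul1e.
Qed.

End AffineMeasure.

(** * Measure of the sum-level sets *)

Section SumLevel.
Variables (R : realType) (a : nat -> R).
Hypothesis a_part : is_partition a.
Local Notation mu := (@lebesgue_measure R).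

Lemma atomP n x : atom a n x <-> tail a n.+1 < x <= tail a n.
Proof. by rewrite /atom /= in_itv. Qed.

Lemma atom_inj m n x : (0 < m)%N -> (0 < n)%N ->
  atom a m x -> atom a n x -> m = n.
Proof.
wlog mn : m n / (m < n)%N => [hw m0 n0 am an|].
  by have [/hw|/hw h|//] := ltngtP m n; [exact | apply/esym/h].
move=> m0 n0 /atomP/andP[tx _] /atomP/andP[_ xt].
have := lt_le_trans tx (le_trans xt (tail_le a_part (ltn0Sn m) mn)).
by rewrite ltxx.
Qed.

Lemma digit_atom k x : (0 < k)%N -> atom a k x -> digit a x = k.
Proof.
move=> k0 akx; apply: xget_unique => //= n [n0 anx].
exact: atom_inj anx akx.
Qed.

Lemma Lmap_atom k x : (0 < k)%N -> atom a k x ->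
  Lmap a x = (tail a k - x) / a k.
Proof. by move=> k0 akx; rewrite /Lmap (digit_atom k0 akx) eqn0Ngt k0. Qed.

(** The image of a branch is [0, 1), since the excluded left end point of the atom would go to 1.
    This is why the point 1 is removed in [piece]. *)
Lemma atom_itv k x : (0 < k)%N ->
  atom a k x <-> 0 <= (tail a k - x) / a k < 1.
Proof.
move=> k0; have ak := partition_gt0 a_part k0.
rewrite atomP pmulr_lge0 ?invr_gt0 // subr_ge0 ltr_pdivrMr // mul1r andbC.
by rewrite ltrBlDr (tailS a_part k0) ltrD2l.
Qed.

Lemma atom_sub01 k x : (0 < k)%N -> atom a k x -> 0 <= x <= 1.
Proof.
move=> k0 /atomP/andP[tx xt]; apply/andP; split.
  exact: le_trans (tail_ge0 a_part (ltn0Sn k)) (ltW tx).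
exact: le_trans xt (tail_le1 a_part k0).
Qed.

Lemma cylinder_cons k l x : (0 < k)%N ->
  cylinder a (k :: l) x <-> atom a k x /\ cylinder a l (Lmap a x).
Proof.
move=> k0; split=> [[x01 H]|[akx [_ H]]].
  have akx : atom a k x by exact: (H 0%N).
  split=> //; split=> [|i il].
    rewrite (Lmap_atom k0 akx); have/andP[-> /ltW ->//] := (atom_itv x k0).1 akx.
  by have := H i.+1 il; rewrite iterSr.
split=> [|[|i] il] //; first exact: atom_sub01 akx.
by rewrite iterSr; exact: H.
Qed.

(** Unlike in [sumlevel] the empty word is allowed, so that [level 0] is all of [0, 1] and matches
    u_0 = 1; for n > 0 the two sets agree. *)
Let level n : set R :=
  [set x | exists l, [/\ all (fun m => 0 < m)%N l, sumn l = n & cylinder a l x]].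

Let level0 : level 0 = `[0, 1]%classic.
Proof.
apply/seteqP; split=> x /=.
  by case=> -[|m l]; [case=> _ _ []; rewrite in_itv | case; case: m].
by rewrite in_itv /= => x01; exists [::].
Qed.

Let level_sub01 n : level n `<=` `[0, 1]%classic.
Proof. by move=> x [l [_ _ []]]; rewrite /= in_itv. Qed.

(** Split by the first digit k + 1: the image of the point under that branch has a word of sum n -
    k. *)
Let levelS n : level n.+1 = \big[setU/set0]_(k < n.+1)
  (atom a k.+1 `&` (fun x => (tail a k.+1 - x) / a k.+1) @^-1` level (n - k)).
Proof.
rewrite -(bigcup_mkord n.+1 (fun k => atom a k.+1 `&`
  (fun x => (tail a k.+1 - x) / a k.+1) @^-1` level (n - k))).
apply/seteqP; split=> x.
  case=> -[|[|k] l] [] //= pl; rewrite addSn => -[sl] /cylinder_cons[] // akx cx.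
  have kn : (k <= n)%N by rewrite -sl leq_addr.
  exists k => //; split=> //=; exists l; split=> //.
    by rewrite -sl addKn.
  by rewrite -Lmap_atom.
case=> k /= kn [akx] [l [pl sl cl]]; exists (k.+1 :: l); split=> //=.
  by rewrite sl addSn subnKC.
by apply/cylinder_cons => //; split=> //; rewrite (Lmap_atom _ akx).
Qed.

(** A reflection followed by an increasing affine map, the two cases whose effect on measure is
    known. Once 1 is removed from S, membership in the atom is automatic. *)
Let piece k (S : set R) : (0 < k)%N -> S `<=` `[0, 1]%classic ->
  atom a k `&` (fun x => (tail a k - x) / a k) @^-1` S =
  (-%R : R -> R) @^-1` ((fun x => (a k)^-1 * x + tail a k / a k) @^-1` (S `\ 1)).
Proof.
move=> k0 S01; have e x : (a k)^-1 * - x + tail a k / a k = (tail a k - x) / a k.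
  by rewrite mulrN addrC mulrDl mulNr [x / _]mulrC.
apply/seteqP; split=> x /=; rewrite e.
  move=> [/(atom_itv _ k0) /andP[_ x1] Sx]; split=> //.
  by move=> x1'; move: x1; rewrite x1' ltxx.
move=> [Sx /eqP x1]; split=> //; apply/(atom_itv _ k0).
by have := S01 _ Sx; rewrite /= in_itv /= lt_neqAle => /andP[-> ->]; rewrite x1.
Qed.

Let measurable_affine_preimage (c d : R) (A : set R) : measurable A ->
  measurable ((fun x => c * x + d) @^-1` A).
Proof. by move=> mA; rewrite -[X in measurable X]setTI; exact: measurable_affine. Qed.

Let measurable_level n : measurable (level n) /\ mu (level n) = (renewal a n)%:E.
Proof.
elim/ltn_ind: n => -[_|n IHn].
  rewrite level0; split; first exact: measurable_itv.
  by rewrite lebesgue_measure_itv /= lte_fin ltr01 oppr0 adde0.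
have mD k : measurable (level (n - k) `\ 1).
  by apply: measurableD => //; exact: (IHn _ (leq_subr _ _)).1.
have mB k := measurable_affine_preimage (a k.+1)^-1 (tail a k.+1 / a k.+1) (mD k).
have muD k : mu (level (n - k) `\ 1) = (renewal a (n - k))%:E.
  have [mL <-] := IHn (n - k)%N (leq_subr _ _).
  rewrite (measureDI mu mL (measurable_set1 1)) -[LHS]adde0; congr (_ + _)%E.
  apply/esym/eqP; rewrite eq_le measure_ge0 andbT -(lebesgue_measure_set1 1).
  by apply: le_measure; rewrite ?inE //; exact: measurableI.
pose F k := atom a k.+1 `&`
  (fun x => (tail a k.+1 - x) / a k.+1) @^-1` level (n - k).
have -> : level n.+1 = \big[setU/set0]_(k < n.+1) F k by exact: levelS.
have FE k : F k = (-%R : R -> R) @^-1`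
    ((fun x => (a k.+1)^-1 * x + tail a k.+1 / a k.+1) @^-1` (level (n - k) `\ 1)).
  exact: piece.
have mF k : measurable (F k).
  rewrite FE -[X in measurable X]setTI.
  by apply: oppr_measurable => //.
split; first by rewrite -(bigcup_mkord n.+1 F); exact: bigcup_measurable.
transitivity (\sum_(k < n.+1) mu (F k))%E.
  apply: measure_bigsetU => //.
  apply/trivIsetP => i j _ _ ij; rewrite -subset0 => x [[+ _] [+ _]].
  by move=> aix ajx; move: ij; have [->] := atom_inj (ltn0Sn _) (ltn0Sn _) aix ajx;
    rewrite eqxx.
rewrite renewalS -sumEFin; apply: eq_bigr => k _.
rewrite FE; have := lebesgue_measureN (mB k); rewrite /pushforward => ->.
rewrite lebesgue_measure_affine ?invr_gt0 ?partition_gt0 // invrK.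
by rewrite EFinM -muD.
Qed.

Lemma lam_sumlevelE n : (0 < n)%N -> lam_sumlevel a n = renewal a n.
Proof.
move=> n0; rewrite /lam_sumlevel.
suff -> : sumlevel a n = level n by rewrite (measurable_level n).2.
apply/seteqP; split=> x; first by case=> l [_ pl sl cx]; exists l.
case=> l [pl sl cx]; exists l; split=> //.
by case: l sl {pl cx} => //= n_eq; rewrite -n_eq in n0.
Qed.

End SumLevel.

(** * Renewal identities *)

Section Convolution.
Variable R : comNzRingType.
Implicit Types f g h : nat -> R.

Definition conv f g n : R := \sum_(k < n.+1) f k * g (n - k)%N.

(** Lets commutativity and associativity of convolution be inherited from polynomials. *)
Lemma conv_coef f g N n : (n < N)%N ->
  conv f g n = (\poly_(i < N) f i * \poly_(i < N) g i)`_n.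
Proof.
move=> nN; rewrite coefM; apply: eq_bigr => k _.
by rewrite !coef_poly !ifT // ?(leq_ltn_trans (leq_subr _ _)) //
  (leq_trans (ltn_ord k)).
Qed.

Lemma convC f g n : conv f g n = conv g f n.
Proof. by rewrite !(conv_coef _ _ (ltnSn n)) mulrC. Qed.

Lemma convA f g h n : conv f (conv g h) n = conv (conv f g) h n.
Proof.
pose P f := \poly_(i < n.+1) f i.
transitivity ((P f * P g * P h)`_n); last first.
  rewrite coefM; apply: eq_bigr => k _.
  by rewrite -conv_coef // coef_poly ltnS leq_subr.
rewrite -mulrA coefM; apply: eq_bigr => k _.
by rewrite -conv_coef ?ltnS ?leq_subr // coef_poly ltn_ord.
Qed.

End Convolution.

Section RenewalTheory.
Variables (R : realType) (a : nat -> R).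
Hypothesis a_part : is_partition a.
Local Notation u := (renewal a).
Local Notation t := (tail a).
Local Notation T := (tsum a).

Definition renewal_sum n : R := \sum_(k < n.+1) u k.
Local Notation U := renewal_sum.

Lemma renewal_ge0 n : 0 <= u n.
Proof.
elim/ltn_ind: n => -[_|n IHn]; first by rewrite renewal0.
rewrite renewalS sumr_ge0 // => k _; rewrite mulr_ge0 //.
  exact/ltW/(partition_gt0 a_part).
by rewrite IHn // ltnS leq_subr.
Qed.

(** Since a_k = t_k - t_(k+1), the renewal recursion says that this convolution does not change with
    n. Probabilistically: the last renewal up to time n is at some k, and the gap after it exceeds n
    - k. *)
Lemma renewal_tail n : conv u (fun k => t k.+1) n = 1.
Proof.
elim: n => [|n IHn].
  by rewrite /conv big_ord1 renewal0 mul1r (tail1 a_part).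
rewrite convC /conv big_ord_recl /= (tail1 a_part) mul1r subn0 renewalS -big_split /=.
rewrite -[RHS]IHn convC /conv; apply: eq_bigr => k _.
rewrite /bump /= add1n subSS -mulrDl; congr (_ * _).
by rewrite -(tailS a_part).
Qed.

Lemma renewal_le1 n : u n <= 1.
Proof.
rewrite -(renewal_tail n) /conv big_ord_recr /= subnn (tail1 a_part) mulr1.
rewrite lerDr sumr_ge0 // => k _.
by rewrite mulr_ge0 ?renewal_ge0 ?(tail_ge0 a_part).
Qed.

Lemma tsum0 : T 0 = 0.
Proof. by rewrite /tsum big_geq. Qed.

Lemma tsumS n : T n.+1 = T n + t n.+1.
Proof. by rewrite /tsum big_nat_recr. Qed.

Lemma tsum1 : T 1 = 1.
Proof. by rewrite tsumS tsum0 add0r (tail1 a_part). Qed.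

Lemma tsum_le m n : (m <= n)%N -> T m <= T n.
Proof.
move=> /subnK <-; elim: (n - m)%N => [|d IHd] //.
by apply: le_trans IHd _; rewrite addSn tsumS lerDl (tail_ge0 a_part).
Qed.

Lemma tsum_ge1 n : (0 < n)%N -> 1 <= T n.
Proof. by rewrite -tsum1; exact: tsum_le. Qed.

Lemma tsum_gt0 n : (0 < n)%N -> 0 < T n.
Proof. by move=> n0; rewrite (lt_le_trans ltr01) ?tsum_ge1. Qed.

Lemma tsum_ge0 n : 0 <= T n.
Proof. by rewrite -tsum0 tsum_le. Qed.

(** Summation of u * t = 1; as T 0 = 0, the value is n and not n + 1. *)
Lemma renewal_tsum n : conv u T n = n%:R.
Proof.
elim: n => [|n IHn]; first by rewrite /conv big_ord1 tsum0 mulr0.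
have -> : n.+1%:R = conv u T n + conv u (fun k => t k.+1) n.
  by rewrite IHn renewal_tail natr1.
rewrite /conv big_ord_recr /= subnn tsum0 mulr0 addr0 -big_split /=.
by apply: eq_bigr => k _; rewrite subSn ?leq_ord // tsumS mulrDr.
Qed.

Lemma renewal_sumS n : U n.+1 = U n + u n.+1.
Proof. by rewrite /U big_ord_recr. Qed.

Lemma renewal_sum_tsum n : conv U T n = n%:R * n.+1%:R / 2.
Proof.
elim: n => [|n IHn]; first by rewrite /conv big_ord1 tsum0 mulr0 !mul0r.
have -> : conv U T n.+1 = conv U T n + conv u T n.+1.
  rewrite convC [conv u _ _]convC [conv U _ _]convC /conv.
  rewrite [LHS]big_ord_recr [X in _ = _ + X]big_ord_recr /= addrA -big_split /= subnn.
  congr (_ + _); last by rewrite /U big_ord1.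
  by apply: eq_bigr => k _; rewrite subSn ?leq_ord // renewal_sumS mulrDr.
by rewrite IHn renewal_tsum -!natr1; field.
Qed.

Lemma renewal_sum_le m n : (m <= n)%N -> U m <= U n.
Proof.
move=> /subnK <-; elim: (n - m)%N => [|d IHd] //.
by apply: le_trans IHd _; rewrite addSn renewal_sumS lerDl renewal_ge0.
Qed.

Lemma renewal_sum_ge0 n : 0 <= U n.
Proof. by rewrite sumr_ge0 // => k _; exact: renewal_ge0. Qed.

Lemma renewal_sum_ge n : n%:R <= U n * T n.
Proof.
rewrite -renewal_tsum /conv /U mulr_suml; apply: ler_sum => k _.
by rewrite ler_wpM2l ?renewal_ge0 // tsum_le // leq_subr.
Qed.

(** Evaluate u * T at 2n: for k <= n the factor T(2n - k) is at least T n. *)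
Lemma renewal_sum_le2 n : U n * T n <= 2 * n%:R.
Proof.
rewrite -natrM -renewal_tsum /conv /U mulr_suml.
rewrite (_ : (2 * n).+1 = n.+1 + n)%N; last by rewrite mul2n -addnn addSn.
rewrite big_split_ord /= -[leLHS]addr0; apply: lerD.
  apply: ler_sum => k _; rewrite ler_wpM2l ?renewal_ge0 // tsum_le //.
  by rewrite mul2n -addnn -addnBA ?leq_addr // -ltnS.
by apply: sumr_ge0 => k _; rewrite mulr_ge0 ?renewal_ge0 ?tsum_ge0.
Qed.

(** Averages of t tend to 0 because t does. The first M tails are bounded by 1 each, the later ones
    by e/2. *)
Lemma tsum_over_n (e : R) : 0 < e ->
  exists N, forall n, (N <= n)%N -> T n <= e * n%:R.
Proof.
move=> e0; have e20 : 0 < e / 2 by rewrite divr_gt0.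
have [M HM] := cvgn_dist_lt (tail_cvg0 a_part) e20.
have TM n : T (M + n) <= M%:R + e / 2 * n%:R.
  elim: n => [|n IHn].
    rewrite addn0 mulr0 addr0; elim: M {HM} => [|m IHm]; first by rewrite tsum0.
    by rewrite tsumS -(natr1 m) lerD // (tail_le1 a_part).
  rewrite addnS tsumS -(natr1 n) mulrDr mulr1 addrA lerD //.
  have := HM (M + n).+1 (leqW (leq_addr _ _)).
  by rewrite subr0 ger0_norm ?(tail_ge0 a_part) // => /ltW.
have [K HK] : exists K : nat, M%:R * 2 / e <= K%:R.
  by exists (Num.bound (M%:R * 2 / e)); apply/ltW/archi_boundP;
    rewrite divr_ge0 ?mulr_ge0 // ltW.
exists (M + K)%N => n nM.
have Mn : (M <= n)%N by exact: leq_trans (leq_addr _ _) nM.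
have Kn : (K <= n)%N by exact: leq_trans (leq_addl _ _) nM.
have := TM (n - M)%N; rewrite subnKC // => /le_trans; apply.
have h1 : M%:R <= e / 2 * n%:R.
  rewrite -ler_pdivrMl // invf_div mulrC mulrA; apply: le_trans HK _.
  by rewrite ler_nat.
have h2 : e / 2 * (n - M)%:R <= e / 2 * n%:R by rewrite ler_pM2l // ler_nat leq_subr.
by lra.
Qed.

Lemma renewal_sum_unbounded (A : R) :
  exists N, forall n, (N <= n)%N -> A <= U n.
Proof.
pose B := `|A| + 1.
have B0 : 0 < B by rewrite ltr_wpDl.
have [N HN] := tsum_over_n (e := B^-1) ltac:(by rewrite invr_gt0).
exists (maxn N 1) => n; rewrite geq_max => /andP[/HN Tn n1].
have n0 : 0 < n%:R :> R by rewrite ltr0n.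
apply: (@le_trans _ _ B); first by rewrite /B ler_wpDr // ler_norm.
have := le_trans (renewal_sum_ge n) (ler_wpM2l (renewal_sum_ge0 n) Tn).
by rewrite mulrA ler_pMl // ler_pdivlMr // mul1r.
Qed.

End RenewalTheory.

(** * The renewal theorem *)

Section RenewalLimit.
Variables (R : realType) (a : nat -> R).
Hypothesis a_part : is_partition a.
Local Notation u := (renewal a).
Local Notation t := (tail a).
Local Notation T := (tsum a).

Lemma tail_sum m n : (m <= n)%N ->
  \sum_(m <= k < n) a k.+1 = t m.+1 - t n.+1.
Proof.
move=> /subnKC <-; elim: (n - m)%N => [|d IHd]; first by rewrite addn0 big_geq // subrr.
rewrite addnS big_nat_recr ?leq_addr //= IHd (tailS a_part (n := (m + d).+1)) //.
by ring.
Qed.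

(** L is the limsup of w, taken as the infimum of its eventual upper bounds. *)
Lemma bounded_limsup (w : nat -> R) : (forall n, `|w n| <= 1) ->
  exists L : R, [/\ -1 <= L <= 1,
    (forall e, 0 < e -> exists N, forall n, (N <= n)%N -> w n < L + e) &
    (forall e N, 0 < e -> exists2 n, (N <= n)%N & L - e < w n)].
Proof.
move=> w1; have wl n : -1 <= w n by have := w1 n; rewrite ler_norml => /andP[].
have wu n : w n <= 1 by have := w1 n; rewrite ler_norml => /andP[].
pose E := [set x : R | exists N, forall n, (N <= n)%N -> w n <= x].
have E1 : E 1 by exists 0%N.
have lbE : lbound E (-1) by move=> x [N /(_ N (leqnn N))]; exact: le_trans.
have hi : has_inf E by split; [exists 1 | exists (-1)].
exists (inf E); split.
- by rewrite (lb_le_inf _ lbE) /=; [exact: ge_inf (ex_intro _ _ lbE) _ E1 | exists 1].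
- move=> e e0; have [x [N HN] xe] := inf_adherent e0 hi.
  by exists N => n /HN /le_lt_trans; apply.
- move=> e N e0; apply: contrapT => H.
  have : E (inf E - e).
    exists N => n Nn; rewrite leNgt; apply/negP => wn; apply: H.
    by exists n.
  by move=> /(ge_inf (ex_intro _ _ lbE)); rewrite lerDl oppr_ge0 leNgt e0.
Qed.

(* A time where w is close to its limsup is, by the recursion, preceded by
   such times: the average of earlier values can only be that large if the
   value one step before, which carries the weight a 1 > 0, is. *)
Lemma limsup_backwards (w : nat -> R) : (forall n, `|w n| <= 1) ->
  (forall n, w n.+1 = \sum_(k < n.+1) a k.+1 * w (n - k)%N) ->
  exists L : R,
    (forall e, 0 < e -> exists N, forall n, (N <= n)%N -> w n < L + e) /\
    (forall J e N, 0 < e ->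
       exists2 n, (N <= n)%N & forall i, (i <= J)%N -> L - e < w (n - i)%N).
Proof.
move=> w1 wS; have [L [/andP[L1 L2] wL Lw]] := bounded_limsup w1.
have wu n : w n <= 1 by have := w1 n; rewrite ler_norml => /andP[].
exists L; split=> // J; elim: J => [|J IHJ] e N e0.
  have [n Nn wn] := Lw e N e0; exists n => // i; rewrite leqn0 => /eqP ->.
  by rewrite subn0.
have a1 : 0 < a 1 by exact: (partition_gt0 a_part).
have a1le : a 1 <= 1.
  rewrite -(tail1 a_part) [leRHS](tailS a_part) // lerDl.
  exact: (tail_ge0 a_part).
(* The errors collected below add up to at most 5 e', and dividing by the weight a 1 has to leave
   less than e. *)
pose e' := e * a 1 / 8.
have e'0 : 0 < e' by rewrite !mulr_gt0 // invr_gt0.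
have e'e : e' <= e.
  by rewrite /e' -mulrA ler_piMr ?(ltW e0) // ler_pdivrMr // mul1r; lra.
have [N0 HN0] := wL e' e'0.
have [M HM] := cvgn_dist_lt (tail_cvg0 a_part) e'0.
have [n] := IHJ e' (N + N0 + M + J.+1)%N e'0.
move=> nN Hn; exists n => [|i]; first by lia.
rewrite leq_eqVlt => /predU1P[->|iJ]; last first.
  by apply: le_lt_trans (Hn i iJ); rewrite lerD2l lerN2.
have [m nE] : exists m, (n - J = m.+1)%N by exists (n - J).-1; lia.
have -> : (n - J.+1 = m)%N by lia.
have wm := Hn J (leqnn J); rewrite nE in wm.
(* For k <= q the index m - k is at least N0, so [F k] is nonnegative; the k beyond q have total
   weight at most t_(q+2) <= e'. *)
pose q := (m - N0)%N.
pose F k := a k.+1 * (L + e' - w (m - k)%N).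
have FE : \sum_(0 <= k < m.+1) F k = (L + e') * (1 - t m.+2) - w m.+1.
  rewrite wS -(big_mkord xpredT (fun k => a k.+1 * w (m - k)%N)).
  rewrite -(tail1 a_part) -tail_sum // mulrC mulr_suml -sumrB.
  by apply: eq_bigr => k _; rewrite /F mulrBr.
have tM k : (M <= k)%N -> t k <= e'.
  by move=> /HM; rewrite subr0 => /ltW; apply: le_trans; rewrite ler_norm.
have F1 : a 1 * (L + e' - w m) <= \sum_(0 <= k < q.+1) F k.
  rewrite big_nat_recl //= {1}/F subn0 lerDl big_nat sumr_ge0 // => k kq.
  rewrite mulr_ge0 ?(ltW (partition_gt0 a_part _)) // subr_ge0 ltW // HN0 //.
  by rewrite /q in kq; lia.
have F2 : - (2 * e') <= \sum_(q.+1 <= k < m.+1) F k.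
  apply: (@le_trans _ _ (\sum_(q.+1 <= k < m.+1) (-2 * a k.+1))).
    rewrite -mulr_sumr tail_sum; last by rewrite /q; lia.
    have := tM q.+2 ltac:(rewrite /q; lia).
    by have := tail_ge0 a_part (ltn0Sn m.+1); lra.
  apply: ler_sum => k _; rewrite mulrC ler_pM2l ?(partition_gt0 a_part) //.
  by have := wu (m - k)%N; lra.
have := FE; rewrite (@big_cat_nat _ _ _ q.+1) //=; last by rewrite /q; lia.
move=> FE'.
have tm := tM m.+2 ltac:(lia).
have tm0 := tail_ge0 a_part (ltn0Sn m.+1).
have LT : (L + e') * (1 - t m.+2) <= L + e' + e'.
  have : (1 + (L + e')) * t m.+2 >= 0 by apply: mulr_ge0 => //; lra.
  by lra.
have H : a 1 * (L - w m) < a 1 * e.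
  have -> : a 1 * e = 8 * e' by rewrite /e'; field.
  have a1e : 0 <= a 1 * e' by rewrite mulr_ge0 // ltW.
  by lra.
by move: H; rewrite ltr_pM2l //; lra.
Qed.

(** At a late time m preceded by a window of values above L - e1, keep only the terms of u * t = 1
    in that window: L times the partial sum of t is then at most about 1. *)
Lemma renewal_limsup J (e : R) : 0 < e ->
  exists N, forall n, (N <= n)%N -> u n * T J <= 1 + e.
Proof.
move=> e0; case: J => [|J].
  by exists 0%N => n _; rewrite tsum0 mulr0; lra.
have u1 n : `|u n| <= 1 by rewrite ger0_norm ?renewal_ge0 // renewal_le1.
have [L [uL Lu]] := limsup_backwards u1 (renewalS a).
have TJ : 0 < T J.+1 by exact: tsum_gt0.
pose e1 := e / (2 * T J.+1).
have e10 : 0 < e1 by rewrite divr_gt0 // mulr_gt0.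
have [N HN] := uL e1 e10; exists N => n /HN un.
have [m Jm um] := Lu J e1 J.+1 e10.
have : (L - e1) * T J.+1 <= 1.
  rewrite -(renewal_tail a_part m) convC /conv.
  rewrite -(big_mkord xpredT (fun k => t k.+1 * u (m - k)%N)).
  rewrite (@big_cat_nat _ _ _ J.+1) //=; last exact: leqW.
  rewrite -[leLHS]addr0 lerD //; last first.
    by rewrite sumr_ge0 // => k _; rewrite mulr_ge0 ?renewal_ge0 ?(tail_ge0 a_part).
  rewrite /tsum big_add1 /= mulr_sumr [leLHS]big_nat [leRHS]big_nat; apply: ler_sum => k /andP[_ kJ].
  by rewrite mulrC ler_wpM2l ?(tail_ge0 a_part) // ltW // um.
have -> : 1 + e = 1 + 2 * e1 * T J.+1 by rewrite /e1; field; rewrite gt_eqF.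
by have : u n * T J.+1 <= (L + e1) * T J.+1 by [rewrite ler_pM2r // ltW]; lra.
Qed.

(** The argument of [renewal_limsup] for -u, which satisfies the same recursion. Now the terms
    outside the window must be bounded above: by u <= 1 they add up to at most mu - T(J + 1), which
    is small. *)
Lemma renewal_liminf (mu e : R) : T @ \oo --> mu -> 0 < e ->
  exists N, forall n, (N <= n)%N -> 1 - e <= u n * mu.
Proof.
move=> Tmu e0.
have Tle n : T n <= mu.
  apply: (cvgr_to_ge Tmu); exists n => // m /= nm; exact: tsum_le.
have mu0 : 0 < mu by apply: lt_le_trans (Tle 1%N); exact: tsum_gt0.
have w1 n : `|- u n| <= 1 by rewrite normrN ger0_norm ?renewal_ge0 // renewal_le1.
have wS n : - u n.+1 = \sum_(k < n.+1) a k.+1 * - u (n - k)%N.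
  by rewrite renewalS -sumrN; apply: eq_bigr => k _; rewrite mulrN.
have [L [uL Lu]] := limsup_backwards w1 wS.
pose e1 := e / (3 * mu).
have e10 : 0 < e1 by rewrite divr_gt0 // mulr_gt0.
have [J HJ] := cvgn_dist_lt Tmu (e := e / 3) ltac:(by rewrite divr_gt0).
have muT : mu - T J.+1 <= e / 3.
  by have := HJ J.+1 (leqnSn J); rewrite distrC => /ltW; apply: le_trans; rewrite ler_norm.
have [N HN] := uL e1 e10; exists N => n /HN un.
have [m Jm um] := Lu J e1 J.+1 e10.
have l0 : 0 <= - L + e1.
  by have := um 0%N isT; have := renewal_ge0 a_part (m - 0)%N; lra.
have : 1 <= (- L + e1) * mu + e / 3.
  rewrite -[leLHS](renewal_tail a_part m) convC /conv.
  rewrite -(big_mkord xpredT (fun k => t k.+1 * u (m - k)%N)).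
  rewrite (@big_cat_nat _ _ _ J.+1) //=; last exact: leqW.
  apply: (@le_trans _ _ ((- L + e1) * T J.+1 + (mu - T J.+1))).
    apply: lerD.
      rewrite [T _]/tsum big_add1 /= mulr_sumr [leLHS]big_nat [leRHS]big_nat.
      apply: ler_sum => k /andP[_ kJ]; rewrite mulrC.
      by rewrite ler_wpM2r ?(tail_ge0 a_part) //; have := um k kJ; lra.
    apply: (@le_trans _ _ (T m.+1 - T J.+1)); last by rewrite lerD2r.
    rewrite /tsum [\sum_(1 <= _ < m.+2) _]big_add1 [\sum_(1 <= _ < J.+2) _]big_add1 /= (@big_cat_nat _ _ _ J.+1 0 m.+1) //=; last exact: leqW.
    rewrite [leRHS]addrC addKr; apply: ler_sum => k _.
    by rewrite ler_piMr ?(tail_ge0 a_part) ?renewal_le1.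
  by rewrite lerD // ler_wpM2l.
have : (- L - e1) * mu <= u n * mu by rewrite ler_pM2r //; lra.
have -> : e = 3 * (e1 * mu) by rewrite /e1; field; rewrite gt_eqF.
by lra.
Qed.

Lemma renewal_cvg_finite (mu : R) : T @ \oo --> mu -> u @ \oo --> mu^-1.
Proof.
move=> Tmu.
have Tle n : T n <= mu.
  apply: (cvgr_to_ge Tmu); exists n => // m /= nm; exact: tsum_le.
have mu0 : 0 < mu by apply: lt_le_trans (Tle 1%N); exact: tsum_gt0.
apply: dist_lt_cvgn => e e0.
pose e1 := e * mu / 4; have e10 : 0 < e1 by rewrite divr_gt0 // mulr_gt0.
have [N1 H1] := renewal_liminf Tmu e10.
have [J HJ] := cvgn_dist_lt Tmu e10.
have [N2 H2] := renewal_limsup J e10.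
exists (maxn N1 N2) => n; rewrite geq_max => /andP[/H1 h1 /H2 h2].
have muT : mu - T J < e1.
  by have := HJ J (leqnn J); rewrite distrC; apply: le_lt_trans; rewrite ler_norm.
rewrite -(ltr_pM2r mu0) -{2}(gtr0_norm mu0) -normrM mulrBl mulVf ?gt_eqF //.
have -> : e * mu = 4 * e1 by rewrite /e1; field.
have h3 : u n * (mu - T J) <= e1.
  apply: le_trans (ltW muT); rewrite ler_piMl ?renewal_le1 //.
  by rewrite subr_ge0.
by rewrite ltr_norml; apply/andP; split; lra.
Qed.

Lemma tsum_unbounded (A : R) : ~ finite_type a ->
  exists N, forall n, (N <= n)%N -> A <= T n.
Proof.
move=> infT; apply: contrapT => H; apply: infT.
have Tnd : nondecreasing_seq T by move=> m n; exact: tsum_le.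
apply: (nondecreasing_is_cvgn Tnd); exists A => _ [n _ <-].
rewrite leNgt; apply/negP => An; apply: H; exists n => m nm.
by apply: le_trans (ltW An) _; exact: tsum_le.
Qed.

Lemma renewal_cvg_infinite : ~ finite_type a -> u @ \oo --> (0 : R).
Proof.
move=> infT; apply: dist_lt_cvgn => e e0.
have [J HJ] := tsum_unbounded (3 / e) infT.
have [N HN] := renewal_limsup J ltr01; exists N => n /HN un.
rewrite subr0 ger0_norm ?renewal_ge0 //.
have : u n * (3 / e) <= 2.
  by apply: le_trans un; rewrite ler_wpM2l ?renewal_ge0 // HJ.
by rewrite mulrA ler_pdivrMr //; have := renewal_ge0 a_part n; lra.
Qed.

End RenewalLimit.

(** * Gamma and Beta integrals *)

Section GammaFunction.
Variable R : realType.
Local Notation mu := (@lebesgue_measure R).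
Local Notation M := (measurableTypeR R).
Local Open Scope ereal_scope.

Lemma ge0_integral_affine (c d : R) (f : R -> \bar R) : (0 < c)%R ->
  measurable_fun [set: R] f -> (forall x, 0 <= f x) ->
  \int[mu]_x f x = c%:E * \int[mu]_x f (c * x + d)%R.
Proof.
move=> c0 mf f0.
have mphi : measurable_fun [set: M] (fun x : M => (c * x + d)%R : M).
  exact: measurable_affine.
have ci0 : (0 <= c^-1)%R by rewrite invr_ge0 ltW.
have -> : \int[mu]_x f (c * x + d)%R = c^-1%:E * \int[mu]_x f x.
  rewrite -(@ge0_integral_mscale _ _ _ mu _ measurableT (NngNum ci0)) //.
  transitivity (\int[pushforward mu (fun x : M => (c * x + d)%R : M)]_y f y).
    rewrite (ge0_integral_pushforward mphi mu measurableT) //.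
  apply: eq_measure_integral => A mA _.
  exact: lebesgue_measure_affine.
by rewrite muleA -EFinM divff ?gt_eqF // mul1e.
Qed.

(** Extended real valued, so that Tonelli applies before finiteness is known, and over the whole
    line, so that affine substitutions leave the domain unchanged. *)
Definition gammaE (s : R) : \bar R :=
  \int[mu]_x (if (0 < x)%R then x `^ (s - 1) * expR (- x) else 0)%R%:E.

Lemma GammaE s : Gamma s = fine (gammaE s).
Proof.
congr fine; rewrite integral_mkcond; apply: eq_integral => x _.
by rewrite patchE mem_setE in_itv /= andbT; case: ifP.
Qed.

Lemma measurable_gt0_if d (T : measurableType d) (g : T -> R) (f : T -> R) :
  measurable_fun [set: T] g -> measurable_fun [set: T] f ->
  measurable_fun [set: T] (fun x => if (0 < g x)%R then f x else 0%R).
Proof.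
move=> mg mf; apply: measurable_fun_ifT => //; exact: measurable_fun_ltr.
Qed.

Lemma measurable_power_exp (s : R) :
  measurable_fun [set: R] (fun x : R => x `^ s * expR (- x))%R.
Proof.
apply: measurable_funM; first exact: measurable_powR.
by apply: measurableT_comp => //; exact: oppr_measurable.
Qed.

Lemma measurable_exp_opp : measurable_fun [set: R] (fun x : R => expR (- x))%R.
Proof. by apply: measurableT_comp => //; exact: oppr_measurable. Qed.

(** The integrand is the density of the exponential law of rate 1. *)
Lemma gammaE1 : gammaE 1 = 1.
Proof.
rewrite -(@integral_exponential_pdf R 1 ltr01) /gammaE.
have -> : (fun x : R => (exponential_pdf 1 x)%:E) =
    (fun x => (expR (- x))%:E) \_ `[0%R, +oo[%classic.
  apply/funext => x; rewrite /exponential_pdf !patchE /=.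
  by case: ifP => _ //; rewrite mul1r mulN1r.
rewrite -integral_mkcond -integral_itv_obnd_cbnd; last first.
  by apply/measurable_EFinP/measurable_funTS; exact: measurable_exp_opp.
rewrite [RHS]integral_mkcond; apply: eq_integral => x _.
rewrite patchE mem_setE in_itv /= andbT subrr.
by case: ifP => // _; rewrite powRr0 mul1r.
Qed.

Lemma integral_exp_tail (x : R) :
  \int[mu]_y (if (x < y)%R then expR (- y) else 0)%R%:E = (expR (- x))%:E.
Proof.
have m1 : measurable_fun [set: R]
    (fun y : R => (if (x < y)%R then expR (- y) else 0)%R%:E).
  rewrite (_ : (fun y => _) =
    (fun y => (if (0 < y - x)%R then expR (- y) else 0)%R%:E)); last first.
    by apply/funext => y; rewrite subr_gt0.
  apply/measurable_EFinP/measurable_gt0_if; last exact: measurable_exp_opp.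
  by apply: measurable_funB.
rewrite (ge0_integral_affine x ltr01 m1) => [|y]; last first.
  by rewrite lee_fin; case: ifP => // _; exact: expR_ge0.
have m2 : measurable_fun [set: R]
    (fun y : R => (if (0 < y)%R then y `^ (1 - 1) * expR (- y) else 0)%R%:E).
  by apply/measurable_EFinP/measurable_gt0_if => //; exact: measurable_power_exp.
rewrite mul1e -[RHS]mule1 -gammaE1 /gammaE.
rewrite -(ge0_integralZl mu measurableT m2) ?lee_fin ?expR_ge0 //; last first.
  by move=> y _; rewrite lee_fin; case: ifP => // _; rewrite mulr_ge0 ?powR_ge0 ?expR_ge0.
apply: eq_integral => y _; rewrite mul1r ltrDr -EFinM subrr powRr0 mul1r.
by case: ifP => // _; rewrite ?mulr0 // opprD expRD mulrC.
Qed.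

Lemma continuous_powR_gt0 (p x : R) : (0 < x)%R ->
  {for x, continuous (fun y : R => y `^ p)%R}.
Proof.
move=> x0; apply: differentiable_continuous; apply/derivable1_diffP.
by have [] := is_derive1_powR p x0.
Qed.

(** For th < 1 the integrand blows up at 0, so the fundamental theorem of calculus is applied on
    [1/(n + 2), 1] and monotone convergence does the rest. *)
Lemma integral_power01 (th : R) : (0 < th)%R ->
  \int[mu]_x (if (0 < x)%R then (if (x < 1)%R then th * x `^ (th - 1) else 0)
              else 0)%R%:E = 1.
Proof.
move=> th0.
pose f (x : R) := (th * x `^ (th - 1))%R.
have mf : measurable_fun [set: R] f.
  by apply: measurable_funM => //; exact: measurable_powR.
have f0 x : (0 <= f x)%R by rewrite mulr_ge0 ?powR_ge0 // ltW.
pose F (n : nat) := `[(n.+2%:R^-1)%R, 1%R]%classic : set R.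
have FU : \bigcup_n F n = `]0%R, 1%R]%classic.
  apply/seteqP; split => x.
    case=> n _; rewrite /F /= !in_itv /= => /andP[nx ->]; rewrite andbT.
    by apply: lt_le_trans nx; rewrite invr_gt0.
  rewrite /= in_itv /= => /andP[x0 x1]; exists (Num.bound (x^-1)%R) => //.
  rewrite /F /= in_itv /= x1 andbT -[leRHS]invrK lef_pV2 ?posrE ?invr_gt0 //.
  have := archi_boundP (ltW (_ : 0 < x^-1)%R); rewrite invr_gt0 => /(_ x0) h.
  by apply: ltW (lt_le_trans h _); rewrite ler_nat; lia.
have cf : {in `]0%R, +oo[, continuous f}.
  move=> x; rewrite in_itv /= andbT => x0.
  apply: (@cvgM _ _ _ _ (fun=> th) (fun x => x `^ (th - 1))%R); first exact: cvg_cst.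
  exact: continuous_powR_gt0.
have FI n : \int[mu]_(x in F n) (f x)%:E = (1 - (n.+2%:R^-1) `^ th)%R%:E.
  have n0 : (0 < n.+2%:R^-1 :> R)%R by rewrite invr_gt0.
  have n1 : (n.+2%:R^-1 < 1 :> R)%R by rewrite invf_lt1 // ltr1n.
  have D (x : R) : (0 < x)%R -> is_derive x 1%R (fun x : R => x `^ th)%R (f x).
    by move=> x0; exact: is_derive1_powR.
  transitivity ((1 `^ th)%R%:E - ((n.+2%:R^-1) `^ th)%R%:E); last by rewrite powR1 EFinB.
  apply: (continuous_FTC2 (F := fun x : R => (x `^ th)%R)) => //.
  - apply: continuous_in_subspaceT => x; rewrite inE /= in_itv /= => /andP[nx _].
    by apply: cf; rewrite in_itv /= andbT (lt_le_trans n0).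
  - split.
    + move=> x; rewrite in_itv /= => /andP[nx _].
      by have [] := D x (lt_trans n0 nx).
    + by apply: cvg_at_right_filter; exact: continuous_powR_gt0.
    + by apply: cvg_at_left_filter; exact: continuous_powR_gt0.
  - move=> x; rewrite in_itv /= => /andP[nx _]; rewrite derive1E.
    by have [_ ->] := D x (lt_trans n0 nx).
have ndF : {homo F : n m / (n <= m)%N >-> (n <= m)%O}.
  move=> n m nm; rewrite subsetEset; apply: subset_itvr.
  by rewrite bnd_simp lef_pV2 ?posrE // ler_nat.
have c1 : (fun n => \int[mu]_(x in F n) (f x)%:E) @ \oo -->
    \int[mu]_(x in `]0%R, 1%R]) (f x)%:E.
  rewrite -FU; apply: ge0_nondecreasing_set_cvg_integral => //.
  - by move=> n; exact: measurable_itv.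
  - by move=> n; apply/measurable_EFinP; exact: measurable_funTS.
  - by move=> n x _; rewrite lee_fin.
have c2 : (fun n => \int[mu]_(x in F n) (f x)%:E) @ \oo --> 1%:E.
  rewrite (_ : (fun n => _) = (fun n => (1 - (n.+2%:R^-1) `^ th)%R%:E)); last first.
    by apply/funext => n; rewrite -FI.
  apply: cvg_EFin; first by near=> n.
  rewrite /comp /= -[X in _ --> X]subr0; apply: cvgB; first exact: cvg_cst.
  have /cvg_at_rightP := powR_cvg0 th0; apply.
  split=> [n|]; first by rewrite invr_gt0.
  have := @cvg_harmonic R; rewrite -cvg_shiftS; exact: cvg_trans.
have h := cvg_unique (@ereal_hausdorff R) c1 c2.
rewrite -[RHS]h -[RHS]integral_itv_bndo_bndc; last first.
  by apply/measurable_EFinP; exact: measurable_funTS.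
rewrite [RHS]integral_mkcond; apply: eq_integral => x _.
by rewrite patchE mem_setE in_itv /=; case: ifP => //= _; case: ifP.
Unshelve. all: by end_near. Qed.

End GammaFunction.

Section BetaGamma.
Variable R : realType.
Local Notation mu := (@lebesgue_measure R).
Local Notation M := (measurableTypeR R).
Local Open Scope ereal_scope.

Let measurable_pow d (T : measurableType d) (g : T -> R) (s : R) :
  measurable_fun [set: T] g -> measurable_fun [set: T] (fun x => g x `^ s)%R.
Proof. by move=> mg; exact: (measurableT_comp (measurable_powR s) mg). Qed.

Let measurable_expN d (T : measurableType d) (g : T -> R) :
  measurable_fun [set: T] g -> measurable_fun [set: T] (fun x => expR (- g x))%R.
Proof. by move=> mg; apply: (measurableT_comp (f := expR)) => //; exact: measurable_funN. Qed.

Let ge0_integral_scalee (k : \bar R) (f : R -> R) : 0 <= k ->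
  measurable_fun [set: R] f -> (forall x, 0 <= f x)%R ->
  \int[mu]_x (k * (f x)%:E) = k * \int[mu]_x (f x)%:E.
Proof.
move=> k0 mf f0; apply: (@ge0_integralZl _ _ _ mu _ measurableT (EFin \o f)) => //.
- exact/measurable_EFinP.
- by move=> x _; rewrite lee_fin.
Qed.

Let ge0_integral_scale (k : R) (f g : R -> R) : (0 <= k)%R ->
  measurable_fun [set: R] f -> (forall x, 0 <= f x)%R ->
  (forall x, g x = k * f x)%R ->
  \int[mu]_x (g x)%:E = k%:E * \int[mu]_x (f x)%:E.
Proof.
move=> k0 mf f0 gf; rewrite -ge0_integral_scalee ?lee_fin //.
by apply: eq_integral => x _; rewrite gf EFinM.
Qed.

Let gam (s x : R) := (if (0 < x)%R then x `^ (s - 1) * expR (- x) else 0)%R.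

Let measurable_gam s : measurable_fun [set: R] (gam s).
Proof. by apply: measurable_gt0_if => //; exact: measurable_power_exp. Qed.

Let gam_ge0 s x : (0 <= gam s x)%R.
Proof. by rewrite /gam; case: ifP => // _; rewrite mulr_ge0 ?powR_ge0 ?expR_ge0. Qed.

Let pw (th y x : R) :=
  (if (0 < x)%R then (if (x < y)%R then th * x `^ (th - 1) else 0) else 0)%R.

Let measurable_pw th y : measurable_fun [set: R] (pw th y).
Proof.
apply: measurable_gt0_if => //.
under eq_fun do rewrite -subr_gt0.
apply: measurable_gt0_if; first by apply: measurable_funB.
by apply: measurable_funM => //; exact: measurable_pow.
Qed.

Let pw_ge0 th y x : (0 < th)%R -> (0 <= pw th y x)%R.
Proof.
move=> th0; rewrite /pw; case: ifP => // _; case: ifP => // _.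
by rewrite mulr_ge0 ?powR_ge0 // ltW.
Qed.

Lemma integral_power (th y : R) : (0 < th)%R ->
  \int[mu]_x (if (0 < x)%R then (if (x < y)%R then th * x `^ (th - 1) else 0)
              else 0)%R%:E = (if (0 < y)%R then y `^ th else 0)%R%:E.
Proof.
move=> th0; have [y0|y0] := ltP 0%R y; last first.
  apply: integral0_eq => x _.
  by case: ifPn => // x0; rewrite ifF //; apply/negbTE; rewrite -leNgt;
    exact: le_trans y0 (ltW x0).
have mg : measurable_fun [set: R] (fun x => (pw th y x)%:E).
  by apply/measurable_EFinP; exact: measurable_pw.
have g0 x : 0 <= (pw th y x)%:E by rewrite lee_fin pw_ge0.
rewrite (ge0_integral_affine 0%R y0 mg g0).
rewrite (@ge0_integral_scale (y `^ (th - 1))%R (pw th 1)).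
- rewrite (integral_power01 th0) mule1 -EFinM; congr EFin.
  have yn : y != 0%R by rewrite gt_eqF.
  rewrite -[X in (X * _)%R](powRr1 (ltW y0)) -powRD ?yn ?implybT //.
  by rewrite addrC subrK.
- exact: powR_ge0.
- exact: measurable_pw.
- by move=> x; exact: pw_ge0.
- move=> x; rewrite /pw addr0 pmulr_rgt0 // gtr_pMr //.
  case: ifPn => [x0|]; last by rewrite mulr0.
  by case: ifP => _; rewrite ?mulr0 // powRM ?(ltW y0) ?(ltW x0) // mulrCA.
Qed.

(** Tonelli for th x^(th-1) e^(-y) on 0 < x < y instead of an integration by parts: the inner
    integral is an exponential tail in one order and y^th in the other. *)
Lemma gammaE_rec (th : R) : (0 < th)%R -> gammaE (1 + th) = th%:E * gammaE th.
Proof.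
move=> th0.
pose f (z : M * M) := (if (0 < z.1)%R then
  (if (0 < z.2 - z.1)%R then th * z.1 `^ (th - 1) * expR (- z.2) else 0) else 0)%R%:E.
have mf : measurable_fun [set: M * M] f.
  apply/measurable_EFinP; apply: measurable_gt0_if => //.
  apply: measurable_gt0_if; first exact: measurable_funB.
  by apply: measurable_funM; [apply: measurable_funM => //; exact: measurable_pow
    | exact: measurable_expN].
have f0 z : 0 <= f z.
  rewrite lee_fin; case: ifP => // _; case: ifP => // _.
  by rewrite !mulr_ge0 ?powR_ge0 ?expR_ge0 // ltW.
have fub := @fubini_tonelli _ _ M M R mu mu f mf f0.
have lhs : \int[mu]_x \int[mu]_y f (x, y) = th%:E * gammaE th.
  clear f0 mf fub; rewrite -(@ge0_integral_scale th (gam th) (fun x => th * gam th x)%R);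
    [|exact: ltW|exact: measurable_gam|exact: gam_ge0|by []].
  apply: eq_integral => x _; rewrite /f /gam /=; case: ifPn => x0; last first.
    by rewrite mulr0; exact: integral0.
  have me : measurable_fun [set: R]
      (fun y => (if (x < y)%R then expR (- y) else 0)%R).
    under eq_fun do rewrite -subr_gt0.
    apply: measurable_gt0_if; first by apply: measurable_funB.
    exact: measurable_expN.
  have e1 := integral_exp_tail x.
  transitivity ((th * x `^ (th - 1))%:E *
      \int[mu]_y (if (x < y)%R then expR (- y) else 0)%R%:E); last first.
    by rewrite e1 -EFinM mulrA.
  apply: ge0_integral_scale; [|exact: me| |].
  + exact: mulr_ge0 (ltW th0) (powR_ge0 _ _).
  + by move=> y; case: ifP => _; [exact: expR_ge0|exact: lexx].
  + by move=> y; rewrite subr_gt0; case: ifP => _; rewrite ?mulr0.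
apply: etrans (etrans (esym fub) lhs); clear f0 mf fub lhs; apply: eq_integral => y _.
transitivity ((expR (- y))%:E * (if (0 < y)%R then y `^ th else 0)%R%:E).
  rewrite -EFinM (_ : 1 + th - 1 = th)%R; last by ring.
  by case: ifP => _; rewrite ?mulr0 // mulrC.
have e1 := integral_power y th0.
apply: etrans (congr1 (mule (expR (- y))%:E) (esym e1)) _.
apply/esym/ge0_integral_scale.
- exact: expR_ge0.
- exact: measurable_pw.
- by move=> x; exact: pw_ge0.
- move=> x; rewrite /= subr_gt0.
  by case: ifP => _; rewrite ?mulr0 //; case: ifP => _; rewrite ?mulr0 // mulrC.
Qed.

Let bet (a b z x : R) := (if (0 < x)%R then
  (if (0 < z - x)%R then x `^ (a - 1) * (z - x) `^ (b - 1) else 0) else 0)%R.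

Definition betaE (a b : R) : \bar R := \int[mu]_x (if (0 < x)%R then
  (if (0 < 1 - x)%R then x `^ (a - 1) * (1 - x) `^ (b - 1) else 0) else 0)%R%:E.

Let measurable_bet (a b z : R) : measurable_fun [set: R] (bet a b z).
Proof.
apply: measurable_gt0_if => //.
have mz : measurable_fun [set: R] (fun x : R => z - x)%R by apply: measurable_funB.
apply: measurable_gt0_if => //.
by apply: measurable_funM; exact: measurable_pow.
Qed.

Let bet_ge0 (a b z x : R) : (0 <= bet a b z x)%R.
Proof.
by rewrite /bet; case: ifP => // _; case: ifP => // _; rewrite mulr_ge0 ?powR_ge0.
Qed.

Let bet_scale (a b z : R) : \int[mu]_x (bet a b z x)%:E =
  (if (0 < z)%R then z `^ (a + b - 1) else 0)%R%:E * betaE a b.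
Proof.
have [z0|z0] := ltP 0%R z; last first.
  rewrite mul0e; apply: integral0_eq => x _; rewrite /bet.
  by case: ifPn => // x0; rewrite ifF // ltNge subr_le0 (le_trans z0) // ltW.
have mb : measurable_fun [set: R] (fun x => (bet a b z x)%:E).
  by apply/measurable_EFinP; exact: measurable_bet.
have b0 x : 0 <= (bet a b z x)%:E by rewrite lee_fin bet_ge0.
rewrite (ge0_integral_affine 0%R z0 mb b0).
rewrite (@ge0_integral_scale (z `^ (a - 1) * z `^ (b - 1))%R (bet a b 1)).
- rewrite muleA -EFinM; congr (_%:E * _).
  have zn : z != 0%R by rewrite gt_eqF.
  rewrite -[X in (X * _)%R](powRr1 (ltW z0)) -!powRD ?zn ?implybT //.
  by congr (_ `^ _)%R; ring.
- by rewrite mulr_ge0 ?powR_ge0.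
- exact: measurable_bet.
- exact: bet_ge0.
- move=> x; rewrite /bet addr0 pmulr_rgt0 // -[X in (0 < X - z * x)%R]mulr1 -mulrBr.
  rewrite pmulr_rgt0 //; case: ifPn => [x0|]; last by rewrite mulr0.
  case: ifPn => [x1|]; last by rewrite mulr0.
  rewrite -[X in ((X - z * x) `^ _)%R]mulr1 -mulrBr.
  by rewrite !powRM ?(ltW z0) ?(ltW x0) ?(ltW x1) // mulrACA.
Qed.

(** Tonelli for x^(a-1) (z-x)^(b-1) e^(-z) on 0 < x < z. A shift of z by x separates the variables
    in one order; rescaling x by z gives the Beta integral in the other. *)
Lemma gammaE_beta (a b : R) : gammaE a * gammaE b = betaE a b * gammaE (a + b).
Proof.
pose f (w : M * M) := (if (0 < w.1)%R then
  (if (0 < w.2 - w.1)%R then w.1 `^ (a - 1) * (w.2 - w.1) `^ (b - 1) * expR (- w.2)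
   else 0) else 0)%R%:E.
have mB : measurable_fun [set: M * M] (fun w : M * M => w.2 - w.1 : R)%R.
  exact: measurable_funB.
have mf : measurable_fun [set: M * M] f.
  apply/measurable_EFinP; apply: measurable_gt0_if => //.
  apply: measurable_gt0_if => //.
  apply: measurable_funM; last exact: measurable_expN.
  by apply: measurable_funM; exact: measurable_pow.
have f0 w : 0 <= f w.
  rewrite lee_fin; case: ifP => // _; case: ifP => // _.
  by rewrite !mulr_ge0 ?powR_ge0 ?expR_ge0.
have gamE_ge0 (s : R) : 0 <= gammaE s.
  by apply: integral_ge0 => x _; rewrite lee_fin; case: ifP => // _; rewrite mulr_ge0 ?powR_ge0 ?expR_ge0.
have beta_ge0 : 0 <= betaE a b.
  by apply: integral_ge0 => x _; rewrite lee_fin; case: ifP => // _; case: ifP => // _; rewrite mulr_ge0 ?powR_ge0.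
have fub := @fubini_tonelli _ _ M M R mu mu f mf f0.
have lhs : \int[mu]_x \int[mu]_y f (x, y) = gammaE a * gammaE b.
  clear f0 mf fub; rewrite muleC.
  rewrite -(ge0_integral_scalee (gamE_ge0 b) (measurable_gam a) (gam_ge0 a)).
  apply: eq_integral => x _; rewrite /f /gam /=; case: ifPn => x0; last first.
    by rewrite mule0; exact: integral0.
  have mx : measurable_fun [set: R] (fun y : R => y - x)%R by apply: measurable_funB.
  rewrite (@ge0_integral_affine _ 1%R x _ ltr01); first last.
  - move=> y; rewrite lee_fin; case: ifP => // _.
    by rewrite !mulr_ge0 ?powR_ge0 ?expR_ge0.
  - apply/measurable_EFinP; apply: measurable_gt0_if => //.
    apply: measurable_funM; last exact: measurable_expN.
    by apply: measurable_funM => //; exact: measurable_pow.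
  rewrite mul1e muleC; apply: (@ge0_integral_scale _ (gam b)).
  - by rewrite mulr_ge0 ?powR_ge0 ?expR_ge0.
  - exact: measurable_gam.
  - exact: gam_ge0.
  move=> y; rewrite mul1r addrK /gam.
  case: ifP => _; rewrite ?mulr0 // opprD expRD.
  by ring.
apply: etrans (etrans (esym lhs) fub) _; clear f0 mf fub lhs.
rewrite -(ge0_integral_scalee beta_ge0 (measurable_gam (a + b)) (gam_ge0 (a + b))).
apply: eq_integral => z _.
transitivity ((expR (- z))%:E * ((if (0 < z)%R then z `^ (a + b - 1) else 0)%R%:E
   * betaE a b)); last first.
  rewrite muleA muleC; congr (_ * _); rewrite -EFinM /= /gam; congr EFin.
  by case: ifP => _; rewrite ?mulr0 // mulrC.
have e1 := bet_scale a b z.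
apply: etrans _ (congr1 (mule (expR (- z))%:E) e1).
apply: ge0_integral_scale.
- exact: expR_ge0.
- exact: measurable_bet.
- exact: bet_ge0.
- move=> x; rewrite /bet /=.
  by case: ifP => _; rewrite ?mulr0 //; case: ifP => _; rewrite ?mulr0 // mulrC.
Qed.

End BetaGamma.

(** * Riemann sums for the Beta integral *)

Section BetaBlocks.
Variable R : realType.
Local Notation mu := (@lebesgue_measure R).

(* x `^ p extended by 0 to the nonpositive reals; unlike powR it vanishes at 0
   also for p = 0. *)
Definition pow0 (p x : R) : R := if 0 < x then x `^ p else 0.

Lemma pow0_ge0 p x : 0 <= pow0 p x.
Proof. by rewrite /pow0; case: ifP => // _; exact: powR_ge0. Qed.

Lemma pow0_le p x y : 0 <= p -> x <= y -> pow0 p x <= pow0 p y.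
Proof.
move=> p0 xy; rewrite {1}/pow0; case: ifPn => [x0|_]; last exact: pow0_ge0.
rewrite /pow0 (lt_le_trans x0 xy) ge0_ler_powR // ?nnegrE.
  exact: ltW.
exact: le_trans (ltW x0) xy.
Qed.

Lemma pow0_0 p : pow0 p 0 = 0.
Proof. by rewrite /pow0 ltxx. Qed.

Lemma pow0_1 p : pow0 p 1 = 1.
Proof. by rewrite /pow0 ltr01 powR1. Qed.

Lemma pow0_le1 p x : 0 <= p -> x <= 1 -> pow0 p x <= 1.
Proof. by move=> p0 x1; rewrite -(pow0_1 p); exact: pow0_le. Qed.

Lemma pow0M p x y : 0 <= x -> 0 <= y -> pow0 p (x * y) = pow0 p x * pow0 p y.
Proof.
rewrite !le_eqVlt => /predU1P[<-|x0] /predU1P[<-|y0];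
  rewrite ?(mul0r, mulr0) ?pow0_0 ?(mul0r, mulr0) //.
by rewrite /pow0 mulr_gt0 // x0 y0 powRM // ltW.
Qed.

Lemma measurable_pow0 p : measurable_fun [set: R] (pow0 p).
Proof. by apply: measurable_gt0_if => //; exact: measurable_powR. Qed.

Variable r : R.
Hypothesis r01 : 0 <= r <= 1.
Let r0 : 0 <= r. Proof. by case/andP: r01. Qed.
Let r1 : 0 <= 1 - r. Proof. by rewrite subr_ge0; case/andP: r01. Qed.

(** The integrand is not monotone, but its factors x^r and (1 - x)^(1 - r) are, in opposite
    directions. Taking them at opposite ends of each block gives the bounds [betaL] and [betaU]. *)
Definition betaL (Q : nat) : R := Q%:R^-1 * \sum_(i < Q)
  pow0 r (i%:R / Q%:R) * pow0 (1 - r) ((Q - i.+1)%:R / Q%:R).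

Definition betaU (Q : nat) : R := Q%:R^-1 * \sum_(i < Q)
  pow0 r (i.+1%:R / Q%:R) * pow0 (1 - r) ((Q - i)%:R / Q%:R).

(** All values lie in [0, 1], so a difference of products is at most the sum of the increments of
    the two factors, and each family of increments telescopes to 1. *)
Lemma betaU_betaL Q : (0 < Q)%N -> betaU Q <= betaL Q + 2 / Q%:R.
Proof.
move=> Q0; have Qr : 0 < Q%:R :> R by rewrite ltr0n.
rewrite /betaU /betaL [2 / _]mulrC -mulrDr ler_pM2l ?invr_gt0 //.
have -> : 2 = \sum_(i < Q) (pow0 r (i.+1%:R / Q%:R) - pow0 r (i%:R / Q%:R)) +
    \sum_(i < Q) (pow0 (1 - r) ((Q - i)%:R / Q%:R) -
      pow0 (1 - r) ((Q - i.+1)%:R / Q%:R)) :> R.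
  rewrite -(big_mkord xpredT (fun i => pow0 r (i.+1%:R / Q%:R) - pow0 r (i%:R / Q%:R))).
  rewrite (telescope_sumr (fun i => pow0 r (i%:R / Q%:R))) //.
  rewrite -(big_mkord xpredT (fun i => pow0 (1 - r) ((Q - i)%:R / Q%:R) -
      pow0 (1 - r) ((Q - i.+1)%:R / Q%:R))).
  rewrite [X in _ + X](_ : _ = - \sum_(0 <= i < Q) (pow0 (1 - r) ((Q - i.+1)%:R / Q%:R)
    - pow0 (1 - r) ((Q - i)%:R / Q%:R))); last first.
    by rewrite -sumrN; apply: eq_bigr => i _; rewrite opprB.
  rewrite (telescope_sumr (fun i => pow0 (1 - r) ((Q - i)%:R / Q%:R))) //.
  by rewrite subnn subn0 mul0r !pow0_0 divff ?gt_eqF // !pow0_1; ring.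
rewrite -!big_split /=; apply: ler_sum => i _.
have qle j : (j <= Q)%N -> j%:R / Q%:R <= 1 :> R.
  by move=> jQ; rewrite ler_pdivrMr // mul1r ler_nat.
have iQ := ltn_ord i.
have a0 := pow0_ge0 r (i%:R / Q%:R).
have a1 := pow0_le1 r0 (qle _ iQ).
have a01 : pow0 r (i%:R / Q%:R) <= pow0 r (i.+1%:R / Q%:R).
  by apply: pow0_le => //; rewrite ler_pM2r ?invr_gt0 // ler_nat.
have b0 := pow0_ge0 (1 - r) ((Q - i.+1)%:R / Q%:R).
have b1 := pow0_le1 r1 (qle _ (leq_subr i Q)).
have b01 : pow0 (1 - r) ((Q - i.+1)%:R / Q%:R) <= pow0 (1 - r) ((Q - i)%:R / Q%:R).
  by apply: pow0_le => //; rewrite ler_pM2r ?invr_gt0 // ler_nat; lia.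
by nra.
Qed.

Let g (x : R) := pow0 r x * pow0 (1 - r) (1 - x).

Let measurable_g : measurable_fun [set: R] (EFin \o g).
Proof.
apply/measurable_EFinP; apply: measurable_funM; first exact: measurable_pow0.
by apply: (measurableT_comp (measurable_pow0 _)); exact: measurable_funB.
Qed.

Let g_ge0 x : 0 <= g x.
Proof. by rewrite mulr_ge0 // pow0_ge0. Qed.

Let block (Q i : nat) := `]i%:R / Q%:R, i.+1%:R / Q%:R]%classic : set R.

Let block_cst (Q i : nat) (c : R) : (0 < Q)%N ->
  (\int[mu]_(x in block Q i) c%:E = (Q%:R^-1 * c)%:E)%E.
Proof.
move=> Q0; transitivity (c%:E * mu (block Q i))%E; first by rewrite integral_cst //; exact: measurable_itv.
rewrite /block lebesgue_measure_itv /= lte_fin.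
rewrite ltr_pM2r ?invr_gt0 ?ltr0n // ltr_nat ltnSn -EFinB -EFinM.
by rewrite -mulrBl -natr1 addrC addKr mul1r mulrC.
Qed.

Let integral_blocks (Q m : nat) : (0 < Q)%N -> (m <= Q)%N ->
  ((Q%:R^-1 * \sum_(i < m)
     pow0 r (i%:R / Q%:R) * pow0 (1 - r) ((Q - i.+1)%:R / Q%:R))%:E <=
   \int[mu]_(x in `]0%R, (m%:R / Q%:R)%R]) (g x)%:E <=
  (Q%:R^-1 * \sum_(i < m)
     pow0 r (i.+1%:R / Q%:R) * pow0 (1 - r) ((Q - i)%:R / Q%:R))%:E)%E.
Proof.
move=> Q0; have Qr : 0 < Q%:R :> R by rewrite ltr0n.
elim: m => [|m IHm] mQ.
  by rewrite !big_ord0 mulr0 mul0r set_itvoc0 integral_set0 lexx.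
have -> : `]0, m.+1%:R / Q%:R]%classic = `]0, m%:R / Q%:R]%classic `|` block Q m.
  apply: itv_bndbnd_setU; rewrite bnd_simp ?divr_ge0 //.
  by rewrite ler_pM2r ?invr_gt0 // ler_nat.
have -> : (\int[mu]_(x in `]0%R, (m%:R / Q%:R)%R]%classic `|` block Q m) (g x)%:E =
    \int[mu]_(x in `]0%R, (m%:R / Q%:R)%R]) (g x)%:E +
    \int[mu]_(x in block Q m) (g x)%:E)%E.
  apply: ge0_integral_setU.
  - exact: measurable_itv.
  - exact: measurable_itv.
  - exact: measurable_funTS.
  - by move=> x _; rewrite lee_fin.
  - apply/disj_setPS => x [/=]; rewrite !in_itv /= => /andP[_ xm] /andP[mx _].
    by move: (lt_le_trans mx xm); rewrite ltxx.
have Qm k : (k <= Q)%N -> (Q - k)%:R / Q%:R = 1 - k%:R / Q%:R :> R.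
  by move=> kQ; rewrite natrB // mulrBl divff // gt_eqF.
rewrite !big_ord_recr /= !mulrDr !EFinD.
have /andP[h1 h2] := IHm (ltnW mQ); apply/andP; split; apply: leeD => //.
  rewrite -(@block_cst Q m _ Q0); apply: ge0_le_integral; [exact: measurable_itv| | | | ].
  - by move=> x _; rewrite lee_fin mulr_ge0 // pow0_ge0.
  - exact: measurable_cst.
  - exact: measurable_funTS.
  - move=> x; rewrite /block /= in_itv /= => /andP[mx xm].
    rewrite lee_fin; apply: ler_pM; rewrite ?pow0_ge0 //; apply: pow0_le => //.
      exact: ltW.
    by rewrite Qm // lerB.
rewrite -(@block_cst Q m _ Q0); apply: ge0_le_integral; [exact: measurable_itv| | | | ].
- by move=> x _; rewrite lee_fin.
- exact: measurable_funTS.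
- exact: measurable_cst.
- move=> x; rewrite /block /= in_itv /= => /andP[mx xm].
  rewrite lee_fin; apply: ler_pM; rewrite ?pow0_ge0 //; apply: pow0_le => //.
  by rewrite Qm ?lerB ?(ltW mx) // ltnW.
Qed.

Let betaE_block Q : (0 < Q)%N ->
  ((betaL Q)%:E <= betaE (1 + r) (2 - r) <= (betaU Q)%:E)%E.
Proof.
move=> Q0; have <- : (\int[mu]_(x in `]0%R, 1%R]) (g x)%:E = betaE (1 + r) (2 - r))%E.
  rewrite integral_mkcond; apply: eq_integral => x _.
  rewrite patchE mem_setE in_itv /= /g /pow0 subr_gt0.
  rewrite (_ : 1 + r - 1 = r); last by ring.
  rewrite (_ : 2 - r - 1 = 1 - r); last by ring.
  case: ifPn => [/andP[x0 x1]|]; first by rewrite x0; case: ifP; rewrite ?mulr0.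
  rewrite negb_and -ltNge -leNgt => /orP[x0|x1]; first by rewrite ltNge x0.
  by rewrite [x < 1]ltNge ltW ?if_same.
have := integral_blocks Q0 (leqnn Q).
by rewrite divff // pnatr_eq0 -lt0n.
Qed.

Definition beta : R := fine (betaE (1 + r) (2 - r)).

Let betaE_fin : betaE (1 + r) (2 - r) \is a fin_num.
Proof.
have /andP[h1 h2] := betaE_block (ltn0Sn 0).
by rewrite fin_numE; apply/andP; split; [rewrite gt_eqF // (lt_le_trans _ h1) ?ltNyr
  | rewrite lt_eqF // (le_lt_trans h2) ?ltry].
Qed.

Lemma beta_block Q : (0 < Q)%N -> betaL Q <= beta <= betaU Q.
Proof. by move=> /betaE_block; rewrite -[betaE _ _]fineK // !lee_fin. Qed.

Lemma beta_gt0 : 0 < beta.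
Proof.
(* Three is the least number of blocks for which [betaL] has a nonzero term, the middle one. *)
have /andP[+ _] := beta_block (ltn0Sn 2); apply: lt_le_trans.
rewrite /betaL mulr_gt0 ?invr_gt0 // !big_ord_recl big_ord0.
rewrite /= /bump /= !mul0r pow0_0 mul0r add0r.
rewrite ltr_wpDr ?addr_ge0 ?mulr_ge0 ?pow0_ge0 //.
by rewrite /pow0 !divr_gt0 // mulr_gt0 // powR_gt0 // divr_gt0.
Qed.

(** The arguments add up to 3 and Gamma(3) = 2. As [Gamma] is [fine] of an extended real, infinite
    factors have to be excluded; they are incompatible with a finite positive product. *)
Lemma Gamma_beta : Gamma (1 + r) * Gamma (2 - r) = 2 * beta.
Proof.
have g2 : gammaE (2 : R) = 1%:E.
  by rewrite (_ : 2 = 1 + 1 :> R) // gammaE_rec // gammaE1 mule1.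
have g3 : gammaE (3 : R) = 2%:E.
  have e3 : 1 + 2 = 3 :> R by ring.
  by rewrite -e3 gammaE_rec // g2 mule1.
have := gammaE_beta (1 + r) (2 - r).
rewrite (_ : 1 + r + (2 - r) = 3 :> R); last by ring.
rewrite g3 !GammaE -[betaE _ _]fineK // -EFinM -/beta.
have b0 : 0 < beta * 2 by rewrite mulr_gt0 // beta_gt0.
have gam0 s : (0%R <= gammaE s :> \bar R)%E.
  apply: integral_ge0 => x _; rewrite lee_fin; case: ifP => // _.
  by rewrite mulr_ge0 ?powR_ge0 ?expR_ge0.
have := gam0 (1 + r); have := gam0 (2 - r).
case: (gammaE (1 + r)) => [x| |]; case: (gammaE (2 - r)) => [y| |] //=.
- by move=> _ _ [->]; rewrite mulrC.
- move=> _; rewrite lee_fin le_eqVlt => /predU1P[<-|x0].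
    by rewrite mul0e => -[]/eqP; rewrite lt_eqF.
  by rewrite mulry gtr0_sg // mul1e.
- rewrite lee_fin le_eqVlt => /predU1P[<-|x0] _.
    by rewrite mule0 => -[]/eqP; rewrite lt_eqF.
  by rewrite mulyr gtr0_sg // mul1e.
Qed.

End BetaBlocks.

Lemma Gamma_rec (R : realType) (th : R) : 0 < th -> Gamma (1 + th) = th * Gamma th.
Proof.
move=> th0; rewrite !GammaE gammaE_rec //.
case: (gammaE th) => [x| |] //=.
- by rewrite mulry gtr0_sg // mul1e mulr0.
- by rewrite mulrNy gtr0_sg // mul1e mulr0.
Qed.

(** * The weak renewal law *)

Lemma double_lt_mul M q n : (4 <= M -> 4 <= q -> M * q <= n -> M + M < n)%N.
Proof.
move=> M4 q4; apply: leq_trans; apply: (@leq_trans (M * 4)%N); first by lia.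
by rewrite leq_mul2l q4 orbT.
Qed.

Section Tent.
Variable R : realType.
Implicit Types f g : nat -> R.

Lemma sum_const_ord n (c : R) : n%:R * c = \sum_(i < n) c.
Proof. by rewrite sumr_const card_ord mulr_natl. Qed.

(** The double summation of f. *)
Definition ramp f n : R := conv (fun k => k%:R) f n.

Lemma rampS f n : ramp f n.+1 = ramp f n + \sum_(k < n.+1) f k.
Proof.
rewrite /ramp /conv big_ord_recl mul0r add0r /=.
have -> : \sum_(k < n.+1) f k = \sum_(k < n.+1) f (n - k)%N.
  rewrite (reindex_inj rev_ord_inj) /=; apply: eq_bigr => k _.
  by rewrite subSS.
rewrite -big_split /=; apply: eq_bigr => k _.
by rewrite /bump /= add1n subSS -natr1 mulrDl mul1r.
Qed.

(** A sum with triangular weights over the indices n + 1 to n + 2M - 1, which is the second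
    difference of [ramp f] with step M. *)
Definition tent f n M : R := \sum_(m < M) \sum_(i < M) f (n + m + i).+1.

Lemma ramp_diff f n M :
  ramp f (n + M + M) - 2 * ramp f (n + M) + ramp f n = tent f n M.
Proof.
have step j m : ramp f (j + m) = ramp f j + \sum_(i < m) \sum_(k < (j + i).+1) f k.
  elim: m => [|m IHm]; first by rewrite addn0 big_ord0 addr0.
  by rewrite addnS rampS IHm [in RHS]big_ord_recr /= addrA.
have part j m : \sum_(k < (j + m).+1) f k =
    \sum_(k < j.+1) f k + \sum_(i < m) f (j + i).+1.
  elim: m => [|m IHm]; first by rewrite addn0 big_ord0 addr0.
  by rewrite addnS big_ord_recr IHm [X in _ = _ + X]big_ord_recr /= addrA.
rewrite (step (n + M)%N) (step n).
have -> : \sum_(i < M) \sum_(k < (n + M + i).+1) f k =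
    \sum_(i < M) \sum_(k < (n + i).+1) f k + tent f n M.
  rewrite /tent -big_split /=; apply: eq_bigr => m _.
  by rewrite addnAC part; congr (_ + _); apply: eq_bigr => i _.
by ring.
Qed.

Lemma tent_lin f g c n M :
  tent (fun k => f k - c * g k) n M = tent f n M - c * tent g n M.
Proof.
rewrite /tent mulr_sumr -sumrB; apply: eq_bigr => m _.
by rewrite mulr_sumr -sumrB.
Qed.

Lemma tent_ge f n M : {homo f : x y / (x <= y)%N >-> x <= y} ->
  M%:R ^+ 2 * f n <= tent f n M.
Proof.
move=> fnd; rewrite expr2 -mulrA sum_const_ord; apply: ler_sum => m _.
rewrite sum_const_ord; apply: ler_sum => i _.
by apply: fnd; rewrite -addnA -addnS leq_addr.
Qed.

Lemma tent_le f n M : {homo f : x y / (x <= y)%N >-> x <= y} ->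
  tent f n M <= M%:R ^+ 2 * f (n + M + M)%N.
Proof.
move=> fnd; rewrite expr2 -mulrA [leRHS]sum_const_ord.
apply: ler_sum => m _.
rewrite sum_const_ord; apply: ler_sum => i _.
by apply: fnd; have := ltn_ord m; have := ltn_ord i; lia.
Qed.

End Tent.

Section WeakLaw.
Variables (R : realType) (a : nat -> R).
Hypothesis a_part : is_partition a.
Local Notation u := (renewal a).
Local Notation t := (tail a).
Local Notation T := (tsum a).
Local Notation U := (renewal_sum a).

Definition wsum n : R := n%:R / T n.
Local Notation W := wsum.

Lemma wsum0 : W 0 = 0.
Proof. by rewrite /W mul0r. Qed.

Lemma tsum_wsum n : T n * W n = n%:R.
Proof.
case: n => [|n]; first by rewrite wsum0 mulr0.
by rewrite /W mulrC divfK // gt_eqF // tsum_gt0.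
Qed.

Lemma wsum_ge0 n : 0 <= W n.
Proof. by rewrite divr_ge0 // tsum_ge0. Qed.

Lemma wsum_gt0 n : (0 < n)%N -> 0 < W n.
Proof. by move=> n0; rewrite divr_gt0 ?ltr0n // tsum_gt0. Qed.

Lemma tail_tsum n : n%:R * t n.+1 <= T n.
Proof.
rewrite /tsum big_add1 /= big_mkord sum_const_ord; apply: ler_sum => k _.
by apply: tail_le => //; rewrite ltnW // ltnS.
Qed.

(** The average of t_1, ..., t_n is at least t_(n+1), so the averages T n / n do not increase. *)
Lemma wsum_le : {homo W : m n / (m <= n)%N >-> m <= n}.
Proof.
apply: homo_leq => [|y x z|n]; [exact: lexx|exact: le_trans|].
case: n => [|n]; first by rewrite wsum0 wsum_ge0.
rewrite /W ler_pdivlMr ?tsum_gt0 // mulrAC ler_pdivrMr ?tsum_gt0 //.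
rewrite [T n.+2]tsumS mulrDr -[n.+2%:R]natr1 mulrDl mul1r lerD2l.
exact: tail_tsum.
Qed.

Lemma wsum_scale m n : (0 < m)%N -> (m <= n)%N -> W n <= n%:R / m%:R * W m.
Proof.
move=> m0 mn; rewrite /W mulrA divfK ?pnatr_eq0 -?lt0n //.
rewrite ler_wpM2l // lef_pV2 ?posrE ?tsum_gt0 ?tsum_le //.
exact: leq_trans m0 mn.
Qed.

(** The correction at 0 is due to U 0 = 1 and W 0 = 0. *)
Lemma renewal_sum_wsum n : U n <= 2 * W n + (n == 0)%:R.
Proof.
case: n => [|n]; first by rewrite wsum0 mulr0 add0r /renewal_sum big_ord1.
rewrite addr0 /W mulrA ler_pdivlMr ?tsum_gt0 //.
exact: renewal_sum_le2.
Qed.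

Variable rho : R.
Hypothesis rho01 : 0 <= rho <= 1.
Hypothesis T_rv : forall m, (0 < m)%N ->
  (fun k => T (m * k) / T k) @ \oo --> m%:R `^ rho.

(** At m = 0 the ratio is 0 even if rho = 0, hence [pow0]. *)
Lemma tsum_ratio m : (fun k => T (m * k) / T k) @ \oo --> pow0 rho m%:R.
Proof.
case: m => [|m]; last by rewrite /pow0 ltr0n /=; exact: T_rv.
rewrite pow0_0 (_ : (fun k => _) = fun=> 0); first exact: cvg_cst.
by apply/funext => k; rewrite mul0n tsum0 mul0r.
Qed.

Lemma wsum_ratio m : (fun k => W (m * k) / W k) @ \oo --> pow0 (1 - rho) m%:R.
Proof.
case: m => [|m].
  rewrite pow0_0 (_ : (fun k => _) = fun=> 0); first exact: cvg_cst.
  by apply/funext => k; rewrite mul0n wsum0 mul0r.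
have m0 : m.+1%:R != 0 :> R by rewrite pnatr_eq0.
have -> : pow0 (1 - rho) m.+1%:R = m.+1%:R * (m.+1%:R `^ rho)^-1.
  by rewrite /pow0 ltr0n /= powRB ?m0 ?implybT // powRr1.
have : (fun k => m.+1%:R * (T (m.+1 * k) / T k)^-1) @ \oo -->
    m.+1%:R * (m.+1%:R `^ rho)^-1.
  apply: cvgM; first exact: cvg_cst.
  by apply: cvgV; [rewrite gt_eqF // powR_gt0 // ltr0n|exact: T_rv].
apply: cvg_trans; apply: near_eq_cvg; near=> k.
have k0 : (0 < k)%N by near: k; exists 1%N.
have mk0 : (0 < m.+1 * k)%N by rewrite muln_gt0.
have Tk : T k != 0 by rewrite gt_eqF // tsum_gt0.
have Tmk : T (m.+1 * k) != 0 by rewrite gt_eqF // tsum_gt0.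
have kn : k%:R != 0 :> R by rewrite pnatr_eq0 -lt0n.
by rewrite /W natrM; field; rewrite ?kn ?Tmk ?Tk.
Unshelve. all: by end_near. Qed.

Let conv_blocks Q k : conv T W (Q * k) = \sum_(i < Q) \sum_(j < k)
  T (i * k + j) * W (Q * k - (i * k + j))%N.
Proof.
rewrite /conv big_ord_recr /= subnn wsum0 mulr0 addr0.
rewrite -(big_mkord xpredT (fun j => T j * W (Q * k - j)%N)).
suff : forall m, \sum_(0 <= j < m * k) T j * W (Q * k - j)%N =
  \sum_(i < m) \sum_(j < k) T (i * k + j) * W (Q * k - (i * k + j))%N by apply.
elim=> [|m IHm]; first by rewrite mul0n big_geq // big_ord0.
rewrite big_ord_recr /= -IHm (@big_cat_nat _ _ _ (m * k)) //=;
  last by rewrite leq_mul2r leqnSn orbT.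
congr (_ + _); rewrite -{1}[(m * k)%N]add0n big_addn mulSn addnK big_mkord.
by apply: eq_bigr => j _; rewrite addnC.
Qed.

(** Along a block of k indices the factor of T increases and that of W decreases; taking them at
    opposite ends mirrors [betaL], and [conv_upper] mirrors [betaU]. *)
Lemma conv_lower Q k : k%:R * \sum_(i < Q) T (i * k) * W ((Q - i.+1) * k)
  <= conv T W (Q * k).
Proof.
rewrite conv_blocks mulr_sumr; apply: ler_sum => i _.
rewrite sum_const_ord; apply: ler_sum => j _.
apply: ler_pM; rewrite ?tsum_ge0 ?wsum_ge0 ?tsum_le ?leq_addr //.
apply: wsum_le; have ij := ltn_ord j; have iQ := ltn_ord i; rewrite mulnBl mulSn.
by apply: leq_sub2l; rewrite addnC leq_add2r ltnW.
Qed.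

Lemma conv_upper Q k : conv T W (Q * k) <=
  k%:R * \sum_(i < Q) T (i.+1 * k) * W ((Q - i) * k).
Proof.
rewrite conv_blocks mulr_sumr; apply: ler_sum => i _.
rewrite sum_const_ord; apply: ler_sum => j _.
have ij := ltn_ord j; apply: ler_pM; rewrite ?tsum_ge0 ?wsum_ge0 //.
  by apply: tsum_le => //; rewrite mulSn addnC leq_add2r ltnW.
by apply: wsum_le; rewrite mulnBl leq_sub2l // leq_addr.
Qed.

(** Since T k * W k = k, dividing by k^2 divides each T by T k and each W by W k. *)
Let ratio_sum Q (f g : nat -> nat) :
  (fun k => (k%:R * \sum_(i < Q) T (f i * k) * W (g i * k)) / k%:R ^+ 2) @ \oo -->
  \sum_(i < Q) pow0 rho (f i)%:R * pow0 (1 - rho) (g i)%:R.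
Proof.
have : (fun k => \sum_(i < Q) (T (f i * k) / T k) * (W (g i * k) / W k)) @ \oo -->
    \sum_(i < Q) pow0 rho (f i)%:R * pow0 (1 - rho) (g i)%:R.
  apply: cvg_big => [|i _]; first exact: add_continuous.
  by apply: cvgM; [exact: tsum_ratio|exact: wsum_ratio].
apply: cvg_trans; apply: near_eq_cvg; near=> k.
have k0 : (0 < k)%N by near: k; exists 1%N.
have kn : k%:R != 0 :> R by rewrite pnatr_eq0 -lt0n.
have Tk : T k != 0 by rewrite gt_eqF // tsum_gt0.
have Wk : W k != 0 by rewrite gt_eqF // wsum_gt0.
have -> (s : R) : k%:R * s / k%:R ^+ 2 = s / (T k * W k).
  by rewrite tsum_wsum; field.
by rewrite mulr_suml; apply: eq_bigr => i _; field; rewrite Tk Wk.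
Unshelve. all: by end_near. Qed.

Let pow0_scale Q i j : (0 < Q)%N ->
  pow0 rho i%:R * pow0 (1 - rho) j%:R =
  Q%:R * (pow0 rho (i%:R / Q%:R) * pow0 (1 - rho) (j%:R / Q%:R)).
Proof.
move=> Q0; have Qr : 0 < Q%:R :> R by rewrite ltr0n.
have H p l : pow0 p l%:R = Q%:R `^ p * pow0 p (l%:R / Q%:R).
  have -> : Q%:R `^ p = pow0 p Q%:R by rewrite /pow0 ltr0n Q0.
  by rewrite -pow0M ?divr_ge0 // [Q%:R * _]mulrC divfK // pnatr_eq0 -lt0n.
rewrite [LHS](_ : _ = Q%:R `^ rho * Q%:R `^ (1 - rho) *
  (pow0 rho (i%:R / Q%:R) * pow0 (1 - rho) (j%:R / Q%:R))); last first.
  by rewrite H [X in _ * X]H; ring.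
have Qn : Q%:R != 0 :> R by rewrite pnatr_eq0 -lt0n.
rewrite -powRD ?Qn ?implybT // (_ : rho + (1 - rho) = 1); last by ring.
by rewrite powRr1.
Qed.

Let betaLE Q : (0 < Q)%N -> \sum_(i < Q) pow0 rho i%:R * pow0 (1 - rho) (Q - i.+1)%:R
  = Q%:R ^+ 2 * betaL rho Q.
Proof.
move=> Q0; have Qr : Q%:R != 0 :> R by rewrite pnatr_eq0 -lt0n.
rewrite /betaL expr2 mulrA mulfK // mulr_sumr.
by apply: eq_bigr => i _; rewrite (pow0_scale _ _ Q0).
Qed.

Let betaUE Q : (0 < Q)%N -> \sum_(i < Q) pow0 rho i.+1%:R * pow0 (1 - rho) (Q - i)%:R
  = Q%:R ^+ 2 * betaU rho Q.
Proof.
move=> Q0; have Qr : Q%:R != 0 :> R by rewrite pnatr_eq0 -lt0n.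
rewrite /betaU expr2 mulrA mulfK // mulr_sumr.
by apply: eq_bigr => i _; rewrite (pow0_scale _ _ Q0).
Qed.

Let conv_le m n : (m <= n)%N -> conv T W m <= conv T W n.
Proof.
move=> mn; rewrite /conv -[n.+1](subnKC (mn : (m.+1 <= n.+1)%N)) big_split_ord /=.
rewrite -[leLHS]addr0 lerD //.
  apply: ler_sum => k _; rewrite ler_wpM2l ?tsum_ge0 //; apply: wsum_le.
  exact: leq_sub2r.
by apply: sumr_ge0 => k _; rewrite mulr_ge0 ?tsum_ge0 ?wsum_ge0.
Qed.

Lemma nat_large (x : R) : exists N : nat, (0 < N)%N /\ x <= N%:R.
Proof.
exists (Num.bound `|x|).+1; split=> //.
apply: le_trans (ler_norm x) _; apply: le_trans (ltW (archi_boundP (normr_ge0 x))) _.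
by rewrite ler_nat.
Qed.

Lemma conv_asymp (e : R) : 0 < e -> exists N, forall n, (N <= n)%N ->
  `|conv T W n - beta rho * n%:R ^+ 2| <= e * n%:R ^+ 2.
Proof.
(* This makes 12 / Q at most e / 2; the other half of e pays for n not being a multiple of Q. *)
move=> e0; have [Q [Q0 Qe]] := nat_large (24 / e).
have Qr : 0 < Q%:R :> R by rewrite ltr0n.
have bL : beta rho - 2 / Q%:R <= betaL rho Q.
  have /andP[_ h] := beta_block rho01 Q0.
  by have := betaU_betaL rho01 Q0; lra.
have bU : betaU rho Q <= beta rho + 2 / Q%:R.
  have /andP[h _] := beta_block rho01 Q0.
  by have := betaU_betaL rho01 Q0; lra.
(* The limits are Q^2 times [betaL] and [betaU], so a tolerance of Q changes these by only 1 / Q. *)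
have [K1 H1] := cvgn_dist_lt (@ratio_sum Q (fun i => i) (fun i => Q - i.+1)%N) Qr.
have [K2 H2] := cvgn_dist_lt (@ratio_sum Q (fun i => i.+1) (fun i => Q - i)%N) Qr.
have eQ : 12 / Q%:R <= e / 2.
  by rewrite ler_pdivrMr //; move: Qe; rewrite ler_pdivrMr //; lra.
have b0 := beta_gt0 rho01; set b := beta rho in bL bU b0 *.
have scale k (x y : R) : (0 < k)%N -> `|x / k%:R ^+ 2 - y| < Q%:R ->
    k%:R ^+ 2 * (y - Q%:R) <= x <= k%:R ^+ 2 * (y + Q%:R).
  move=> k0; rewrite ltr_norml => /andP[h1 h2].
  have k2 : 0 < k%:R ^+ 2 :> R by rewrite exprn_gt0 // ltr0n.
  have -> : x = k%:R ^+ 2 * (x / k%:R ^+ 2) by rewrite mulrC divfK // gt_eqF.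
  by rewrite !ler_pM2l //; apply/andP; split; lra.
have low k : (0 < k)%N -> (K1 <= k)%N ->
    b * (Q%:R * k%:R) ^+ 2 - 3 / Q%:R * (Q%:R * k%:R) ^+ 2 <= conv T W (Q * k).
  move=> k0 /H1 /(scale _ _ _ k0) /andP[+ _] => h.
  apply: le_trans (le_trans h (conv_lower Q k)).
  rewrite betaLE // -mulrBl exprMn mulrA mulrC ler_pM2l ?exprn_gt0 ?ltr0n //.
  have -> : Q%:R ^+ 2 * betaL rho Q - Q%:R =
      (betaL rho Q - Q%:R^-1) * Q%:R ^+ 2 by field; rewrite gt_eqF.
  by rewrite ler_pM2r ?exprn_gt0 //; lra.
have upp k : (0 < k)%N -> (K2 <= k)%N ->
    conv T W (Q * k) <= b * (Q%:R * k%:R) ^+ 2 + 3 / Q%:R * (Q%:R * k%:R) ^+ 2.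
  move=> k0 /H2 /(scale _ _ _ k0) /andP[_ +] => h.
  apply: le_trans (le_trans (conv_upper Q k) h) _.
  rewrite betaUE // (_ : b * (Q%:R * k%:R) ^+ 2 + 3 / Q%:R * (Q%:R * k%:R) ^+ 2 =
    k%:R ^+ 2 * ((b + 3 / Q%:R) * Q%:R ^+ 2)); last by ring.
  rewrite ler_pM2l ?exprn_gt0 ?ltr0n //.
  have -> : Q%:R ^+ 2 * betaU rho Q + Q%:R =
      (betaU rho Q + Q%:R^-1) * Q%:R ^+ 2 by field; rewrite gt_eqF.
  by rewrite ler_pM2r ?exprn_gt0 //; lra.
have [N3 [N30 HN3]] := nat_large (6 * Q%:R * b / e).
exists (Q * (K1 + K2 + 1) + N3)%N => n nN.
have Qn : (Q * (K1 + K2 + 1) <= n)%N by exact: leq_trans (leq_addr _ _) nN.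
have nN3 : (N3 <= n)%N by exact: leq_trans (leq_addl _ _) nN.
pose k := (n %/ Q)%N.
have kK : (K1 + K2 + 1 <= k)%N by rewrite /k leq_divRL // mulnC.
have k0 : (0 < k)%N by apply: leq_trans kK; rewrite addn1.
have kK1 : (K1 <= k)%N by apply: leq_trans kK; rewrite -addnA leq_addr.
have kK2 : (K2 <= k.+1)%N.
  by apply: leqW; apply: leq_trans kK; rewrite addnAC addnC leq_addr.
have kn : (Q * k <= n)%N by rewrite mulnC /k leq_divM.
have nk : (n < Q * k.+1)%N by rewrite mulnC /k ltn_ceil.
have n0 : 0 <= n%:R :> R by [].
have nQ : Q%:R <= n%:R :> R.
  by rewrite ler_nat; apply: leq_trans Qn; rewrite leq_pmulr // addn1.
have kn' : Q%:R * k%:R <= n%:R :> R by rewrite -natrM ler_nat.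
have nk' : n%:R <= Q%:R * k%:R + Q%:R :> R.
  by rewrite -[X in _ + X]mulr1 -mulrDr natr1 -natrM ler_nat ltnW.
have k0' : 0 <= Q%:R * k%:R :> R by rewrite mulr_ge0.
have nb : 3 * Q%:R * b <= e / 2 * n%:R.
  have : 6 * Q%:R * b / e <= n%:R by apply: le_trans HN3 _; rewrite ler_nat.
  by rewrite ler_pdivrMr //; lra.
have nbn : 3 * Q%:R * b * n%:R <= e / 2 * n%:R ^+ 2.
  by rewrite expr2 mulrA ler_wpM2r.
have eQn : 12 / Q%:R * n%:R ^+ 2 <= e / 2 * n%:R ^+ 2.
  by rewrite ler_wpM2r // exprn_ge0.
have q0 : 0 < Q%:R^-1 :> R by rewrite invr_gt0.
have l1 := le_trans (low k k0 kK1) (conv_le kn).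
have u1 := le_trans (conv_le (ltnW nk)) (upp k.+1 isT kK2).
rewrite -natr1 mulrDr mulr1 in u1.
set y := Q%:R * k%:R in kn' nk' k0' l1 u1.
have y2 : n%:R ^+ 2 - 2 * Q%:R * n%:R <= y ^+ 2 by nra.
have y2n : y ^+ 2 <= n%:R ^+ 2 by rewrite ler_sqr ?nnegrE.
have yQ : (y + Q%:R) ^+ 2 <= (n%:R + Q%:R) ^+ 2.
  by rewrite ler_sqr ?nnegrE ?lerD2r ?addr_ge0 // ltW.
have nQ2 : (n%:R + Q%:R) ^+ 2 <= n%:R ^+ 2 + 3 * Q%:R * n%:R :> R by nra.
have nQ4 : (n%:R + Q%:R) ^+ 2 <= 4 * n%:R ^+ 2 :> R by nra.
rewrite ler_norml; apply/andP; split.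
  have h1 : b * (n%:R ^+ 2 - 2 * Q%:R * n%:R) <= b * y ^+ 2 by rewrite ler_pM2l.
  have h2 : 3 / Q%:R * y ^+ 2 <= 3 / Q%:R * n%:R ^+ 2 by rewrite ler_wpM2l // divr_ge0.
  have h3 : 0 <= Q%:R^-1 * n%:R ^+ 2 :> R by rewrite mulr_ge0 ?exprn_ge0 // ltW.
  have h4 : 0 <= b * Q%:R * n%:R by rewrite !mulr_ge0 // ltW.
  by lra.
have h1 : b * (y + Q%:R) ^+ 2 <= b * (n%:R ^+ 2 + 3 * Q%:R * n%:R).
  by rewrite ler_pM2l // (le_trans yQ).
have h2 : 3 / Q%:R * (y + Q%:R) ^+ 2 <= 3 / Q%:R * (4 * n%:R ^+ 2).
  by rewrite ler_wpM2l ?divr_ge0 // (le_trans yQ).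
by lra.
Qed.

Variable K : R.
Hypothesis KE : K * beta rho = 2^-1.

Let K0 : 0 < K.
Proof. by rewrite -(pmulr_lgt0 _ (beta_gt0 rho01)) KE invr_gt0. Qed.

Let D n := U n - K * W n.

(* U * T = n(n+1)/2 exactly and W * T ~ beta n^2, so the constant K with
   K beta = 1/2 makes D * T = o(n^2). *)
Let conv_TD (e : R) : 0 < e -> exists C : R, 0 <= C /\
  forall n, `|conv T D n| <= e * n%:R ^+ 2 + C.
Proof.
move=> e0.
have e1 : 0 < e / (2 * K) by rewrite divr_gt0 // mulr_gt0.
have [N HN] := conv_asymp e1.
have [N2 [N20 HN2]] := nat_large (e^-1).
have DE n : conv T D n = n%:R / 2 - K * (conv T W n - beta rho * n%:R ^+ 2).
  have -> : conv T D n = conv U T n - K * conv T W n.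
    rewrite [conv U T n]convC /conv mulr_sumr -sumrB; apply: eq_bigr => k _.
    by rewrite /D; ring.
  rewrite renewal_sum_tsum // -natr1 mulrBr [K * (beta rho * _)]mulrA.
  by rewrite KE; field.
have big n : (N + N2 <= n)%N -> `|conv T D n| <= e * n%:R ^+ 2.
  move=> nN; have /HN h : (N <= n)%N by exact: leq_trans (leq_addr _ _) nN.
  have n2 : (N2 <= n)%N by exact: leq_trans (leq_addl _ _) nN.
  rewrite DE; apply: le_trans (ler_normB _ _) _.
  rewrite [`|K * _|]normrM (gtr0_norm K0) [`|n%:R / 2|]ger0_norm ?divr_ge0 //.
  have h1 : K * `|conv T W n - beta rho * n%:R ^+ 2| <= e / 2 * n%:R ^+ 2.
    have -> : e / 2 * n%:R ^+ 2 = K * (e / (2 * K) * n%:R ^+ 2).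
      by field; rewrite gt_eqF.
    by rewrite ler_pM2l.
  have h2 : n%:R <= e * n%:R ^+ 2.
    have : e^-1 <= n%:R by apply: le_trans HN2 _; rewrite ler_nat.
    rewrite -(ler_pM2l e0) divff ?gt_eqF // => h3.
    by rewrite expr2 mulrA -[leLHS]mul1r ler_wpM2r.
  apply: (@le_trans _ _ (n%:R / 2 + e / 2 * n%:R ^+ 2)); first by rewrite lerD2l.
  by lra.
exists (\sum_(k < N + N2) `|conv T D k|); split.
  by apply: sumr_ge0 => k _.
move=> n; have [nN|nN] := leqP (N + N2) n.
  by apply: le_trans (big n nN) _; rewrite lerDl sumr_ge0.
rewrite (bigD1 (Ordinal nN)) //= addrCA lerDl addr_ge0 ?sumr_ge0 //.
by rewrite mulr_ge0 ?exprn_ge0 // ltW.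
Qed.

(* Since u * T = n, convolving D * T with u turns it into the ramp of D. *)
Let ramp_D (e C : R) n : 0 <= e -> 0 <= C ->
  (forall n, `|conv T D n| <= e * n%:R ^+ 2 + C) ->
  `|ramp D n| <= U n * (e * n%:R ^+ 2 + C).
Proof.
move=> e0 C0 HC.
have -> : ramp D n = conv u (conv T D) n.
  by rewrite convA; apply: eq_bigr => k _; rewrite renewal_tsum.
rewrite /conv /renewal_sum mulr_suml; apply: le_trans (ler_norm_sum _ _ _) _.
apply: ler_sum => k _; rewrite normrM ger0_norm ?renewal_ge0 //.
rewrite ler_wpM2l ?renewal_ge0 // (le_trans (HC _)) // lerD2r ler_wpM2l //.
by rewrite ler_sqr ?nnegrE // ler_nat leq_subr.
Qed.

(** The three ramps enter with coefficients 1, -2, 1, and U <= 2 W at positive indices, whence the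
    factor 8. *)
Let tent_D (e C : R) n M : 0 <= e -> 0 <= C -> (0 < n)%N ->
  (forall n, `|conv T D n| <= e * n%:R ^+ 2 + C) ->
  `|tent U n M - K * tent W n M| <=
    8 * W (n + M + M) * (e * (n + M + M)%:R ^+ 2 + C).
Proof.
move=> e0 C0 n0 HC; rewrite -tent_lin -ramp_diff.
have bd m : (0 < m)%N -> (m <= n + M + M)%N -> `|ramp D m| <=
    2 * W (n + M + M) * (e * (n + M + M)%:R ^+ 2 + C).
  move=> m0 mn; apply: le_trans (ramp_D _ e0 C0 HC) _.
  apply: ler_pM; rewrite ?renewal_sum_ge0 //.
  - by rewrite addr_ge0 // mulr_ge0 ?exprn_ge0.
  - apply: le_trans (renewal_sum_wsum m) _.
    by rewrite gtn_eqF // addr0 ler_wpM2l // wsum_le.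
  - by rewrite lerD2r ler_wpM2l // ler_sqr ?nnegrE // ler_nat.
have b1 := bd (n + M + M)%N ltac:(lia) (leqnn _).
have b2 := bd (n + M)%N ltac:(lia) ltac:(lia).
have b3 := bd n n0 ltac:(lia).
move: b1 b2 b3; rewrite !ler_norml => /andP[b1 b1'] /andP[b2 b2'] /andP[b3 b3'].
by apply/andP; split; lra.
Qed.

Lemma weak_renewal (e : R) : 0 < e -> exists N, forall n, (N <= n)%N ->
  `|U n - K * W n| <= e * W n.
Proof.
move=> e0.
(* Across a tent W varies by a factor within 2 / q of 1, and K * 2 / q has to be at most e / 2. *)
have [q0 [q00 Hq0]] := nat_large (4 * K / e).
have [q q4n Hq] : exists2 q, (4 <= q)%N & 4 * K / e <= q%:R.
  exists (q0 + 4)%N; first exact: leq_addl.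
  by apply: le_trans Hq0 _; rewrite ler_nat leq_addr.
have q4 : 4 <= q%:R :> R by rewrite ler_nat.
have qr : 0 < q%:R :> R by apply: lt_le_trans q4.
have Kq : K * 2 / q%:R <= e / 2.
  by move: Hq; rewrite !ler_pdivrMr //; lra.
(* The tents have width M ~ n/q, so M^2 >= n^2/(4 q^2); they are second
   differences of a ramp, which is known up to o(n W n n), while U and W vary
   little, relative to M/n, across a tent. *)
have q2 : 0 < q%:R ^+ 2 :> R by rewrite exprn_gt0.
(* The tent error will be at most 240 e1 n^2 W n, and n^2 <= 4 q^2 M^2; this choice makes it e / 2
   times M^2 W n. *)
have [e1 e10 e1E] : exists2 e1, 0 < e1 & e = 8 * (16 * (15 * (q%:R ^+ 2 * e1))).
  exists (e / (8 * (16 * (15 * q%:R ^+ 2)))); first by rewrite divr_gt0 // !mulr_gt0.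
  by field; rewrite gt_eqF.
have [C [C0 HC]] := conv_TD e10.
have [N1 [N10 HN1]] := nat_large (C / e1).
exists (4 * q + N1)%N => n nN.
have nq : (4 * q <= n)%N by exact: leq_trans (leq_addr _ _) nN.
have nN1 : (N1 <= n)%N by exact: leq_trans (leq_addl _ _) nN.
have q0' : (0 < q)%N by exact: leq_trans q4n.
have [M [Mq nMq M4]] : exists M, [/\ M * q <= n, n < M.+1 * q & 4 <= M]%N.
  exists (n %/ q)%N; split; [exact: leq_divM|exact: ltn_ceil|].
  by rewrite leq_divRL.
have Mr : q%:R * M%:R <= n%:R :> R by rewrite -natrM ler_nat mulnC.
have Mr2 : n%:R <= 2 * (q%:R * M%:R) :> R.
  rewrite -!natrM ler_nat; apply: leq_trans (ltnW nMq) _.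
  by rewrite mulSn [(q * M)%N]mulnC mul2n -addnn leq_add2r leq_pmull // (leq_trans _ M4).
have MMn := double_lt_mul M4 q4n Mq.
have M0 : 0 < M%:R :> R by rewrite ltr0n; exact: leq_trans M4.
have n0 : (0 < n)%N by apply: leq_trans nq; rewrite muln_gt0.
have n1 : 1 <= n%:R :> R by rewrite ler1n.
have nM2 : n%:R ^+ 2 <= 4 * (q%:R ^+ 2 * M%:R ^+ 2) :> R.
  rewrite -exprMn -[4](_ : 2 ^+ 2 = _); last by rewrite -natrX.
  by rewrite -exprMn ler_sqr ?nnegrE // ?mulr_ge0 // ltW.
have Cn : C <= e1 * n%:R ^+ 2.
  have : C / e1 <= n%:R by apply: le_trans HN1 _; rewrite ler_nat.
  rewrite ler_pdivrMr // => h; apply: le_trans h _.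
  by rewrite mulrC ler_pM2l // expr2 ler_peMl.
have e1n : 0 <= e1 * n%:R ^+ 2 by rewrite mulr_ge0 ?exprn_ge0 // ltW.
have Und : {homo U : x y / (x <= y)%N >-> x <= y} by move=> x y; exact: renewal_sum_le.
have Wn := wsum_gt0 n0.
have M2 : 0 < M%:R ^+ 2 :> R by rewrite exprn_gt0.
have q1 : 2 * M%:R <= 2 / q%:R * n%:R :> R.
  by rewrite mulrAC ler_pdivlMr //; lra.
have fin (x : R) : x <= 240 * (e1 * n%:R ^+ 2) * W n -> x <= M%:R ^+ 2 * (e / 2 * W n).
  move=> /le_trans; apply; rewrite [leRHS]mulrA ler_pM2r // e1E.
  have : e1 * n%:R ^+ 2 <= e1 * (4 * (q%:R ^+ 2 * M%:R ^+ 2)) by rewrite ler_pM2l.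
  have : 0 <= e1 * (q%:R ^+ 2 * M%:R ^+ 2).
    by rewrite !mulr_ge0 // ltW.
  by lra.
rewrite ler_norml; apply/andP; split.
(* For the lower bound the tent lies to the left of n, so that U n dominates its entries; for the
   upper bound it lies to the right. *)
- pose p := (n - M - M)%N.
  have p0 : (0 < p)%N by rewrite /p -subnDA subn_gt0.
  have pM : (p + M + M = n)%N by rewrite -addnA /p -subnDA subnK // ltnW.
  have pr : p%:R = n%:R - 2 * M%:R :> R by rewrite -pM !natrD; ring.
  have := tent_D M (ltW e10) C0 p0 HC; rewrite pM => h.
  have t1 := tent_le p M Und; rewrite pM in t1.
  have t2 := tent_ge p M wsum_le.
  have Wp : (1 - 2 / q%:R) * W n <= W p.
    have := wsum_scale p0 (_ : (p <= n)%N); rewrite -{1}pM -addnA leq_addr => /(_ isT).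
    rewrite mulrAC ler_pdivlMr ?ltr0n // => h1.
    have np : 0 < n%:R :> R by lra.
    rewrite -(ler_pM2r np); apply: le_trans (_ : W n * p%:R <= _).
      rewrite mulrAC [leRHS]mulrC ler_wpM2r ?wsum_ge0 //.
      by rewrite pr mulrBl mul1r; lra.
    by rewrite [leRHS]mulrC.
  have h2 : 8 * W n * (e1 * n%:R ^+ 2 + C) <= 240 * (e1 * n%:R ^+ 2) * W n.
    rewrite [leRHS]mulrAC -[leLHS]mulrA -[leRHS]mulrA.
    have -> : 240 * (W n * (e1 * n%:R ^+ 2)) = 8 * (W n * (30 * (e1 * n%:R ^+ 2))) by ring.
    rewrite ler_pM2l // ler_pM2l //; lra.
  have h3 := fin _ (le_trans h h2).
  rewrite ler_norml in h3; case/andP: h3 => h3 _.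
  have h4 : K * ((1 - 2 / q%:R) * W n) <= K * W p by rewrite ler_pM2l.
  have h5 : K * (M%:R ^+ 2 * W p) <= K * tent W p M by rewrite ler_pM2l.
  have h6 : M%:R ^+ 2 * (K * ((1 - 2 / q%:R) * W n)) <= K * (M%:R ^+ 2 * W p).
    by rewrite [leRHS]mulrCA ler_pM2l.
  have h7 : K * 2 / q%:R * W n <= e / 2 * W n by rewrite ler_pM2r.
  rewrite -(ler_pM2l M2).
  have h8 : M%:R ^+ 2 * (K * 2 / q%:R * W n) <= M%:R ^+ 2 * (e / 2 * W n).
    by rewrite ler_pM2l.
  by lra.
- have nM3 : (n + M + M <= 3 * n)%N.
    by rewrite -addnA mulSn leq_add2l mul2n -addnn (leq_trans (ltnW MMn)) ?leq_addr.
  have := tent_D M (ltW e10) C0 n0 HC => h.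
  have t1 := tent_ge n M Und.
  have t2 := tent_le n M wsum_le.
  have nMr : (n + M + M)%:R = n%:R + 2 * M%:R :> R by rewrite !natrD; ring.
  have Wp : W (n + M + M) <= (1 + 2 / q%:R) * W n.
    apply: le_trans (wsum_scale n0 _) _; first by rewrite -addnA leq_addr.
    rewrite ler_pM2r // ler_pdivrMr ?ltr0n // nMr mulrDl mul1r; lra.
  have W3 : W (n + M + M) <= 2 * W n.
    apply: le_trans Wp _; rewrite ler_pM2r //.
    have : 2 / q%:R <= 1 :> R by rewrite ler_pdivrMr //; lra.
    by lra.
  have h2 : 8 * W (n + M + M) * (e1 * (n + M + M)%:R ^+ 2 + C) <=
      240 * (e1 * n%:R ^+ 2) * W n.
    have -> : 240 * (e1 * n%:R ^+ 2) * W n =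
      (8 * (2 * W n)) * (15 * (e1 * n%:R ^+ 2)) by ring.
    apply: ler_pM.
    - by rewrite mulr_ge0 ?wsum_ge0.
    - by rewrite addr_ge0 // mulr_ge0 ?exprn_ge0 // ltW.
    - by rewrite ler_pM2l.
    have h9 : e1 * (n + M + M)%:R ^+ 2 <= e1 * (9 * n%:R ^+ 2).
      rewrite ler_pM2l // (_ : 9 * n%:R ^+ 2 = (3 * n%:R) ^+ 2); last by ring.
      by rewrite ler_sqr ?nnegrE ?mulr_ge0 // -natrM ler_nat.
    apply: le_trans (lerD h9 Cn) _.
    by move: e1n; set z := e1 * _; rewrite mulrCA -/z; lra.
  have h3 := fin _ (le_trans h h2).
  rewrite ler_norml in h3; case/andP: h3 => _ h3.
  have h4 : K * W (n + M + M) <= K * ((1 + 2 / q%:R) * W n) by rewrite ler_pM2l.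
  have h5 : K * tent W n M <= K * (M%:R ^+ 2 * W (n + M + M)) by rewrite ler_pM2l.
  have h6 : K * (M%:R ^+ 2 * W (n + M + M)) <= M%:R ^+ 2 * (K * ((1 + 2 / q%:R) * W n)).
    by rewrite [leLHS]mulrCA ler_pM2l.
  have h7 : K * 2 / q%:R * W n <= e / 2 * W n by rewrite ler_pM2r.
  rewrite -(ler_pM2l M2).
  have h8 : M%:R ^+ 2 * (K * 2 / q%:R * W n) <= M%:R ^+ 2 * (e / 2 * W n).
    by rewrite ler_pM2l.
  by lra.
Qed.

End WeakLaw.

(** * Finite Fourier inversion of the renewal sequence *)

Section Cis.
Variable R : realType.
Local Notation C := R[i].
Implicit Types x y : R.

Definition cis x : C := (cos x +i* sin x)%C.

Lemma normc_ge0 (z : C) : 0 <= normc z.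
Proof. by case: z => z1 z2; rewrite /normc sqrtr_ge0. Qed.

Lemma normc_sum (I : Type) (r : seq I) (P : pred I) (F : I -> C) :
  normc (\sum_(i <- r | P i) F i) <= \sum_(i <- r | P i) normc (F i).
Proof.
elim/big_rec2: _ => [|i y1 y2 _ h]; first by rewrite normc0.
by apply: le_trans (le_normcD _ _) _; rewrite lerD2l.
Qed.

Lemma normcB (z w : C) : normc (z - w) = normc (w - z).
Proof. by rewrite -normcN opprB. Qed.

Lemma normc_real x : normc (x%:C)%C = `|x|.
Proof. by rewrite /normc /= expr0n /= addr0 sqrtr_sqr. Qed.

Lemma Re_le_normc (z : C) : complex.Re z <= normc z.
Proof.
case: z => z1 z2 /=; apply: le_trans (ler_norm z1) _.
by rewrite -sqrtr_sqr ler_sqrt ?addr_ge0 ?sqr_ge0 // lerDl sqr_ge0.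
Qed.

Lemma Im_le_normc (z : C) : `|complex.Im z| <= normc z.
Proof.
case: z => z1 z2 /=.
by rewrite -sqrtr_sqr ler_sqrt ?addr_ge0 ?sqr_ge0 // lerDr sqr_ge0.
Qed.

Lemma normc_cis x : normc (cis x) = 1.
Proof. by rewrite /normc /= cos2Dsin2 sqrtr1. Qed.

Lemma cis0 : cis 0 = 1.
Proof. by rewrite /cis cos0 sin0. Qed.

Lemma cisD x y : cis (x + y) = cis x * cis y.
Proof.
rewrite /cis cosD sinD; apply/eqP; rewrite eq_complex /=.
by rewrite eqxx [X in _ == X]addrC [sin x * cos y]mulrC [cos y * _]mulrC eqxx.
Qed.

Lemma cis_neq0 x : cis x != 0.
Proof.
apply/eqP => /(congr1 (@normc R)); rewrite normc_cis normc0 => /eqP.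
by rewrite oner_eq0.
Qed.

Lemma cisN x : cis (- x) = (cis x)^-1.
Proof.
apply: (mulIf (cis_neq0 x)); rewrite mulVf ?cis_neq0 //.
by rewrite -cisD addNr cis0.
Qed.

Lemma cisMn (n : nat) x : cis (n%:R * x) = cis x ^+ n.
Proof.
elim: n => [|n IHn]; first by rewrite mul0r cis0 expr0.
by rewrite -natr1 mulrDl mul1r cisD IHn exprSr.
Qed.

Lemma cispi : cis pi = -1.
Proof. by rewrite /cis cospi sinpi; apply/eqP; rewrite eq_complex /= oppr0 !eqxx. Qed.

Lemma cis2pi : cis (2 * pi) = 1.
Proof. by rewrite mulr_natl mulr2n cisD cispi mulrNN mulr1. Qed.

Lemma cis_neq1 x : 0 < x < 2 * pi -> cis x != 1.
Proof.
move=> /andP[x0 xpi]; apply/eqP => /(congr1 (@complex.Re R)) /= cx.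
have s0 : 0 < sin (x / 2) by apply: sin_gt0_pi; lra.
have := cos_mulr2n (x / 2); rewrite cos2sin2 -[x / 2 *+ 2]mulr_natr divfK // cx.
have : 0 < sin (x / 2) ^+ 2 by rewrite exprn_gt0.
by rewrite mulr2n; lra.
Qed.

Definition grid (N p : nat) : R := 2 * pi * p%:R / N%:R.

Lemma gridE N p : grid N p = p%:R * (2 * pi / N%:R).
Proof. by rewrite /grid; ring. Qed.

Let sum_roots N (z : C) : z ^+ N = 1 -> z != 1 -> \sum_(p < N) z ^+ p = 0.
Proof.
move=> zN z1; have := subrX1 z N; rewrite zN subrr => /esym/eqP.
by rewrite mulf_eq0 subr_eq0 (negbTE z1) /= => /eqP.
Qed.

Lemma grid_orthogonal N j n : (j < N)%N -> (n < N)%N ->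
  \sum_(p < N) cis (j%:R * grid N p) * cis (- (n%:R * grid N p)) =
  if j == n then N%:R else 0.
Proof.
move=> jN nN; have N0 : (0 < N)%N by exact: leq_ltn_trans jN.
have Nr : N%:R != 0 :> R by rewrite pnatr_eq0 -lt0n.
have root m : (0 < m < N)%N -> let z := cis (m%:R * (2 * pi / N%:R)) in
    z ^+ N = 1 /\ z != 1.
  move=> /andP[m0 mN]; split.
    rewrite -cisMn (_ : N%:R * _ = m%:R * (2 * pi)); last by field.
    by rewrite cisMn cis2pi expr1n.
  apply: cis_neq1; rewrite mulrA; apply/andP; split.
    by rewrite divr_gt0 ?ltr0n // mulr_gt0 ?ltr0n // mulr_gt0 // pi_gt0.
  rewrite ltr_pdivrMr ?ltr0n // mulrC ltr_pM2l ?ltr_nat //.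
  by rewrite mulr_gt0 // pi_gt0.
have [->|jn] := eqVneq j n.
  rewrite (eq_bigr (fun=> 1)) ?sumr_const ?card_ord // => p _.
  by rewrite -cisD subrr cis0.
have [nj|jn'|/eqP] := ltngtP n j; last by rewrite eq_sym (negbTE jn).
  have [zN z1] := root (j - n)%N ltac:(lia).
  rewrite -[RHS](sum_roots zN z1); apply: eq_bigr => p _.
  rewrite -cisD -cisMn gridE natrB ?(ltnW nj) //; congr cis; ring.
have [zN z1] := root (n - j)%N ltac:(lia).
have iN : (cis ((n - j)%:R * (2 * pi / N%:R)))^-1 ^+ N = 1 by rewrite exprVn zN invr1.
have i1 : (cis ((n - j)%:R * (2 * pi / N%:R)))^-1 != 1 by rewrite invr_eq1.
rewrite -[RHS](sum_roots iN i1); apply: eq_bigr => p _.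
rewrite -cisD -cisN -cisMn gridE natrB ?(ltnW jn') //; congr cis; ring.
Qed.

Lemma dft (N n : nat) (P : nat -> R) : (n < N)%N ->
  \sum_(p < N) (\sum_(j < N) (P j)%:C%C * cis (j%:R * grid N p)) *
     cis (- (n%:R * grid N p)) = (N%:R * P n)%:C%C.
Proof.
move=> nN; under eq_bigr do rewrite mulr_suml.
rewrite exchange_big /=; under eq_bigr do under eq_bigr do rewrite -mulrA.
under eq_bigr do rewrite -mulr_sumr grid_orthogonal //.
rewrite (bigD1 (Ordinal nN)) //= eqxx [X in _ + X]big1 => [|j jn].
  by rewrite addr0 rmorphM rmorph_nat mulrC.
rewrite ifF ?mulr0 //.
by apply/negbTE; apply: contra jn => /eqP jn; apply/eqP/val_inj.
Qed.

End Cis.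

(** * The truncated renewal sequence *)

Section TruncatedRenewal.
Variables (R : realType) (a : nat -> R).
Hypothesis a_part : is_partition a.
Local Notation t := (tail a).
Variable J : nat.

(* Truncation makes the symbol a trigonometric polynomial bounded away from 0
   and leaves u_n unchanged for n <= J. *)
Definition trunc i : R := if (i <= J)%N then a i else 0.
Local Notation v := (renewal trunc).

Lemma renewal_trunc n : (n <= J)%N -> v n = renewal a n.
Proof.
elim/ltn_ind: n => -[|n] IHn nJ; first by rewrite !renewal0.
rewrite !renewalS; apply: eq_bigr => k _.
rewrite /trunc (leq_trans (ltn_ord k) nJ).
by rewrite IHn // ?ltnS ?leq_subr // (leq_trans (leq_subr _ _)) // ltnW.
Qed.

Lemma trunc_ge0 i : (0 < i)%N -> 0 <= trunc i.
Proof. by move=> i0; rewrite /trunc; case: ifP => // _; exact/ltW/partition_gt0. Qed.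

Lemma renewal_trunc_ge0 n : 0 <= v n.
Proof.
elim/ltn_ind: n => -[_|n IHn]; first by rewrite renewal0.
rewrite renewalS sumr_ge0 // => k _; rewrite mulr_ge0 ?trunc_ge0 //.
by rewrite IHn // ltnS leq_subr.
Qed.

(** The tails of the truncated weights together with the missing mass t_(J+1), the value at which d
    stays from J on. *)
Let d n : R := 1 - \sum_(i < n) trunc i.+1.

Let conv_d n : conv v d n = 1.
Proof.
elim: n => [|n IHn].
  by rewrite /conv big_ord1 renewal0 mul1r /d big_ord0 subr0.
rewrite convC /conv big_ord_recl /= {1}/d big_ord0 subr0 mul1r subn0 renewalS -big_split /=.
rewrite -[RHS]IHn convC /conv; apply: eq_bigr => k _.
rewrite /bump /= add1n subSS -mulrDl; congr (_ * _).
by rewrite /d big_ord_recr /=; ring.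
Qed.

Let d_const n : (J <= n)%N -> d n = t J.+1.
Proof.
move=> Jn; rewrite (tailE a_part) /d -(big_mkord xpredT (fun i => trunc i.+1)).
rewrite (@big_cat_nat _ _ _ J) //= big_add1 /=.
rewrite [\sum_(J <= i < n) _]big_nat_cond (@big1 _ _ _ _ (index_iota J n)) => [|i /andP[/andP[Ji _] _]];
  last by rewrite /trunc leqNgt ltnS Ji.
rewrite addr0.
by congr (_ - _); rewrite !big_mkord; apply: eq_bigr => i _; rewrite /trunc ltn_ord.
Qed.

Let d_ge n : t J.+1 <= d n.
Proof.
rewrite -(@d_const (n + J)) ?leq_addl // /d lerD2l lerN2 big_split_ord /=.
by rewrite lerDl sumr_ge0 // => i _; exact: trunc_ge0.
Qed.

Let d_le1 n : d n <= 1.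
Proof. by rewrite /d gerBl sumr_ge0 // => i _; exact: trunc_ge0. Qed.

Let S n : R := \sum_(k < n) v k.

(** The truncated process dies out: d >= t_(J+1) in v * d = 1 bounds its total mass. *)
Lemma trunc_mass_le n : t J.+1 * \sum_(k < n) v k <= 1.
Proof.
case: n => [|n]; first by rewrite big_ord0 mulr0.
rewrite -[leRHS](conv_d n) mulr_sumr; apply: ler_sum => k _.
by rewrite mulrC ler_wpM2l ?renewal_trunc_ge0.
Qed.

(** In v * d = 1 the terms at distance at least J from the end carry the factor t_(J+1) and cancel;
    the others lie in the last block, where d <= 1. *)
Let defect_le n L : (J <= L)%N -> (0 < L)%N ->
  1 - t J.+1 * S (n + L) <= S (n + L) - S n.
Proof.
move=> JL L0; have [m mE] : exists m, (n + L = m.+1)%N by exists (n + L).-1; lia.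
rewrite mE -{1}(conv_d m) /conv /S mulr_sumr -sumrB -mE !big_split_ord /= addrAC subrr add0r.
rewrite -[leRHS]add0r; apply: lerD.
  apply: sumr_le0 => k _; have kn := ltn_ord k.
  by rewrite d_const 1?[v k * _]mulrC ?subrr //; lia.
apply: ler_sum => k _.
have h1 := renewal_trunc_ge0 (n + k); have h2 := d_le1 (m - (n + k)).
have h3 := tail_ge0 a_part (ltn0Sn J).
have : v (n + k) * d (m - (n + k)) <= v (n + k) by rewrite ler_piMr.
have : 0 <= t J.+1 * v (n + k) by rewrite mulr_ge0.
by lra.
Qed.

(* Consecutive blocks of length L carry a bounded total mass, so one of them
   carries little. *)
Lemma small_defect (L : nat) (e : R) : (J <= L)%N -> (0 < L)%N -> 0 < e ->
  exists q, 1 - t J.+1 * \sum_(k < q.+1 * L) v k <= e.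
Proof.
move=> JL L0 e0; apply: contrapT => H.
have big q : q%:R * e <= S (q * L).
  elim: q => [|q IHq]; first by rewrite mul0r /S mul0n big_ord0.
  have : ~ (1 - t J.+1 * S (q.+1 * L) <= e) by move=> h; apply: H; exists q.
  move/negP; rewrite -ltNge => h1.
  have := defect_le (q * L) JL L0; rewrite addnC -mulSn => h2.
  by rewrite -natr1 mulrDl mul1r; lra.
have tJ := tail_gt0 a_part (ltn0Sn J).
have [q [q0 hq]] := nat_large (2 / (t J.+1 * e)).
have te : 0 < t J.+1 * e by rewrite mulr_gt0.
have h1 : t J.+1 * (q%:R * e) <= 1.
  by apply: le_trans (trunc_mass_le (q * L)); rewrite ler_pM2l.
move: hq; rewrite ler_pdivrMr // => h2.
have : q%:R * (t J.+1 * e) = t J.+1 * (q%:R * e) by ring.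
by lra.
Qed.

End TruncatedRenewal.

Section Symbol.
Variables (R : realType) (a : nat -> R).
Hypothesis a_part : is_partition a.
Local Notation t := (tail a).
Local Notation T := (tsum a).
Local Notation C := R[i].
Variable J : nat.
Local Notation v := (renewal (trunc a J)).

Definition gsym (x : R) : C :=
  1 - \sum_(i < J) (a i.+1)%:C%C * cis (i.+1%:R * x).

Let evc (p : {poly R}) (x : R) : C := (map_poly (real_complex R) p).[cis x].

Let evc_poly n (f : nat -> R) x :
  evc (\poly_(i < n) f i) x = \sum_(i < n) (f i)%:C%C * cis (i%:R * x).
Proof.
rewrite /evc (@horner_coef_wide _ n); last first.
  by rewrite (leq_trans (size_poly _ _)) // size_poly.
by apply: eq_bigr => i _; rewrite coef_map coef_poly ltn_ord cisMn.
Qed.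

Let evc_norm (p : {poly R}) x : (forall i, 0 <= p`_i) -> normc (evc p x) <= p.[1].
Proof.
move=> p0; rewrite horner_coef /evc (@horner_coef_wide _ (size p)) ?size_poly //.
apply: le_trans (normc_sum _ _ _) _; apply: ler_sum => i _.
rewrite normcM coef_map normc_real ger0_norm // expr1n -cisMn normc_cis.
by [].
Qed.

Let G : {poly R} := \poly_(i < J.+1) (if i == 0%N then 1 else - a i).

Let evc_G x : evc G x = gsym x.
Proof.
rewrite evc_poly big_ord_recl /= mul0r cis0 mulr1 rmorph1 /gsym -sumrN; congr (_ + _).
by apply: eq_bigr => i _; rewrite rmorphN mulNr.
Qed.

Let G1 : G.[1] = t J.+1.
Proof.
rewrite horner_poly big_ord_recl /= expr0 mulr1 (tailE a_part) big_add1 /= big_mkord.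
by congr (_ + _); rewrite -sumrN; apply: eq_bigr => i _; rewrite expr1n mulr1.
Qed.

(** Below N the coefficients vanish by the recursion, from N on they are sums of nonnegative
    products. By [evc_norm] the error on the whole circle is then at most its value at the point
    1. *)
Let defect_coef N i : 0 <= (1 - G * \poly_(j < N) v j)`_i.
Proof.
have Gi j : G`_j.+1 = - trunc a J j.+1.
  by rewrite coef_poly /trunc ltnS; case: ifP => // _; rewrite oppr0.
rewrite coefB coef1 coefM big_ord_recl subn0 [G`_0]coef_poly /= mul1r.
have -> : \sum_(k < i) G`_(bump 0 k) * (\poly_(j < N) v j)`_(i - bump 0 k) =
   - \sum_(k < i) trunc a J k.+1 * (if (i - k.+1 < N)%N then v (i - k.+1) else 0).
  by rewrite -sumrN; apply: eq_bigr => k _; rewrite /bump /= add1n Gi coef_poly mulNr.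
rewrite coef_poly; case: i => [|i].
  by rewrite big_ord0 oppr0 addr0; case: ifP => _; rewrite ?renewal0 ?subrr ?subr0 ?ler01.
rewrite /= sub0r opprD opprK; case: ltnP => iN.
  rewrite renewalS addrC -sumrB sumr_ge0 // => k _.
  by rewrite subSS ifT ?subrr // (leq_ltn_trans (leq_subr _ _)) // ltnW.
rewrite oppr0 add0r sumr_ge0 // => k _; apply: mulr_ge0; first exact: trunc_ge0.
by case: ifP => // _; exact: renewal_trunc_ge0.
Qed.

Let gsym_renewal N x : normc (gsym x *
  (\sum_(j < N) (v j)%:C%C * cis (j%:R * x)) - 1) <= 1 - t J.+1 * \sum_(k < N) v k.
Proof.
have -> : gsym x * (\sum_(j < N) (v j)%:C%C * cis (j%:R * x)) - 1 =
    - evc (1 - G * \poly_(j < N) v j) x.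
  rewrite -evc_G -evc_poly /evc rmorphB rmorphM rmorph1 hornerD hornerN hornerM.
  by rewrite hornerC opprB.
rewrite normcN; apply: le_trans (evc_norm _ (defect_coef N)) _.
rewrite hornerD hornerN hornerM hornerC G1 horner_poly.
by rewrite lerD2l lerN2 ler_wpM2l ?(ltW (tail_gt0 a_part _)) //;
  apply: ler_sum => i _; rewrite expr1n mulr1.
Qed.

Lemma Re_gsym x : complex.Re (gsym x) =
  t J.+1 + \sum_(i < J) a i.+1 * (1 - cos (i.+1%:R * x)).
Proof.
rewrite (tailE a_part) big_add1 /= big_mkord -addrA [- _ + _]addrC -sumrB /gsym.
have -> : complex.Re (1 - \sum_(i < J) (a i.+1)%:C%C * cis (i.+1%:R * x)) =
   1 - \sum_(i < J) a i.+1 * cos (i.+1%:R * x).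
  elim: J => [|m IHm]; first by rewrite !big_ord0 !subr0.
  rewrite !big_ord_recr /= !opprD !addrA -IHm.
  by case: (1 - _) => z1 z2 /=; rewrite mul0r subr0.
by congr (_ + _); rewrite -sumrN; apply: eq_bigr => i _; ring.
Qed.

Lemma Im_gsym x : complex.Im (gsym x) = - \sum_(i < J) a i.+1 * sin (i.+1%:R * x).
Proof.
rewrite /gsym; elim: J => [|m IHm]; first by rewrite !big_ord0 subr0 oppr0.
rewrite !big_ord_recr /= !opprD !addrA -IHm.
by case: (1 - _) => z1 z2 /=; rewrite mul0r addr0.
Qed.

Lemma gsym_ge x : t J.+1 <= normc (gsym x).
Proof.
apply: le_trans (Re_le_normc _); rewrite Re_gsym lerDl sumr_ge0 // => i _.
by rewrite mulr_ge0 ?(ltW (partition_gt0 a_part _)) // subr_ge0 cos_le1.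
Qed.

Lemma gsym_neq0 x : gsym x != 0.
Proof.
apply/eqP => g0; have := gsym_ge x; rewrite g0 normc0 leNgt.
by rewrite (tail_gt0 a_part).
Qed.

(** The coefficients are real, so reflecting the grid conjugates the symbol; frequencies beyond pi
    reduce to those below. *)
Lemma gsym_reflect N p : (0 < N)%N -> (p <= N)%N ->
  normc (gsym (grid R N (N - p))) = normc (gsym (grid R N p)).
Proof.
move=> N0 pN; rewrite /gsym.
have Nr : N%:R != 0 :> R by rewrite pnatr_eq0 -lt0n.
have E i : cis (i%:R * grid R N (N - p)) = (cis (i%:R * grid R N p))^*%C.
  have -> : i%:R * grid R N (N - p) = i%:R * (2 * pi) + - (i%:R * grid R N p).
    by rewrite /grid natrB //; field.
  rewrite cisD cisMn cis2pi expr1n mul1r /cis cosN sinN.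
  by apply/eqP; rewrite eq_complex /= !eqxx.
have -> : 1 - \sum_(i < J) (a i.+1)%:C%C * cis (i.+1%:R * grid R N (N - p)) =
   (1 - \sum_(i < J) (a i.+1)%:C%C * cis (i.+1%:R * grid R N p))^*%C.
  rewrite rmorphB rmorph1 rmorph_sum; congr (_ - _); apply: eq_bigr => i _.
  rewrite rmorphM E; congr (_ * _).
  by apply/eqP; rewrite eq_complex /= oppr0 !eqxx.
by case: (1 - _) => z1 z2; rewrite /normc /= sqrrN.
Qed.

(** The transform of v differs from the inverse symbol by (g V - 1) / g. The numerator is at most e
    t_(J+1) for a suitable q, and |g| >= t_(J+1). The grid size is a multiple of a prescribed L so
    that the caller can make half-periods integral. *)
Lemma renewal_dft (L : nat) (e : R) : (J <= L)%N -> (0 < L)%N -> 0 < e ->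
  exists q, forall n, (n < q.+1 * L)%N ->
  normc ((v n)%:C%C - ((q.+1 * L)%:R^-1)%:C%C * \sum_(p < q.+1 * L)
    (gsym (grid R (q.+1 * L) p))^-1 * cis (- (n%:R * grid R (q.+1 * L) p))) <= e.
Proof.
move=> JL L0 e0; have tJ := tail_gt0 a_part (ltn0Sn J).
have [q Hq] := small_defect a_part JL L0 (mulr_gt0 e0 tJ).
exists q; move: Hq; set N := (q.+1 * L)%N => Hq n nN.
have Nr : 0 < N%:R :> R by rewrite ltr0n /N muln_gt0.
pose V p := \sum_(j < N) (v j)%:C%C * cis (j%:R * grid R N p).
have -> : (v n)%:C%C = (N%:R^-1)%:C%C *
   \sum_(p < N) V p * cis (- (n%:R * grid R N p)).
  rewrite dft // -rmorphM mulrA mulVf ?mul1r // gt_eqF //.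
rewrite -mulrBr normcM normc_real ger0_norm ?invr_ge0 ?(ltW Nr) //.
rewrite -sumrB mulrC ler_pdivrMr // mulrC.
have -> : N%:R * e = \sum_(p < N) e by rewrite sumr_const card_ord mulr_natl.
apply: le_trans (normc_sum _ _ _) _; apply: ler_sum => p _.
rewrite -mulrBl normcM normc_cis mulr1.
have -> : V p - (gsym (grid R N p))^-1 =
    (gsym (grid R N p))^-1 * (gsym (grid R N p) * V p - 1).
  by rewrite mulrBr mulr1 mulrA mulVf ?mul1r // gsym_neq0.
rewrite normcM normcV mulrC ler_pdivrMr; last first.
  by apply: lt_le_trans (gsym_ge _).
apply: le_trans (gsym_renewal N _) _; apply: le_trans Hq _.
by rewrite ler_pM2l // gsym_ge.
Qed.

End Symbol.

(** * Trigonometric inequalities *)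

Section Trigonometry.
Variable R : realType.

Lemma sin_mvt (y : R) : 0 < y -> exists2 z, 0 < z < y & sin y = y * cos z.
Proof.
move=> y0; have [|z] := MVT y0 (fun x _ => is_derive_sin x).
  by apply: continuous_subspaceT => x; exact: continuous_sin.
rewrite in_itv /= => zy; rewrite sin0 !subr0 => h.
by exists z => //; rewrite h mulrC.
Qed.

Lemma sin_le_norm (y : R) : `|sin y| <= `|y|.
Proof.
wlog y0 : y / 0 < y => [hw|].
  have [y0|] := ltP 0 y; first by apply: hw.
  rewrite le_eqVlt => /predU1P[->|y0]; first by rewrite sin0.
  by have := hw (- y); rewrite oppr_gt0 sinN !normrN; apply.
have [z _ ->] := sin_mvt y0.
by rewrite normrM ler_piMr // cos_max.
Qed.

Lemma cos_half (y : R) : cos y = 1 - 2 * sin (y / 2) ^+ 2.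
Proof.
have := cos_mulr2n (y / 2); rewrite cos2sin2 -[y / 2 *+ 2]mulr_natr divfK // => ->.
by rewrite mulr2n; ring.
Qed.

Lemma cos_ge (y : R) : 1 - y ^+ 2 / 2 <= cos y.
Proof.
have : sin (y / 2) ^+ 2 <= (y / 2) ^+ 2.
  rewrite -(real_normK (num_real (sin _))) -(real_normK (num_real (y / 2))).
  by rewrite ler_sqr ?nnegrE // sin_le_norm.
by rewrite cos_half => h; lra.
Qed.

Lemma sin_ge_half (y : R) : 0 <= y <= 1 -> y / 2 <= sin y.
Proof.
rewrite le_eqVlt => /andP[/predU1P[<- _|y0 y1]]; first by rewrite sin0 mul0r.
have [z /andP[z0 zy] ->] := sin_mvt y0.
by rewrite ler_pM2l //; have := cos_ge z; nra.
Qed.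

Lemma cos_le_quad (y : R) : 0 <= y <= 2 -> y ^+ 2 / 8 <= 1 - cos y.
Proof.
move=> /andP[y0 y2]; rewrite cos_half.
have : y / 2 / 2 <= sin (y / 2) by apply: sin_ge_half; lra.
by nra.
Qed.

(** Beyond 2 the half angle is halved once more; pi <= 4 puts y / 4 in [0, 1], the range of
    [sin_ge_half]. *)
Lemma cos_le_away (y : R) : 1 <= y <= pi -> 1 / 8 <= 1 - cos y.
Proof.
move=> /andP[y1 ypi]; have [y2|y2] := leP y 2.
  by have := cos_le_quad (_ : 0 <= y <= 2); rewrite y2; nra.
have pi4 : pi <= 4 :> R by have /andP[_ h] := pihalf_02 R; lra.
rewrite cos_half; have s : y / 2 / 2 / 2 <= sin (y / 2 / 2) by apply: sin_ge_half; lra.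
have c := cos_ge (y / 2 / 2).
have -> : sin (y / 2) = 2 * (cos (y / 2 / 2) * sin (y / 2 / 2)).
  have := sin_mulr2n (y / 2 / 2).
  by rewrite -[y / 2 / 2 *+ 2]mulr_natr divfK // => ->; rewrite mulr2n; ring.
have c1 : 1 / 2 <= cos (y / 2 / 2) by nra.
have s1 : 1 / 4 <= sin (y / 2 / 2) by lra.
have cs : 1 / 8 <= cos (y / 2 / 2) * sin (y / 2 / 2) by nra.
by nra.
Qed.

Lemma normc_cisB (x y : R) : normc (cis x - cis y) <= `|x - y|.
Proof.
have -> : cis x - cis y = cis y * (cis (x - y) - 1).
  by rewrite mulrBr mulr1 -cisD; congr (cis _ - _); ring.
rewrite normcM normc_cis mul1r /cis /normc /=.
rewrite -sqrtr_sqr ler_sqrt ?sqr_ge0 //.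
have := cos2Dsin2 (x - y); have := cos_ge (x - y).
by set d := x - y; rewrite subr0 => h1 h2; nra.
Qed.

Lemma normc_cisB2 (x y : R) : normc (cis x - cis y) <= 2.
Proof.
by apply: le_trans (le_normcD _ _) _; rewrite normcN !normc_cis.
Qed.

End Trigonometry.

(** * Oscillating sums, block sums and power sums *)

Section ShiftBound.
Variable R : realType.
Local Notation C := R[i].

(* The oscillation trick behind the Riemann-Lebesgue lemma: if shifting by r
   flips the sign of the phase e, then sum F e = - sum (shifted F) e, so twice
   the sum is controlled by the increments of F plus boundary terms. *)
Lemma shift_bound (F e : nat -> C) (r A B : nat) : (A + r <= B)%N ->
  (forall p, e (p + r)%N = - e p) -> (forall p, normc (e p) = 1) ->
  2 * normc (\sum_(A <= p < B) F p * e p) <=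
    \sum_(A <= p < B - r) normc (F (p + r)%N - F p) +
    \sum_(A <= p < A + r) normc (F p) + \sum_(B - r <= p < B) normc (F p).
Proof.
move=> ArB er e1.
have rB : (r <= B)%N by exact: leq_trans (leq_addl _ _) ArB.
have AB : (A <= B - r)%N by rewrite leq_subRL // addnC.
have E1 : \sum_(A <= p < B) F p * e p =
   \sum_(A <= p < A + r) F p * e p - \sum_(A <= p < B - r) F (p + r)%N * e p.
  rewrite (@big_cat_nat _ _ _ (A + r)) ?leq_addr //=; congr (_ + _).
  rewrite big_addn -sumrN; apply: eq_bigr => p _.
  by rewrite er mulrN.
have E2 : \sum_(A <= p < B) F p * e p =
   \sum_(A <= p < B - r) F p * e p + \sum_(B - r <= p < B) F p * e p.
  by rewrite (@big_cat_nat _ _ _ (B - r)) ?leq_subr.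
have -> : 2 * normc (\sum_(A <= p < B) F p * e p) =
    normc (\sum_(A <= p < B - r) (F p - F (p + r)%N) * e p +
    \sum_(A <= p < A + r) F p * e p + \sum_(B - r <= p < B) F p * e p).
  have -> : \sum_(A <= p < B - r) (F p - F (p + r)%N) * e p =
      \sum_(A <= p < B - r) F p * e p - \sum_(A <= p < B - r) F (p + r)%N * e p.
    by rewrite -sumrB; apply: eq_bigr => p _; rewrite mulrBl.
  rewrite mulr_natl -normcMn mulr2n {1}E1 E2; congr normc; ring.
apply: le_trans (le_normcD _ _) _; apply: lerD; last first.
  apply: le_trans (normc_sum _ _ _) _.
  by apply: ler_sum => p _; rewrite normcM e1 mulr1.
apply: le_trans (le_normcD _ _) _; apply: lerD.
  apply: le_trans (normc_sum _ _ _) _.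
  by apply: ler_sum => p _; rewrite normcM e1 mulr1 normcB.
apply: le_trans (normc_sum _ _ _) _.
by apply: ler_sum => p _; rewrite normcM e1 mulr1.
Qed.

Lemma sum_reflect (f : nat -> R) N X Y : (X <= Y)%N -> (Y <= N)%N ->
  \sum_(N - Y <= p < N - X) f p = \sum_(X <= p < Y) f (N - p.+1)%N.
Proof.
move=> XY YN; rewrite [RHS]big_nat_rev /= -{1}[(N - Y)%N]add0n big_addn.
rewrite -[in RHS](add0n X) big_addn.
have -> : (N - X - (N - Y) = Y - X)%N by lia.
by apply: eq_big_nat => p /andP[_ pY]; congr f; lia.
Qed.

Lemma sum_blocks (f h : nat -> R) r B n :
  (forall l i, (B <= l < n)%N -> (i < r)%N -> f (l * r + i)%N <= h l) ->
  \sum_(B * r <= p < n * r) f p <= r%:R * \sum_(B <= l < n) h l.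
Proof.
elim: n => [|n IHn] H.
  by rewrite mul0n !big_geq ?mulr0.
have [Bn|nB] := leqP B n; last first.
  by rewrite !big_geq ?mulr0 // leq_mul2r nB orbT.
rewrite (@big_cat_nat _ _ _ (n * r)) ?leq_mul2r ?Bn ?leqnSn ?orbT //=.
rewrite big_nat_recr //= mulrDr; apply: lerD.
  apply: IHn => l i /andP[Bl ln] ir; apply: H => //.
  by rewrite Bl ltnW.
rewrite mulSn -{1}[(n * r)%N]add0n big_addn addnK big_mkord sum_const_ord.
by apply: ler_sum => i _; rewrite addnC; apply: H; rewrite ?Bn /=.
Qed.

(** The comparison with the integral of x^(-s), telescoped; one step follows from e^x >= 1 + x and
    ln (1 + x) <= x. *)
Lemma tail_power_sum (s : R) (B m : nat) : 1 < s -> (2 <= B)%N ->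
  \sum_(B <= l < m) l%:R `^ (- s) <= (B.-1)%:R `^ (1 - s) / (s - 1).
Proof.
move=> s1 B2; have s0 : 0 < s - 1 by rewrite subr_gt0.
have step l : (2 <= l)%N ->
    l%:R `^ (- s) <= ((l.-1)%:R `^ (1 - s) - l%:R `^ (1 - s)) / (s - 1).
  move=> l2; have l0 : 0 < l%:R :> R by rewrite ltr0n ltnW.
  have lp : 0 < l.-1%:R :> R by rewrite ltr0n; lia.
  have ln0 : l%:R != 0 :> R by rewrite gt_eqF.
  rewrite ler_pdivlMr //.
  have -> : l%:R `^ (- s) = l%:R `^ (1 - s) * l%:R^-1 :> R.
    rewrite -[X in _ * X](powR_inv1 (ltW l0)) -powRD ?ln0 ?implybT //.
    by congr (_ `^ _); ring.
  have -> : l.-1%:R = l%:R * (l.-1%:R / l%:R) :> R by field.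
  rewrite powRM ?divr_ge0 // -{3}[l%:R `^ (1 - s)]mulr1 -mulrBr -mulrA.
  rewrite ler_pM2l ?powR_gt0 // lerBrDl.
  have q0 : 0 < l.-1%:R / l%:R :> R by rewrite divr_gt0.
  rewrite /powR gt_eqF //; apply: le_trans (expR_ge1Dx _).
  have qE : l.-1%:R / l%:R = 1 - l%:R^-1 :> R.
    have -> : l.-1%:R = l%:R - 1 :> R by rewrite -subn1 natrB // ltnW.
    by field.
  have lnq : ln (l.-1%:R / l%:R) <= - l%:R^-1 :> R.
    by rewrite qE; apply: le_ln1Dx; rewrite ltrN2 invf_lt1 // ltr1n.
  by nra.
have [mB|Bm] := leqP m B.
  by rewrite big_geq // divr_ge0 ?powR_ge0 // ltW.
apply: (@le_trans _ _ (((B.-1)%:R `^ (1 - s) - (m.-1)%:R `^ (1 - s)) / (s - 1))); last first.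
  by rewrite ler_pM2r ?invr_gt0 // gerBl powR_ge0.
elim: m Bm => // m IHm; rewrite ltnS leq_eqVlt => /predU1P[<-|Bm].
  by rewrite big_nat1; exact: step.
rewrite big_nat_recr ?(ltnW Bm) //=.
apply: le_trans (lerD (IHm Bm) (step m (leq_trans B2 (ltnW Bm)))) _.
by rewrite -mulrDl addrA subrK.
Qed.

End ShiftBound.

(** * Slow oscillation of the renewal sequence *)

Section Oscillation.
Variables (R : realType) (a : nat -> R).
Hypothesis a_part : is_partition a.
Local Notation u := (renewal a).
Local Notation t := (tail a).
Local Notation T := (tsum a).
Local Notation C := R[i].
Local Notation g := (gsym a).

(** Layer cake: the minimum counts the l < m with l <= i, and for fixed l the weights add up to at
    most t_(l+1). *)
Let mass_min J m : \sum_(i < J) a i.+1 * (minn i.+1 m)%:R <= T m.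
Proof.
have -> : T m = \sum_(l < m) t l.+1.
  by rewrite /tsum big_add1 /= big_mkord.
have -> : \sum_(i < J) a i.+1 * (minn i.+1 m)%:R =
    \sum_(l < m) \sum_(i < J | (l <= i)%N) a i.+1.
  rewrite (exchange_big_dep xpredT) //=; apply: eq_bigr => i _.
  rewrite sumr_const mulr_natr; congr (_ *+ _).
  rewrite -sum1_card -(big_mkord (fun l => l <= i)%N (fun=> 1%N)).
  have [im|mi] := leqP i.+1 m.
    rewrite (@big_cat_nat _ _ _ i.+1) //= [X in (_ + X)%N]big_nat_cond.
    rewrite [X in (_ + X)%N]big1 ?addn0 => [|l]; last lia.
    rewrite big_nat_cond (eq_bigl (fun l => 0 <= l < i.+1)%N) => [|l]; last lia.
    by rewrite -big_nat sum_nat_const_nat muln1 subn0.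
  rewrite big_nat_cond (eq_bigl (fun l => 0 <= l < m)%N) => [|l]; last lia.
  by rewrite -big_nat sum_nat_const_nat muln1 subn0.
apply: ler_sum => l _; rewrite (tailE a_part).
have [lJ|Jl] := leqP l J; last first.
  rewrite big1 => [|i]; last by have := ltn_ord i; lia.
  by rewrite -(tailE a_part) (tail_ge0 a_part).
rewrite -(big_mkord (fun i => l <= i)%N (fun i => a i.+1)) (@big_cat_nat _ _ _ l) //=.
rewrite big_nat_cond big1 ?add0r => [|i]; last lia.
rewrite -(tailE a_part) big_nat_cond (eq_bigl (fun i => l <= i < J)%N) => [|i]; last lia.
by rewrite -big_nat (tail_sum a_part) // gerBl (tail_ge0 a_part).
Qed.

(** Two values of the j-th character differ by at most j |x - y| and at most 2 <= m |x - y|, hence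
    by at most min(j, m) |x - y|. *)
Let gsym_lip J m x y : 2 <= m%:R * `|x - y| ->
  normc (g J x - g J y) <= `|x - y| * T m.
Proof.
move=> mh; have -> : g J x - g J y =
    \sum_(i < J) (a i.+1)%:C%C * (cis (i.+1%:R * y) - cis (i.+1%:R * x)).
  rewrite /gsym opprB addrC addrA subrK -sumrB.
  by apply: eq_bigr => i _; rewrite mulrBr.
apply: le_trans (normc_sum _ _ _) _.
apply: (@le_trans _ _ (`|x - y| * \sum_(i < J) a i.+1 * (minn i.+1 m)%:R)); last first.
  by rewrite ler_wpM2l ?mass_min.
rewrite mulr_sumr; apply: ler_sum => i _.
have a0 := ltW (partition_gt0 a_part (ltn0Sn i)).
rewrite normcM normc_real ger0_norm // mulrCA ler_wpM2l // [leRHS]mulrC.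
have [im|mi] := leqP i.+1 m.
  apply: le_trans (normc_cisB _ _) _.
  by rewrite -mulrBr normrM ger0_norm // distrC.
exact: le_trans (normc_cisB2 _ _) mh.
Qed.

(** The Potter bound [HP] and the symbol bound [HL] are kept abstract so that theta < 1 and theta =
    1, which prove [HL] differently, share what follows. *)
Variables (c Cp b : R).
Hypothesis c0 : 0 < c.
Hypothesis Cp0 : 0 < Cp.
Hypothesis b01 : 0 <= b < 1 / 2.
Hypothesis HP : forall n m, (0 < m)%N -> (m <= n)%N ->
  T n <= Cp * (n%:R / m%:R) `^ b * T m.
(* The condition says that m does not exceed 1/x, except that m = 1 is allowed
   for all x. *)
Hypothesis HL : forall J m x, (0 < m)%N -> (m <= J)%N -> 0 < x <= pi ->
  m%:R * x <= 1 \/ m = 1%N -> c * x * T m <= normc (g J x).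

Let C1 := 2 * Cp / c.

Let C10 : 0 < C1.
Proof. by rewrite divr_gt0 // mulr_gt0. Qed.

Let b0 : 0 <= b. Proof. by case/andP: b01. Qed.
Let bh : b < 1 / 2. Proof. by case/andP: b01. Qed.

(** Apply [HL] with m the integer part of 1/x, or m = 1 if x > 1, and pass from T m to T n by [HP].
    Since n / m <= 2 x n and b <= 1, this costs the factor 2 in [C1]. *)
Let symbol_lower n J x : (0 < n)%N -> (n <= J)%N -> 0 < x <= pi -> 1 <= x * n%:R ->
  normc (g J x)^-1 <= C1 * (n%:R / T n) * (x * n%:R) `^ (b - 1).
Proof.
move=> n0 nJ /andP[x0 xpi] xn.
have nr : 0 < n%:R :> R by rewrite ltr0n.
have Tn := tsum_gt0 a_part n0.
have [m [m0 mn mx mx2]] : exists m, [/\ (0 < m)%N, (m <= n)%N,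
    m%:R * x <= 1 \/ m = 1%N & 1 <= 2 * m%:R * x].
  have [x1|x1] := leP x 1; last by exists 1%N; split=> //; [right|lra].
  have xi : 1 <= x^-1 by rewrite invf_ge1.
  have /andP[h1 h2] := truncn_itv (ltW (lt_le_trans ltr01 xi)).
  set m := Num.truncn _ in h1 h2.
  have m0 : (0 < m)%N.
    have : 1%:R < m.+1%:R :> R by exact: le_lt_trans xi h2.
    by rewrite ltr_nat.
  exists m; split=> //.
  - by rewrite -(ler_nat R) (le_trans h1) // -(ler_pM2l x0) divff ?gt_eqF.
  - by left; rewrite -ler_pdivlMr // mul1r.
  have m1 : 1 <= m%:R :> R by rewrite ler1n.
  rewrite -ler_pdivrMr // div1r; apply: le_trans (ltW h2) _.
  by rewrite -natr1; lra.
have mr : 0 < m%:R :> R by rewrite ltr0n.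
have Tm := tsum_gt0 a_part m0.
have low := HL m0 (leq_trans mn nJ) (introT andP (conj x0 xpi)) mx.
have h1 : T n <= Cp * (2 * (x * n%:R) `^ b) * T m.
  apply: le_trans (HP m0 mn) _; rewrite ler_pM2r // ler_pM2l //.
  have h : n%:R / m%:R <= 2 * (x * n%:R).
    rewrite ler_pdivrMr //; have : n%:R * 1 <= n%:R * (2 * m%:R * x) by rewrite ler_pM2l.
    by lra.
  apply: le_trans (_ : (2 * (x * n%:R)) `^ b <= _).
    by rewrite ge0_ler_powR ?nnegrE ?divr_ge0 ?mulr_ge0 // ltW.
  rewrite powRM // ?mulr_ge0 ?(ltW x0) // ler_wpM2r ?powR_ge0 //.
  have two1 : 1 <= 2 :> R by rewrite ler1n.
  have b1 : b <= 1 by have := bh; lra.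
  by have := ler_powR two1 b1; rewrite powRr1.
have xn0 : 0 < x * n%:R by rewrite mulr_gt0.
have g0 : 0 < normc (g J x) by apply: lt_le_trans low; rewrite !mulr_gt0.
have B0 : 0 < (C1 * (n%:R / T n) * (x * n%:R) `^ (b - 1))^-1.
  rewrite invr_gt0; apply: mulr_gt0; last exact: powR_gt0.
  by apply: mulr_gt0; [exact: C10|exact: divr_gt0].
rewrite normcV -[leRHS]invrK lef_pV2 ?posrE //.
apply: le_trans low; clear B0.
have -> : (x * n%:R) `^ (b - 1) = (x * n%:R) `^ b / (x * n%:R).
  have xnn : x * n%:R != 0 by rewrite gt_eqF.
  by rewrite powRB ?xnn ?implybT // powRr1 // ltW.
have p0 : 0 < (x * n%:R) `^ b by rewrite powR_gt0.
set P := (x * n%:R) `^ b in h1 p0 *.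
have -> : (C1 * (n%:R / T n) * (P / (x * n%:R)))^-1 = c * x * (T n / (2 * Cp * P)).
  by rewrite /C1; field; rewrite !gt_eqF.
rewrite ler_pM2l ?mulr_gt0 // ler_pdivrMr ?mulr_gt0 //.
by rewrite (_ : T m * _ = Cp * (2 * P) * T m) //; ring.
Qed.

Section Grid.
(** With N = 2 n r0 a shift by r0 grid points moves the frequency by pi / n and flips the sign of
    the phase of n. B separates low frequencies, up to about B / n, from high ones. *)
Variables n J N r0 B : nat.
Hypotheses (n0 : (0 < n)%N) (nJ : (n <= J)%N) (r00 : (0 < r0)%N).
Hypotheses (NE : N = (2 * n * r0)%N) (B2 : (2 <= B)%N) (Bn : (4 * B <= n)%N).

Let F p := (g J (grid R N p))^-1.
Let phase m p : C := cis (- (m%:R * grid R N p)).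
Let phi l : R := C1 * (n%:R / T n) * l%:R `^ (b - 1).

Let N0 : (0 < N)%N.
Proof. by rewrite NE !muln_gt0 n0 r00. Qed.

Let nr : 0 < n%:R :> R. Proof. by rewrite ltr0n. Qed.
Let rr : 0 < r0%:R :> R. Proof. by rewrite ltr0n. Qed.
Let Nr : 0 < N%:R :> R. Proof. by rewrite ltr0n. Qed.
Let Tn : 0 < T n. Proof. exact: tsum_gt0. Qed.
Let NRE : N%:R = 2 * n%:R * r0%:R :> R. Proof. by rewrite NE !natrM. Qed.

Let grid_n p : grid R N p = pi * p%:R / (n%:R * r0%:R).
Proof. by rewrite /grid NRE; field; rewrite !gt_eqF. Qed.

Let phi_ge0 l : 0 <= phi l.
Proof.
apply: mulr_ge0; last exact: powR_ge0.
by apply: mulr_ge0; [exact/ltW/C10|rewrite divr_ge0 // ltW].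
Qed.

Let F_near p l : (1 <= l)%N -> (l * r0 <= p <= n * r0)%N -> normc (F p) <= phi l.
Proof.
move=> l1 /andP[lp pn].
have p0 : (0 < p)%N by apply: leq_trans lp; rewrite muln_gt0 l1.
have x0 : 0 < grid R N p.
  by rewrite grid_n divr_gt0 ?mulr_gt0 ?pi_gt0 // ltr0n.
have xpi : grid R N p <= pi.
  by rewrite grid_n ler_pdivrMr ?mulr_gt0 // ler_pM2l ?pi_gt0 // -natrM ler_nat.
have xl : l%:R <= grid R N p * n%:R.
  have -> : grid R N p * n%:R = pi * p%:R / r0%:R.
    by rewrite grid_n; field; rewrite !gt_eqF.
  rewrite ler_pdivlMr // -natrM; apply: (@le_trans _ _ p%:R); first by rewrite ler_nat.
  by rewrite ler_peMl // (le_trans _ (pi_ge2 R)) // ler1n.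
have l1r : 1 <= l%:R :> R by rewrite ler1n.
apply: le_trans (symbol_lower n0 nJ (introT andP (conj x0 xpi)) (le_trans l1r xl)) _.
apply: ler_wpM2l.
  by apply: mulr_ge0; [exact/ltW/C10|rewrite divr_ge0 // ltW].
have lr : 0 < l%:R :> R by rewrite ltr0n.
have xn0 : 0 < grid R N p * n%:R by exact: lt_le_trans xl.
rewrite (_ : b - 1 = - (1 - b)); last by ring.
rewrite !powRN lef_pV2 ?posrE ?powR_gt0 //.
by rewrite ge0_ler_powR ?nnegrE ?(ltW lr) ?(ltW xn0) //; have := bh; lra.
Qed.

Let F_reflect p : (p <= N)%N -> normc (F (N - p)) = normc (F p).
Proof. by move=> pN; rewrite /F !normcV gsym_reflect. Qed.

Let F_far p l : (1 <= l)%N -> (p <= N)%N -> (l * r0 <= N - p <= n * r0)%N ->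
  normc (F p) <= phi l.
Proof. by move=> l1 pN h; rewrite -F_reflect //; exact: F_near h. Qed.

Let Bn1 : (B < n)%N.
Proof. by apply: leq_trans Bn; rewrite -{1}[B]mul1n ltn_pmul2r // ltnW. Qed.

Let Br : (B * r0 <= n * r0)%N.
Proof. by rewrite leq_mul2r (ltnW Bn1) orbT. Qed.

Let nN : (n * r0 <= N)%N. Proof. by rewrite NE leq_mul2r leq_pmull // orbT. Qed.

Let NnE : (N - n * r0 = n * r0)%N. Proof. by rewrite NE mul2n -addnn mulnDl addnK. Qed.

Let square_sum : \sum_(B * r0 <= p < N - B * r0) normc (F p) ^+ 2 <=
  2 * r0%:R * \sum_(B <= l < n) phi l ^+ 2.
Proof.
rewrite (@big_cat_nat _ _ _ (n * r0)) //=; last by rewrite -{1}NnE leq_sub2l.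
rewrite -mulrA mulr2n mulrDl !mul1r; apply: lerD.
  apply: sum_blocks => l i /andP[Bl ln] ir.
  rewrite ler_sqr ?nnegrE ?normc_ge0 ?phi_ge0 //; apply: F_near; first exact: leq_trans (ltnW B2) Bl.
  rewrite leq_addr /=; apply: (@leq_trans (l.+1 * r0)%N); last by rewrite leq_mul2r ln orbT.
  by rewrite mulSn addnC leq_add2r ltnW.
rewrite -{1}NnE sum_reflect //; apply: sum_blocks => l i /andP[Bl ln] ir.
have pn : ((l * r0 + i).+1 <= n * r0)%N.
  apply: (@leq_trans (l.+1 * r0)%N); last by rewrite leq_mul2r ln orbT.
  by rewrite mulSn [(r0 + _)%N]addnC -addnS leq_add2l.
rewrite ler_sqr ?nnegrE ?normc_ge0 ?phi_ge0 // F_reflect ?(leq_trans pn) //.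
by apply: F_near; [exact: leq_trans (ltnW B2) Bl|rewrite pn andbT leqW // leq_addr].
Qed.

Let phase_shift m r p : (2 * m * r = N)%N -> phase m (p + r) = - phase m p.
Proof.
move=> mr; have m0 : (0 < m)%N by move: N0; rewrite -mr !muln_gt0 => /andP[].
have r0' : (0 < r)%N by move: N0; rewrite -mr !muln_gt0 => /andP[].
have mrr : 0 < m%:R :> R by rewrite ltr0n.
have rrr : 0 < r%:R :> R by rewrite ltr0n.
have -> : phase m (p + r) = cis (- (m%:R * grid R N p) + - pi).
  rewrite /phase /grid -mr !natrM natrD; congr cis; field.
  by rewrite !gt_eqF.
by rewrite cisD [cis (- pi)]cisN cispi invrN1 mulrN1.
Qed.

Let wide m r : (2 * m * r = N)%N -> (n <= m)%N -> (r <= r0)%N.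
Proof.
move=> mr nm; rewrite -(leq_pmul2l (_ : 0 < 2 * n)%N) ?muln_gt0 // -NE -mr.
by rewrite leq_mul2r leq_mul2l nm !orbT.
Qed.

(** The difference of inverses is the product of the inverses times the difference of symbols; the
    latter is bounded by [gsym_lip], pi <= 4 and T m / m <= T n / n, and 2xy <= x^2 + y^2 brings in
    the squares. *)
Let F_diff m r p : (2 * m * r = N)%N -> (n <= m)%N ->
  normc (F (p + r)%N - F p) <=
  2 * (T n / n%:R) * (normc (F (p + r)%N) ^+ 2 + normc (F p) ^+ 2).
Proof.
move=> mr nm; have m0 : (0 < m)%N by exact: leq_trans nm.
have mrr : 0 < m%:R :> R by rewrite ltr0n.
have r0' : (0 < r)%N by move: N0; rewrite -mr !muln_gt0 => /andP[].
have rrr : 0 < r%:R :> R by rewrite ltr0n.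
have hE : grid R N p - grid R N (p + r) = - (pi / m%:R).
  by rewrite /grid -mr !natrM natrD; field; rewrite !gt_eqF.
have hn : `|grid R N p - grid R N (p + r)| = pi / m%:R.
  by rewrite hE normrN ger0_norm // divr_ge0 // pi_ge0.
have lip : normc (g J (grid R N p) - g J (grid R N (p + r))) <= 4 * (T n / n%:R).
  apply: le_trans (gsym_lip J (_ : 2 <= m%:R * _)) _.
    by rewrite hn mulrC divfK ?gt_eqF // pi_ge2.
  have Tm := tsum_gt0 a_part m0.
  rewrite hn mulrAC -mulrA; apply: ler_pM; rewrite ?pi_ge0 ?divr_ge0 ?(ltW Tm) //.
    by have /andP[_ h] := pihalf_02 R; lra.
  rewrite ler_pdivrMr // mulrAC ler_pdivlMr // .
  have := wsum_le a_part nm.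
  by rewrite /wsum ler_pdivlMr // mulrAC ler_pdivrMr // mulrC [T n * _]mulrC.
have -> : F (p + r)%N - F p =
    F (p + r)%N * F p * (g J (grid R N p) - g J (grid R N (p + r))).
  by rewrite /F; field; rewrite !gsym_neq0.
rewrite !normcM.
set x := normc (F _); set y := normc (F p).
have x0 : 0 <= x by exact: normc_ge0.
have y0 : 0 <= y by exact: normc_ge0.
apply: le_trans (ler_wpM2l (mulr_ge0 x0 y0) lip) _.
have : 0 <= T n / n%:R by rewrite divr_ge0 // ltW.
by set z := T n / n%:R => z0; have := sqr_ge0 (x - y); nra.
Qed.

(** By [shift_bound] at a half-period r: [F_diff] and [square_sum] control the increments, and the
    two boundary pieces have length r <= r0 with terms at most [phi B]. *)
Let high m r : (2 * m * r = N)%N -> (n <= m)%N ->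
  normc (\sum_(B * r0 <= p < N - B * r0) F p * phase m p) <=
  4 * (T n / n%:R) * r0%:R * \sum_(B <= l < n) phi l ^+ 2 + r0%:R * phi B.
Proof.
move=> mr nm; have rr0 := wide mr nm.
have Br0 : (B.+1 * r0 <= n * r0)%N by rewrite leq_mul2r Bn1 orbT.
have ArB : (B * r0 + r <= N - B * r0)%N.
  apply: (@leq_trans (n * r0)%N); last by rewrite -{1}NnE leq_sub2l.
  by apply: leq_trans Br0; rewrite mulSn addnC leq_add2r.
have AB : (B * r0 <= N - B * r0 - r)%N by rewrite leq_subRL 1?addnC //;
  exact: leq_trans (leq_addl _ _) ArB.
have := shift_bound F ArB (fun p => phase_shift p mr) (fun p => normc_cis _).
set S := normc _ => h.
have s1 : \sum_(B * r0 <= p < N - B * r0 - r) normc (F (p + r)%N - F p) <=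
    8 * (T n / n%:R) * r0%:R * \sum_(B <= l < n) phi l ^+ 2.
  have z0 : 0 <= T n / n%:R by rewrite divr_ge0 // ltW.
  apply: (@le_trans _ _ (\sum_(B * r0 <= p < N - B * r0 - r) 2 * (T n / n%:R) *
      (normc (F (p + r)%N) ^+ 2 + normc (F p) ^+ 2))).
    by apply: ler_sum => p _; exact: F_diff nm.
  rewrite -mulr_sumr big_split /=.
  have q1 : \sum_(B * r0 <= p < N - B * r0 - r) normc (F (p + r)%N) ^+ 2 <=
      \sum_(B * r0 <= p < N - B * r0) normc (F p) ^+ 2.
    rewrite [leRHS](@big_cat_nat _ _ _ (B * r0 + r)) ?leq_addr //=.
    rewrite big_addn lerDr sumr_ge0 // => p _.
    by rewrite exprn_ge0 // normc_ge0.
  have q2 : \sum_(B * r0 <= p < N - B * r0 - r) normc (F p) ^+ 2 <=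
      \sum_(B * r0 <= p < N - B * r0) normc (F p) ^+ 2.
    rewrite [leRHS](@big_cat_nat _ _ _ (N - B * r0 - r)) ?leq_subr //=.
    by rewrite lerDl sumr_ge0 // => p _; rewrite exprn_ge0 // normc_ge0.
  apply: le_trans (ler_wpM2l _ (lerD (le_trans q1 square_sum) (le_trans q2 square_sum))) _.
    by rewrite mulr_ge0.
  by rewrite le_eqVlt; apply/orP; left; apply/eqP; ring.
have s2 : \sum_(B * r0 <= p < B * r0 + r) normc (F p) <= r0%:R * phi B.
  apply: (@le_trans _ _ (\sum_(B * r0 <= p < B * r0 + r) phi B)).
    apply: ler_sum_nat => p /andP[p1 p2]; apply: F_near; first exact: ltnW.
    rewrite p1 (leq_trans _ Br0) // mulSn addnC (leq_trans (ltnW p2)) //.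
    by rewrite leq_add2l.
  rewrite sumr_const_nat addKn.
  by rewrite -[leLHS]mulr_natl ler_wpM2r // ler_nat.
have s3 : \sum_(N - B * r0 - r <= p < N - B * r0) normc (F p) <= r0%:R * phi B.
  apply: (@le_trans _ _ (\sum_(N - B * r0 - r <= p < N - B * r0) phi B)).
    apply: ler_sum_nat => p /andP[p1 p2].
    have pN : (p <= N)%N by apply: leq_trans (ltnW p2) (leq_subr _ _).
    apply: F_far => //; first exact: ltnW.
    have BN : (B * r0 <= N)%N by exact: leq_trans Br nN.
    have h1 : (B * r0 <= N - p)%N.
      by rewrite leq_subRL // addnC -leq_subRL // ltnW.
    rewrite h1 (leq_trans _ Br0) // mulSn (@leq_trans (B * r0 + r)%N) //.
      by rewrite leq_subLR addnC -leq_subLR subnDA.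
    by rewrite addnC leq_add2r.
  rewrite sumr_const_nat subKn; last by exact: leq_trans (leq_addl _ _) ArB.
  by rewrite -[leLHS]mulr_natl ler_wpM2r // ler_nat.
by move: h s1 s2 s3; lra.
Qed.

(* At frequencies up to B/n the phases at n and n + k are compared directly; at
   the others both sums are small separately. *)
Let low_term k p : (0 < p)%N -> (p <= B * r0)%N ->
  normc (F p) * (k%:R * grid R N p) <= 8 * B%:R * k%:R / (c * T n).
Proof.
(* The largest frequency here is pi B / n, so m x <= pi / 4 <= 1, while m is still of order n /
   B. *)
move=> p0 pB; pose m := (n %/ (4 * B))%N.
have B0 : (0 < B)%N by exact: ltnW.
have B40 : (0 < 4 * B)%N by rewrite muln_gt0.
have m0 : (0 < m)%N by rewrite /m divn_gt0.
have mB : (m * (4 * B) <= n)%N by exact: leq_divM.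
have nm : (n <= 8 * B * m)%N.
  apply: leq_trans (ltnW (ltn_ceil n B40)) _; rewrite -/m mulnC.
  rewrite -[8%N]/(4 * 2)%N -!mulnA [(2 * _)%N]mulnC -!mulnA leq_mul2l leq_mul2l /=.
  by rewrite mulnC mul2n -addnn -addn1 leq_add2l m0 orbT.
have mn : (m <= n)%N by exact: leq_div.
have x0 : 0 < grid R N p by rewrite grid_n divr_gt0 ?mulr_gt0 ?pi_gt0 // ltr0n.
have xpi : grid R N p <= pi.
  rewrite grid_n ler_pdivrMr ?mulr_gt0 // ler_pM2l ?pi_gt0 // -natrM ler_nat.
  exact: leq_trans pB Br.
have xB : n%:R * grid R N p <= pi * B%:R.
  have -> : n%:R * grid R N p = pi * p%:R / r0%:R.
    by rewrite grid_n; field; rewrite !gt_eqF.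
  by rewrite ler_pdivrMr // -mulrA ler_pM2l ?pi_gt0 // -natrM ler_nat.
have mx : m%:R * grid R N p <= 1.
  have Br1 : 0 < 4 * B%:R :> R by rewrite -natrM ltr0n.
  rewrite -(ler_pM2r Br1) mul1r mulrAC; apply: (@le_trans _ _ (n%:R * grid R N p)).
    by rewrite ler_pM2r // -!natrM ler_nat.
  apply: le_trans xB _; rewrite ler_wpM2r //.
  by have /andP[_ h] := pihalf_02 R; lra.
have low := HL m0 (leq_trans mn nJ) (introT andP (conj x0 xpi)) (or_introl mx).
have Tm := tsum_gt0 a_part m0.
have TB : T n <= 8 * B%:R * T m.
  have mr : 0 < m%:R :> R by rewrite ltr0n.
  have := wsum_le a_part mn; rewrite /wsum ler_pdivrMr // mulrAC ler_pdivlMr // => h.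
  rewrite -(ler_pM2l mr); apply: le_trans h _.
  rewrite mulrA ler_pM2r // mulrC -!natrM ler_nat.
  exact: nm.
have cx := mulr_gt0 c0 x0.
have g0 : 0 < normc (g J (grid R N p)) := lt_le_trans (mulr_gt0 cx Tm) low.
rewrite /F normcV mulrC ler_pdivrMr //.
have cT : 0 < c * T n by rewrite mulr_gt0.
rewrite mulrAC ler_pdivlMr //.
have h1 : c * grid R N p * T n <= 8 * B%:R * (c * grid R N p * T m).
  by rewrite [leRHS]mulrCA (ler_pM2l cx).
have h2 : 8 * B%:R * (c * grid R N p * T m) <= 8 * B%:R * normc (g J (grid R N p)).
  by rewrite ler_wpM2l // mulr_ge0.
have := ler_wpM2l (ler0n R k) (le_trans h1 h2).
by set G := normc _; lra.
Qed.

Let low k : normc (\sum_(0 <= p < B * r0) F p * (phase n p - phase (n + k) p)) +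
  normc (\sum_(N - B * r0 <= p < N) F p * (phase n p - phase (n + k) p)) <=
  2 * (B * r0)%:R * (8 * B%:R * k%:R / (c * T n)).
Proof.
set X : R := 8 * B%:R * k%:R / (c * T n).
have X0 : 0 <= X by rewrite /X divr_ge0 // mulr_ge0 // ltW.
rewrite -mulrA mulr2n mulrDl !mul1r.
apply: lerD; (apply: le_trans (normc_sum _ _ _) _).
  rewrite big_mkord sum_const_ord; apply: ler_sum => p _.
  (* At frequency 0 both phases are 1 and the term vanishes; [low_term] covers p > 0. *)
  have [->|p0] := posnP p.
    by rewrite /phase /grid mulr0 mul0r !mulr0 oppr0 subrr mulr0 normc0 X0.
  rewrite normcM; apply: le_trans (low_term k p0 (ltnW (ltn_ord p))).
  rewrite ler_wpM2l ?normc_ge0 //; apply: le_trans (normc_cisB _ _) _.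
  rewrite natrD (_ : _ - _ = k%:R * grid R N p); last by ring.
  by rewrite ger0_norm // mulr_ge0 // grid_n divr_ge0 ?mulr_ge0 ?pi_ge0.
have BN : (B * r0 <= N)%N by exact: leq_trans Br nN.
rewrite -[X in \sum_(_ <= _ < X) _]subn0 sum_reflect // big_mkord sum_const_ord.
apply: ler_sum => p _; have pB := ltn_ord p.
have pN : (p.+1 <= N)%N by exact: leq_trans pB BN.
rewrite normcM F_reflect //; apply: le_trans (low_term k (ltn0Sn p) pB).
rewrite ler_wpM2l ?normc_ge0 //.
have E m : phase m (N - p.+1) = cis (m%:R * grid R N p.+1).
  have -> : phase m (N - p.+1) = cis (- (m%:R * (2 * pi)) + m%:R * grid R N p.+1).
    by rewrite /phase /grid natrB //; congr cis; field; rewrite gt_eqF.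
  by rewrite cisD cisN cisMn cis2pi expr1n invr1 mul1r.
rewrite !E; apply: le_trans (normc_cisB _ _) _.
rewrite natrD (_ : _ - _ = - (k%:R * grid R N p.+1)); last by ring.
by rewrite normrN ger0_norm // mulr_ge0 // grid_n divr_ge0 ?mulr_ge0 ?pi_ge0.
Qed.

(** The hypothesis on r1 provides a half-period for the phase of n + k as well. The three summands
    come from the low frequencies, the squares of the inverse symbol and the boundary terms of the
    shifts. *)
Lemma grid_sum_bound k r1 tau : (2 * (n + k) * r1 = N)%N ->
  \sum_(B <= l < n) l%:R `^ (- (2 - 2 * b)) <= tau ->
  N%:R^-1 * normc (\sum_(p < N) (F p * phase n p - F p * phase (n + k) p)) <=
  (8 * B%:R ^+ 2 * (k%:R / n%:R) / c + 4 * C1 ^+ 2 * tau + C1 * B%:R `^ (b - 1)) / T n.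
Proof.
move=> Nr1 htau.
have h1 := high (m := n) (r := r0) (esym NE) (leqnn n).
have h2 := high Nr1 (leq_addr k n).
have h3 := low k.
have phi2 : \sum_(B <= l < n) phi l ^+ 2 <= C1 ^+ 2 * (n%:R / T n) ^+ 2 * tau.
  have K0 : 0 <= C1 ^+ 2 * (n%:R / T n) ^+ 2.
    by apply: mulr_ge0; apply: exprn_ge0; [exact/ltW/C10|rewrite divr_ge0 // ltW].
  apply: le_trans (ler_wpM2l K0 htau); rewrite mulr_sumr; apply: ler_sum => l _.
  rewrite /phi 2!exprMn; apply: ler_wpM2l => //.
  by rewrite -powR_mulrn ?powR_ge0 // -powRrM (_ : (b - 1) * 2%:R = - (2 - 2 * b)) //; ring.
have tot : normc (\sum_(p < N) (F p * phase n p - F p * phase (n + k) p)) <=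
    2 * (B * r0)%:R * (8 * B%:R * k%:R / (c * T n)) +
    2 * (4 * (T n / n%:R) * r0%:R * (C1 ^+ 2 * (n%:R / T n) ^+ 2 * tau) + r0%:R * phi B).
  have BN : (B * r0 <= N - B * r0)%N.
    by apply: leq_trans Br _; rewrite -{1}NnE leq_sub2l.
  have -> : \sum_(p < N) (F p * phase n p - F p * phase (n + k) p) =
      \sum_(0 <= p < B * r0) F p * (phase n p - phase (n + k) p) +
      (\sum_(B * r0 <= p < N - B * r0) F p * phase n p -
       \sum_(B * r0 <= p < N - B * r0) F p * phase (n + k) p +
       \sum_(N - B * r0 <= p < N) F p * (phase n p - phase (n + k) p)).
    rewrite -(big_mkord xpredT (fun p => F p * phase n p - F p * phase (n + k) p)).
    rewrite (@big_cat_nat _ _ _ (B * r0)) //=; last by exact: leq_trans BN (leq_subr _ _).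
    rewrite (@big_cat_nat _ _ _ (N - B * r0) (B * r0)) ?leq_subr //=.
    congr (_ + (_ + _)); last by apply: eq_bigr => p _; rewrite mulrBr.
      by apply: eq_bigr => p _; rewrite mulrBr.
    by rewrite -sumrB.
  apply: le_trans (le_normcD _ _) _.
  apply: le_trans (lerD (lexx _) (le_normcD _ _)) _.
  apply: le_trans (lerD (lexx _) (lerD (le_normcD _ _) (lexx _))) _.
  rewrite normcN.
  have T0 : 0 <= 4 * (T n / n%:R) * r0%:R 
    by apply: mulr_ge0 => //; apply: mulr_ge0 => //; rewrite divr_ge0 // ltW.
  have := ler_wpM2l T0 phi2.
  by move: h1 h2 h3; lra.
rewrite mulrC ler_pdivrMr //; apply: le_trans tot _.
rewrite NRE natrM /phi le_eqVlt; apply/orP; left; apply/eqP; field.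
by rewrite !gt_eqF.
Qed.

End Grid.

Lemma renewal_increment n k B tau : (0 < n)%N -> (k <= n)%N -> (2 <= B)%N ->
  (4 * B <= n)%N -> \sum_(B <= l < n) l%:R `^ (- (2 - 2 * b)) <= tau ->
  `|u n - u (n + k)| <= (8 * B%:R ^+ 2 * (k%:R / n%:R) / c + 4 * C1 ^+ 2 * tau +
     C1 * B%:R `^ (b - 1)) / T n.
Proof.
move=> n0 kn B2 Bn htau; apply/ler_addgt0Pr => e e0.
(* J is large enough for truncation not to affect u up to n + k <= 2 n; L is a multiple of 2 n and
   of 2 (n + k), so both phases have integral half-periods. *)
pose J := (2 * n)%N; pose L := (2 * n * (n + k))%N.
have nk0 : (0 < n + k)%N by rewrite addn_gt0 n0.
have L0 : (0 < L)%N by rewrite !muln_gt0 n0 nk0.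
have JL : (J <= L)%N by rewrite /L leq_pmulr.
have e20 : 0 < e / 2 by rewrite divr_gt0.
have [q Hq] := renewal_dft a_part JL L0 e20.
set N := (q.+1 * L)%N in Hq.
have nkJ : (n + k <= J)%N by rewrite /J mul2n -addnn leq_add2l.
have nJ : (n <= J)%N by exact: leq_trans (leq_addr _ _) nkJ.
have NE : N = (2 * n * (q.+1 * (n + k)))%N by rewrite /N /L; ring.
have NE1 : (2 * (n + k) * (q.+1 * n) = N)%N by rewrite /N /L; ring.
have nkN : (n + k < N)%N.
  rewrite /N /L mulSn (@leq_trans (2 * (n + k))%N) //.
    by rewrite mul2n -addnn -addn1 leq_add2l.
  by apply: leq_trans (leq_addr _ _); rewrite -mulnA leq_mul2l leq_pmull.
have nN : (n < N)%N by exact: leq_ltn_trans (leq_addr _ _) nkN.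
have r00 : (0 < q.+1 * (n + k))%N by rewrite muln_gt0.
have main := grid_sum_bound n0 nJ r00 NE B2 Bn NE1 htau.
have a1 := Hq n nN; have a2 := Hq (n + k)%N nkN.
rewrite (renewal_trunc a nJ) in a1; rewrite (renewal_trunc a nkJ) in a2.
have Nr : 0 < N%:R :> R by rewrite ltr0n (leq_ltn_trans _ nN).
rewrite -normc_real rmorphB.
set A1 := \sum_(p < N) _ in a1; set A2 := \sum_(p < N) _ in a2.
have -> : (u n)%:C%C - (u (n + k))%:C%C =
    ((u n)%:C%C - (N%:R^-1)%:C%C * A1) - ((u (n + k))%:C%C - (N%:R^-1)%:C%C * A2) +
    (N%:R^-1)%:C%C * (A1 - A2) by ring.
apply: le_trans (le_normcD _ _) _; rewrite addrC; apply: lerD.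
  rewrite normcM normc_real ger0_norm ?invr_ge0 ?(ltW Nr) //.
  by rewrite /A1 /A2 -sumrB.
apply: le_trans (le_normcD _ _) _; rewrite normcN.
by apply: le_trans (lerD a1 a2) _; rewrite -splitr.
Qed.

Let power_small (s e : R) : 0 < s -> 0 < e ->
  exists M : nat, forall m, (M <= m)%N -> (0 < m)%N -> m%:R `^ (- s) <= e.
Proof.
move=> s0 e0; have [M [M0 HM]] := nat_large (e^-1 `^ s^-1).
exists M => m Mm m0; have mr : 0 < m%:R :> R by rewrite ltr0n.
rewrite powRN -[leRHS]invrK lef_pV2 ?posrE ?invr_gt0 ?powR_gt0 //.
have -> : e^-1 = (e^-1 `^ s^-1) `^ s.
  by rewrite -powRrM mulVf ?gt_eqF // powRr1 // invr_ge0 ltW.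
have h : e^-1 `^ s^-1 <= m%:R by apply: le_trans HM _; rewrite ler_nat.
by rewrite ge0_ler_powR ?nnegrE ?powR_ge0 ?(ltW s0) ?(ltW mr).
Qed.

(** First B is taken so large that the square sum, convergent by 2 - 2b > 1, and the boundary terms
    give e / 3 each; then q makes the low frequencies small through k / n <= 1 / q. *)
Lemma renewal_oscillation (e : R) : 0 < e -> exists q n1, (0 < q)%N /\
  forall n k, (n1 <= n)%N -> (k * q <= n)%N -> `|u n - u (n + k)| <= e / T n.
Proof.
move=> e0.
have s0 : 0 < 1 - 2 * b by have := bh; lra.
have C12 : 0 < C1 ^+ 2 by apply: exprn_gt0; exact: C10.
have e1 : 0 < e * (1 - 2 * b) / (12 * C1 ^+ 2).
  by apply: divr_gt0; apply: mulr_gt0.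
have e2 : 0 < e / (3 * C1).
  by apply: divr_gt0 => //; apply: mulr_gt0 => //; exact: C10.
have [M1 H1] := power_small s0 e1.
have s2 : 0 < 1 - b by have := bh; lra.
have [M2 H2] := power_small s2 e2.
pose B := (M1 + M2 + 2)%N.
have B2 : (2 <= B)%N by exact: leq_addl.
have B10 : (0 < B.-1)%N by rewrite /B addn2.
have BM1 : (M1 <= B.-1)%N by rewrite /B addn2 /= -addnS leq_addr.
have BM2 : (M2 <= B)%N by rewrite /B addnAC leq_addl.
clearbody B.
have h1 : 4 * C1 ^+ 2 * ((B.-1)%:R `^ (1 - (2 - 2 * b)) / (2 - 2 * b - 1)) <= e / 3.
  have := H1 B.-1 BM1 B10.
  rewrite (_ : 1 - (2 - 2 * b) = - (1 - 2 * b)); last by ring.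
  rewrite (_ : 2 - 2 * b - 1 = 1 - 2 * b); last by ring.
  rewrite ler_pdivlMr; last exact: mulr_gt0.
  rewrite mulrA ler_pdivrMr // => h.
  by have C0 := C12; lra.
have h2 : C1 * B%:R `^ (b - 1) <= e / 3.
  have := H2 B BM2 (ltnW B2).
  rewrite (_ : - (1 - b) = b - 1); last by ring.
  rewrite ler_pdivlMr; last by apply: mulr_gt0 => //; exact: C10.
  by lra.
have [q [q0 hq]] := nat_large (24 * B%:R ^+ 2 / (c * e)).
exists q, (4 * B)%N; split=> // n k nB kq.
have n0 : (0 < n)%N by apply: leq_trans nB; rewrite muln_gt0 /= ltnW.
have kn : (k <= n)%N by apply: leq_trans kq; rewrite leq_pmulr.
have Tn := tsum_gt0 a_part n0.
have s1 : 1 < 2 - 2 * b by lra.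
apply: le_trans (renewal_increment n0 kn B2 nB (tail_power_sum n s1 B2)) _.
rewrite ler_pM2r ?invr_gt0 //.
have nr : 0 < n%:R :> R by rewrite ltr0n.
have qr : 0 < q%:R :> R by rewrite ltr0n.
have h3 : 8 * B%:R ^+ 2 * (k%:R / n%:R) / c <= e / 3.
  have kqr : k%:R / n%:R <= q%:R^-1 :> R.
    by rewrite ler_pdivrMr // mulrC ler_pdivlMr // -natrM ler_nat.
  apply: (@le_trans _ _ (8 * B%:R ^+ 2 * q%:R^-1 / c)).
    by rewrite ler_pM2r ?invr_gt0 // ler_wpM2l // mulr_ge0 // exprn_ge0.
  move: hq; rewrite !ler_pdivrMr ?mulr_gt0 // => hq.
  by lra.
by lra.
Qed.

End Oscillation.

(** * Regular variation of the tails *)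

Lemma gt1_ltr_powR (R : realType) (x r s : R) : 1 < x -> r < s -> x `^ r < x `^ s.
Proof.
move=> x1 rs; have x0 : 0 < x by exact: lt_trans x1.
by rewrite /powR gt_eqF // ltr_expR ltr_pM2r // ln_gt0.
Qed.

Section RegularVariation.
Variables (R : realType) (a : nat -> R).
Hypothesis a_part : is_partition a.
Local Notation t := (tail a).
Local Notation T := (tsum a).

Lemma tsum_add_le n m : T (n + m) <= T n + m%:R * t n.+1.
Proof.
elim: m => [|m IHm]; first by rewrite addn0 mul0r addr0.
rewrite addnS tsumS -natr1 mulrDl mul1r addrA lerD //.
by apply: tail_le => //; rewrite ltnS leq_addr.
Qed.

Lemma tsum_add_ge n m : T n + m%:R * t (n + m) <= T (n + m).
Proof.
elim: m => [|m IHm]; first by rewrite addn0 mul0r addr0.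
case: m IHm => [|m] IHm; first by rewrite addn1 tsumS mul1r.
rewrite addnS tsumS -natr1 mulrDl mul1r addrA lerD //.
apply: le_trans IHm; rewrite lerD2l ler_wpM2l //.
by apply: tail_le => //; rewrite addnS.
Qed.

Lemma tsum_mul_ge m k : m%:R * \sum_(j < k) t (m * j.+1) <= T (m * k).
Proof.
elim: k => [|k IHk]; first by rewrite big_ord0 mulr0 muln0 tsum0.
rewrite big_ord_recr mulrDr /= [in leRHS]mulnS addnC.
apply: le_trans (tsum_add_ge _ _); rewrite lerD //.
by rewrite mulnS addnC.
Qed.

(** Each block of m tails is bounded by the one at its preceding multiple of m, the first block by
    t_1 = 1; hence the summand 1. *)
Lemma tsum_mul_le m k : (0 < m)%N ->
  T (m * k) <= m%:R * (1 + \sum_(j < k) t (m * j.+1)).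
Proof.
move=> m0; case: k => [|k].
  by rewrite muln0 tsum0 big_ord0 addr0 mulr1.
apply: (@le_trans _ _ (m%:R * (1 + \sum_(j < k) t (m * j.+1)))); last first.
  rewrite ler_wpM2l // lerD2l big_ord_recr lerDl /= (tail_ge0 a_part) //.
  by rewrite muln_gt0 m0.
elim: k => [|k IHk].
  rewrite big_ord0 addr0 muln1 -[X in T X]add0n; apply: le_trans (tsum_add_le _ _) _.
  by rewrite tsum0 add0r (tail1 a_part).
rewrite mulnS addnC; apply: le_trans (tsum_add_le _ _) _.
rewrite big_ord_recr addrA [leRHS]mulrDr lerD // ler_wpM2l // tail_le //.
by rewrite muln_gt0 m0.
Qed.

(** The finitely many exceptions, each strictly below l, are absorbed into a maximum. This makes
    asymptotic bounds valid for all k. *)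
Lemma uniform_lt (f : nat -> R) (l d : R) N : d < l -> (forall k, f k < l) ->
  (forall k, (N <= k)%N -> f k <= d) -> exists2 d', d' < l & forall k, f k <= d'.
Proof.
move=> dl fl; elim: N d dl => [|N IHN] d dl H; first by exists d => // k; apply: H.
apply: (IHN (Num.max d (f N))); first by rewrite gt_max dl fl.
move=> k; rewrite leq_eqVlt => /predU1P[<-|/H h]; first by rewrite le_max lexx orbT.
by rewrite le_max h.
Qed.

Lemma tsum_ratio_finite m : finite_type a -> (0 < m)%N ->
  (fun k => T (m * k) / T k) @ \oo --> (1 : R).
Proof.
move=> /cvg_ex[mu Tmu] m0.
have mu0 : mu != 0.
  rewrite gt_eqF // (lt_le_trans ltr01) //; apply: (cvgr_to_ge Tmu).
  by exists 1%N => // n /= n0; exact: (tsum_ge1 a_part).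
rewrite -(divff mu0); apply: cvgM; last exact: cvgV.
apply: dist_lt_cvgn => e /(cvgn_dist_lt Tmu)[N HN].
by exists N => n Nn; apply: HN; rewrite (leq_trans Nn) // leq_pmull.
Qed.

Section Expansive.
Variable theta : R.
Hypothesis th01 : 0 <= theta <= 1.
Hypothesis ex : expansive a theta.

(** Slow variation of psi enters the proof here and nowhere else, along the integers. *)
Lemma tail_ratio m : (0 < m)%N ->
  (fun k => t (m * k) / t k) @ \oo --> m%:R `^ (- theta).
Proof.
move=> m0; have [_ [psi [[_ psi0 psi_sv] tE]]] := ex.
have mr : 0 < m%:R :> R by rewrite ltr0n.
have H : (fun k : nat => psi (k%:R * m%:R) / psi k%:R) @ \oo --> (1 : R).
  exact: cvg_comp (@cvgr_idn R) (psi_sv _ mr).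
have {}H : (fun k : nat => psi (k%:R * m%:R) / psi k%:R * m%:R `^ (- theta)) @ \oo -->
    1 * m%:R `^ (- theta) by apply: cvgM H _; exact: cvg_cst.
rewrite mul1r in H; apply: cvg_trans H; apply: near_eq_cvg.
exists 1%N => // k /= k0.
have kr : 0 < k%:R :> R by rewrite ltr0n.
rewrite /= !tE ?muln_gt0 ?m0 // natrM powRM ?ler0n // [m%:R * _]mulrC.
by have p1 := psi0 _ kr; have p2 := powR_gt0 (- theta) kr; field; rewrite !gt_eqF.
Qed.

(** Summation of [tail_ratio]. T may be bounded, so the first N terms, each off by at most 1 + L,
    are kept as a constant A. *)
Lemma tail_sum_ratio m (e : R) : (0 < m)%N -> 0 < e ->
  exists2 A : R, 0 <= A & forall k,
    `|\sum_(j < k) t (m * j.+1) - m%:R `^ (- theta) * T k| <= A + e * T k.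
Proof.
move=> m0 e0; have [N HN] := cvgn_dist_lt (tail_ratio m0) e0.
set L := m%:R `^ (- theta) in HN *.
have L0 : 0 <= L by exact: powR_ge0.
exists (N%:R * (1 + L)); first by rewrite mulr_ge0 // addr_ge0.
suff H k : `|\sum_(j < k) t (m * j.+1) - L * T k| <= (minn k N)%:R * (1 + L) + e * T k.
  move=> k; apply: le_trans (H k) _; rewrite lerD2r ler_wpM2r ?addr_ge0 //.
  by rewrite ler_nat geq_minr.
elim: k => [|k IHk].
  by rewrite big_ord0 tsum0 !mulr0 subrr normr0 min0n mul0r addr0.
have tk := tail_gt0 a_part (ltn0Sn k).
have tmk : 0 < t (m * k.+1) by apply: (tail_gt0 a_part); rewrite muln_gt0 m0.
have -> : \sum_(j < k.+1) t (m * j.+1) - L * T k.+1 =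
  (\sum_(j < k) t (m * j.+1) - L * T k) + (t (m * k.+1) - L * t k.+1).
  by rewrite big_ord_recr tsumS /=; ring.
apply: le_trans (ler_normD _ _) _; rewrite tsumS.
have [kN|Nk] := leqP k.+1 N.
  move: IHk; rewrite (minn_idPl (ltnW kN)) -[k.+1%:R]natr1 => IHk.
  have h : `|t (m * k.+1) - L * t k.+1| <= 1 + L.
    apply: le_trans (ler_normB _ _) _.
    rewrite normrM (gtr0_norm tmk) (gtr0_norm tk) (ger0_norm L0) lerD //.
      by apply: (tail_le1 a_part); rewrite muln_gt0 m0.
    by rewrite ler_piMr // (tail_le1 a_part).
  have h2 : 0 <= e * t k.+1 by rewrite mulr_ge0 ?ltW.
  by lra.
rewrite ltnS in Nk; move: IHk; rewrite (minn_idPr Nk) => IHk.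
have h : `|t (m * k.+1) - L * t k.+1| <= e * t k.+1.
  rewrite -ler_pdivrMr // -{2}(gtr0_norm tk) -normrV ?unitfE ?gt_eqF // -normrM.
  by rewrite mulrBl mulfK ?gt_eqF // ltW // HN // ltnW.
by lra.
Qed.

(* If theta < 1 then t_{2k} > t_k / 2 eventually, so k t_k is bounded below
   along a geometric sequence. *)
Lemma expansive_infinite : theta < 1 -> ~ finite_type a.
Proof.
move=> th1 /cvg_ex[mu Tmu].
have two1 : 1 < 2 :> R by rewrite ltr1n.
have h2 : 2^-1 < 2%:R `^ (- theta) :> R.
  by rewrite -powR_inv1 // gt1_ltr_powR // ltrN2.
have d0 : 0 < 2%:R `^ (- theta) - 2^-1 :> R by rewrite subr_gt0.
have [N HN] := cvgn_dist_lt (tail_ratio (ltn0Sn 1)) d0.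
have half k : (N < k)%N -> t k <= 2 * t (2 * k).
  move=> Nk; have k0 : (0 < k)%N by exact: leq_ltn_trans Nk.
  have tk := tail_gt0 a_part k0.
  have : 2^-1 <= t (2 * k) / t k by have := HN k (ltnW Nk); rewrite ltr_norml => /andP[h _]; lra.
  by rewrite ler_pdivlMr //; lra.
set c := N.+1%:R * t N.+1.
have c0 : 0 < c by rewrite mulr_gt0 // (tail_gt0 a_part).
have low j : c <= (2 ^ j * N.+1)%:R * t (2 ^ j * N.+1).
  elim: j => [|j IHj]; first by rewrite mul1n.
  have Nj : (N < 2 ^ j * N.+1)%N by rewrite leq_pmull // expn_gt0.
  apply: le_trans IHj _; rewrite expnS -mulnA.
  set k := (2 ^ j * N.+1)%N in Nj *; rewrite natrM.
  by rewrite [2%:R * _]mulrC -mulrA ler_wpM2l // half.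
(* For the n below, T(2n) - T n >= n t_(2n) >= c / 2, although both values would be within c / 8 of
   mu. *)
have [M HM] := cvgn_dist_lt Tmu (divr_gt0 c0 (ltr0n R 8)).
set n := (2 ^ M * N.+1)%N.
have Mn : (M <= n)%N.
  by apply: leq_trans (leq_pmulr _ _) => //; apply: ltnW; exact: ltn_expl.
have Nn : (N < n)%N by rewrite leq_pmull // expn_gt0.
have := HM n Mn; have := HM (n + n)%N (leq_trans Mn (leq_addr _ _)).
have := tsum_add_ge n n; have := half n Nn; have := low M; rewrite -/n mul2n -addnn.
rewrite !ltr_norml => l1 l2 l3 /andP[l4 l5] /andP[l6 l7].
have := ler_wpM2l (ler0n R n) l2.
by lra.
Qed.

(** T(mk) is m times the sum of t over the multiples of m, up to a constant, and that sum is close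
    to m^(-theta) T k; constants disappear when T is unbounded. Finite type forces theta = 1, and
    the ratio tends to 1. *)
Lemma tsum_regular m : (0 < m)%N ->
  (fun k => T (m * k) / T k) @ \oo --> m%:R `^ (1 - theta).
Proof.
move=> m0; have mr : 0 < m%:R :> R by rewrite ltr0n.
have [fin|inf] := pselect (finite_type a).
  have th1 : theta = 1.
    apply/eqP; rewrite eq_le; apply/andP; split; first by case/andP: th01.
    by rewrite leNgt; apply/negP => /expansive_infinite.
  by rewrite th1 subrr powRr0; exact: tsum_ratio_finite.
apply: dist_lt_cvgn => e e0.
have e10 : 0 < e / (3 * m%:R) by rewrite divr_gt0 // mulr_gt0.
have [A A0 HA] := tail_sum_ratio m0 e10.
have [N HN] := tsum_unbounded a_part ((A + 1) / (e / (3 * m%:R))) inf.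
exists N.+1 => n Nn; have n0 : (0 < n)%N by exact: leq_ltn_trans Nn.
have Tn := tsum_gt0 a_part n0.
have := HN n (ltnW Nn); rewrite ler_pdivrMr // => hT.
have -> : m%:R `^ (1 - theta) = m%:R * m%:R `^ (- theta) :> R.
  by rewrite powRD ?powRr1 ?(ltW mr) // (gt_eqF mr) implybT.
have := HA n; have := tsum_mul_ge m n; have := tsum_mul_le n m0.
set S := \sum_(j < n) _; set L := _ `^ _.
move=> h1 h2; rewrite ler_norml => /andP[h3 h4].
have h5 : `|T (m * n) - m%:R * L * T n| <= 2 / 3 * e * T n.
  have E : m%:R * (e / (3 * m%:R)) = e / 3 by field; rewrite gt_eqF.
  have h3' := ler_wpM2l (ltW mr) h3; have h4' := ler_wpM2l (ltW mr) h4.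
  have hT' := ler_wpM2l (ltW mr) hT.
  have E2 : m%:R * (T n * (e / (3 * m%:R))) = T n * (e / 3) by rewrite mulrCA E.
  have E3 : m%:R * (A + e / (3 * m%:R) * T n) = m%:R * A + T n * (e / 3).
    by rewrite mulrDr mulrA E; ring.
  rewrite E2 in hT'; rewrite E3 in h4'; rewrite mulrN E3 in h3'.
  by rewrite ler_norml; apply/andP; split; lra.
rewrite -(ltr_pM2r Tn); apply: le_lt_trans (_ : 2 / 3 * e * T n < _); last first.
  by rewrite ltr_pM2r //; lra.
by rewrite -{2}(gtr0_norm Tn) -normrM mulrBl divfK ?gt_eqF.
Qed.

End Expansive.
End RegularVariation.

Lemma half_ceil n : (0 < n)%N ->
  exists p, [/\ (p.+1 <= n)%N, (2 * p.+1 <= n.+1)%N & (n <= 2 * p.+1)%N].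
Proof. by move=> n0; exists (n.-1 %/ 2)%N; split; lia. Qed.

(** * Potter bound and lower bounds for the symbol *)

Section SymbolBounds.
Variables (R : realType) (a : nat -> R).
Hypothesis a_part : is_partition a.
Local Notation t := (tail a).
Local Notation T := (tsum a).
Local Notation g := (gsym a).
Variable theta : R.
Hypothesis th01 : 0 <= theta <= 1.
Hypothesis ex : expansive a theta.

Lemma tsum_potter : 1 / 2 < theta -> exists b C : R, [/\ 0 <= b < 1 / 2, 0 < C &
  forall n m, (0 < m)%N -> (m <= n)%N -> T n <= C * (n%:R / m%:R) `^ b * T m].
Proof.
move=> th2; have /andP[_ th1] := th01.
(* The midpoint of 1 - theta and 1/2. *)
pose b := (1 - theta) / 2 + 1 / 4.
have b0 : 0 <= b by rewrite /b; lra.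
have hb : 1 - theta < b by rewrite /b; lra.
have b2 : b < 1 / 2 by rewrite /b; lra.
clearbody b.
have two1 : 1 < 2 :> R by rewrite ltr1n.
have d0 : 0 < 2%:R `^ b - 2%:R `^ (1 - theta) :> R by rewrite subr_gt0 gt1_ltr_powR.
have [N HN] := cvgn_dist_lt (tsum_regular a_part th01 ex (ltn0Sn 1)) d0.
have p1 x : 1 <= x -> 1 <= x `^ b :> R by move=> x1; rewrite -(powRr0 x) ler_powR.
have dbl m : (N < m)%N -> T (2 * m) <= 2 `^ b * T m.
  move=> Nm; have Tm := tsum_gt0 a_part (leq_ltn_trans (leq0n N) Nm).
  have := HN m (ltnW Nm); rewrite ltr_norml => /andP[_ h].
  by rewrite -ler_pdivrMr //; lra.
have ratio1 n m : (0 < m)%N -> (m <= n)%N -> 1 <= (n%:R / m%:R : R) `^ b.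
  by move=> m0 mn; apply: p1; rewrite ler_pdivlMr ?ltr0n // mul1r ler_nat.
(* Induction on the number of doublings from m to n; the extra factor 2^b pays for the last,
   incomplete one. *)
have big d : forall n m, (N < m)%N -> (m <= n)%N -> (n <= 2 ^ d * m)%N ->
    T n <= 2 `^ b * (n%:R / m%:R) `^ b * T m.
  elim: d => [|d IHd] n m Nm mn nd; have m0 : (0 < m)%N by exact: leq_ltn_trans Nm.
    have -> : n = m by apply/eqP; rewrite eqn_leq mn andbT -(mul1n m).
    have Tm := tsum_gt0 a_part m0.
    by rewrite divff ?pnatr_eq0 -?lt0n // powR1 mulr1 ler_peMl ?(ltW Tm) // p1 // ltW.
  have Tm := tsum_gt0 a_part m0.
  have [n2|n2] := leqP n (2 * m).
    apply: le_trans (tsum_le a_part n2) _; apply: le_trans (dbl m Nm) _.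
    by rewrite ler_pM2r // ler_peMr ?powR_ge0 // ratio1.
  have mr : 0 < m%:R :> R by rewrite ltr0n.
  have m2 : (m <= 2 * m)%N by rewrite leq_pmull.
  have := IHd n (2 * m)%N (leq_trans Nm m2) (ltnW n2).
  rewrite mulnCA mulnA -expnS => /(_ nd) h.
  apply: le_trans h _; rewrite -!mulrA ler_pM2l ?powR_gt0 //.
  apply: le_trans (ler_wpM2l (powR_ge0 _ _) (dbl m Nm)) _.
  rewrite mulrA ler_pM2r // -powRM ?divr_ge0 // natrM.
  by rewrite le_eqVlt; apply/orP; left; apply/eqP; congr (_ `^ _); field; rewrite gt_eqF.
exists b, (2 `^ b * T N.+1); split; first by rewrite b0.
  by rewrite mulr_gt0 ?powR_gt0 // (tsum_gt0 a_part).
move=> n m m0 mn; have Tm := tsum_ge1 a_part m0.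
have TN := tsum_ge1 a_part (ltn0Sn N).
have q1 := ratio1 n m m0 mn.
have s1 : 1 <= 2 `^ b :> R by rewrite p1 // ltW.
have [Nm|mN] := ltnP N m.
  apply: le_trans (big n n m Nm mn _) _.
    by apply: leq_trans (leq_pmulr _ m0); apply: ltnW; exact: ltn_expl.
  rewrite ler_pM2r ?(lt_le_trans ltr01) // ler_pM2r ?(lt_le_trans ltr01) //.
  by rewrite ler_peMr // powR_ge0.
have [Nn|nN] := ltnP N n.
  apply: le_trans (big n n N.+1 (leqnn _) Nn _) _.
    by apply: leq_trans (leq_pmulr _ _) => //; apply: ltnW; exact: ltn_expl.
  have h : (n%:R / N.+1%:R) `^ b <= (n%:R / m%:R) `^ b :> R.
    rewrite ge0_ler_powR ?nnegrE ?divr_ge0 // ler_wpM2l // lef_pV2 ?posrE ?ltr0n //.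
    by rewrite ler_nat ltnW.
  rewrite [leLHS](_ : _ = 2 `^ b * T N.+1 * (n%:R / N.+1%:R) `^ b); last by ring.
  rewrite [leRHS](_ : _ = 2 `^ b * T N.+1 * (T m * (n%:R / m%:R) `^ b)); last by ring.
  rewrite ler_pM2l; last by rewrite mulr_gt0 // (lt_le_trans ltr01).
  apply: le_trans h _; rewrite ler_peMl // powR_ge0 //.
apply: le_trans (tsum_le a_part (leq_trans nN (leqnSn N))) _.
have TN0 : 0 <= T N.+1 by exact: le_trans TN.
apply: (@le_trans _ _ (2 `^ b * T N.+1)); first by rewrite ler_peMl.
rewrite -mulrA ler_peMr //; first by rewrite mulr_ge0 // powR_ge0.
by rewrite mulr_ege1.
Qed.

Let cos_terms J x A B : (A <= B)%N -> (B <= J)%N ->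
  t J.+1 + \sum_(A <= i < B) a i.+1 * (1 - cos (i.+1%:R * x)) <= normc (g J x).
Proof.
move=> AB BJ; apply: le_trans (Re_le_normc _); rewrite (Re_gsym a_part) lerD2l.
rewrite -(big_mkord xpredT (fun i => a i.+1 * (1 - cos (i.+1%:R * x)))).
have pos i : 0 <= a i.+1 * (1 - cos (i.+1%:R * x)).
  by rewrite mulr_ge0 ?(ltW (partition_gt0 a_part _)) // subr_ge0 cos_le1.
rewrite [leRHS](@big_cat_nat _ _ _ A) ?(leq_trans AB) //=.
rewrite [X in _ + X](@big_cat_nat _ _ _ B) //= addrA addrAC lerDr.
by rewrite addr_ge0 // sumr_ge0.
Qed.

Let first_term J x : (0 < J)%N -> a 1 * (1 - cos x) <= normc (g J x).
Proof.
move=> J0; have := cos_terms x (leq0n 1) J0; rewrite big_nat1 mul1r.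
by have := tail_ge0 a_part (ltn0Sn J); lra.
Qed.

Let pi4 : pi <= 4 :> R.
Proof. by have /andP[_ h] := pihalf_02 R; lra. Qed.

Let symbol_away J x : (0 < J)%N -> 1 <= x <= pi -> a 1 / 32 * x <= normc (g J x).
Proof.
move=> J0 xb; apply: le_trans (first_term x J0).
have := cos_le_away xb; have := partition_gt0 a_part (ltn0Sn 0).
case/andP: xb => x1 xpi; have := pi4; nra.
Qed.

Let inverse_floor (x : R) : 0 < x < 1 ->
  exists n, [/\ (0 < n)%N, n%:R * x <= 1, 1 <= 2 * (n%:R * x) &
    forall m, m%:R * x <= 1 -> (m <= n)%N].
Proof.
move=> /andP[x0 x1]; have xi : 1 <= x^-1 by rewrite invf_ge1 // ltW.
have /andP[h1 h2] := truncn_itv (ltW (lt_le_trans ltr01 xi)).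
set n := Num.truncn _ in h1 h2.
have n0 : (0 < n)%N.
  have : 1%:R < n.+1%:R :> R by exact: le_lt_trans xi h2.
  by rewrite ltr_nat.
exists n; split=> //; first by rewrite -ler_pdivlMr // mul1r.
have n1 : 1 <= n%:R :> R by rewrite ler1n.
  rewrite mulrA -ler_pdivrMr // mul1r; apply: le_trans (ltW h2) _.
  by rewrite -natr1; lra.
move=> m; rewrite -ler_pdivlMr // mul1r => /le_lt_trans/(_ h2).
by rewrite ltr_nat ltnS.
Qed.

(** The limit 2^(-theta) < 1 settles large k; strict monotonicity of t settles the others. *)
Lemma tail_double : 0 < theta -> exists2 d : R, d < 1 &
  forall k, (0 < k)%N -> t (2 * k) <= d * t k.
Proof.
move=> th0; have two1 : 1 < 2 :> R by rewrite ltr1n.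
have h2 : 2%:R `^ (- theta) < 1 :> R by rewrite -[ltRHS](powRr0 2%:R) gt1_ltr_powR // oppr_lt0.
have d0 : 0 < (1 - 2%:R `^ (- theta)) / 2 :> R by rewrite divr_gt0 // subr_gt0.
have [N HN] := cvgn_dist_lt (tail_ratio ex (ltn0Sn 1)) d0.
have [] := @uniform_lt _ (fun k => t (2 * k.+1) / t k.+1) 1 ((1 + 2%:R `^ (- theta)) / 2) N.
- by lra.
- move=> k; rewrite ltr_pdivrMr ?(tail_gt0 a_part) // mul1r.
  apply: le_lt_trans (tail_ltS a_part (ltn0Sn k)).
  by rewrite (tail_le a_part) // mul2n -addnn addnS ltnS addSn leq_addr.
- move=> k Nk; have := HN k.+1 (leqW Nk); rewrite ltr_norml => /andP[_ h].
  by lra.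
move=> d d1 Hd; exists d => // -[//|k] _.
by have := Hd k; rewrite ler_pdivrMr // (tail_gt0 a_part).
Qed.

(** T(2k) / T k tends to 2^(1-theta) > 1 while T(2k) - T k <= k t_(k+1), so k t_(k+1) is at least a
    fixed fraction of T k. *)
Lemma tsum_le_tail : theta < 1 -> exists2 C : R, 0 < C &
  forall n, (0 < n)%N -> T n <= C * (n%:R * t n.+1).
Proof.
move=> th1; have two1 : 1 < 2 :> R by rewrite ltr1n.
have h2 : 1 < 2%:R `^ (1 - theta) :> R by rewrite -[ltLHS](powRr0 2%:R) gt1_ltr_powR // subr_gt0.
have d0 : 0 < (2%:R `^ (1 - theta) - 1) / 2 :> R by rewrite divr_gt0 // subr_gt0.
have [N HN] := cvgn_dist_lt (tsum_regular a_part th01 ex (ltn0Sn 1)) d0.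
(* The sign turns the positive lower bound wanted into the upper bound that [uniform_lt] gives. *)
have [] := @uniform_lt _ (fun k => - (k.+1%:R * t k.+2 / T k.+1)) 0
  (- ((2%:R `^ (1 - theta) - 1) / 2)) N.
- by rewrite oppr_lt0.
- move=> k; rewrite oppr_lt0 divr_gt0 ?(tsum_gt0 a_part) //.
  by rewrite mulr_gt0 // (tail_gt0 a_part).
- move=> k Nk; have := HN k.+1 (leqW Nk); rewrite ltr_norml => /andP[h _].
  have Tk := tsum_gt0 a_part (ltn0Sn k).
  rewrite lerN2 ler_pdivlMr //.
  have := tsum_add_le a_part k.+1 k.+1; rewrite addnn -mul2n.
  have : 1 + (2%:R `^ (1 - theta) - 1) / 2 <= T (2 * k.+1) / T k.+1 by lra.
  by rewrite ler_pdivlMr //; lra.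
move=> d d1 Hd; exists (- d)^-1; first by rewrite invr_gt0 oppr_gt0.
move=> [//|k] _; rewrite mulrC ler_pdivlMr ?oppr_gt0 //.
by have := Hd k; rewrite lerNl ler_pdivlMr ?(tsum_gt0 a_part) // mulrC.
Qed.

(** For theta = 1 the ratio T(2k) / T k tends to 1, while k t_(2k) <= T(2k) - T k; take k = n/2. *)
Lemma tail_negligible (e : R) : theta = 1 -> 0 < e ->
  exists N, forall n, (N <= n)%N -> n%:R * t n.+1 <= e * T n.
Proof.
move=> th1 e0; have e30 : 0 < e / 3 by rewrite divr_gt0.
have [N HN] := cvgn_dist_lt (tsum_regular a_part th01 ex (ltn0Sn 1)) e30.
exists (2 * N.+1)%N => n Nn; pose k := (n %/ 2)%N.
have Nk : (N.+1 <= k)%N by rewrite /k leq_divRL // mulnC.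
have k0 : (0 < k)%N by exact: leq_trans Nk.
have kn : (2 * k <= n)%N by rewrite mulnC leq_divM.
have nk : (n <= 3 * k)%N.
  have := ltn_ceil n (ltn0Sn 1); rewrite -/k mulnC => h.
  rewrite -[3%N]/(2 + 1)%N mulnDl mul1n; apply: (@leq_trans (2 * k).+1).
    by rewrite -ltnS; apply: leq_trans h _; rewrite mulnS addnC addn2.
  by rewrite -[(2 * k).+1]addn1 leq_add2l.
clearbody k; have := HN k (ltnW Nk).
have Tk := tsum_gt0 a_part k0.
rewrite th1 subrr powRr0 ltr_norml => /andP[_ h].
have h1 : T (2 * k) <= (1 + e / 3) * T k by rewrite -ler_pdivrMr //; lra.
have h2 := tsum_add_ge a_part k k.
have h3 : t n.+1 <= t (k + k) .
  by rewrite (tail_le a_part) ?addnn ?double_gt0 // -mul2n leqW.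
have h4 := tail_ge0 a_part (ltn0Sn n).
have h5 : T k <= T n by rewrite (tsum_le a_part) // (leq_trans _ kn) // leq_pmull.
have h6 : n%:R * t n.+1 <= 3 * k%:R * t n.+1 :> R by rewrite ler_wpM2r // -natrM ler_nat.
have h7 := ler_wpM2l (ler0n R k) h3.
have h8 := ler_wpM2l (ltW e0) h5.
by rewrite mul2n -addnn in h1; lra.
Qed.

(** With n the integer part of 1/x, the indices between n/2 and n alone suffice: 1 - cos is bounded
    below there, and by [tail_double] they carry a fixed part of the tail at n/2, which
    [tsum_le_tail] compares with x T n. If J <= n, the term t_(J+1) of the real part is enough. *)
Lemma symbol_lower_Re : 0 < theta -> theta < 1 -> exists2 c : R, 0 < c &
  forall J m x, (0 < m)%N -> (m <= J)%N -> 0 < x <= pi ->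
  m%:R * x <= 1 \/ m = 1%N -> c * x * T m <= normc (g J x).
Proof.
move=> th0 th1; have [d d1 Hd] := tail_double th0; have [C C0 HC] := tsum_le_tail th1.
have a1 := partition_gt0 a_part (ltn0Sn 0).
have [c c0 [ca cC]] : exists2 c : R, 0 < c & c <= a 1 / 32 /\ c * C <= Num.min 1 ((1 - d) / 128).
  exists (Num.min (a 1 / 32) (Num.min 1 ((1 - d) / 128) / C)).
    by rewrite lt_min divr_gt0 // divr_gt0 // lt_min ltr01 divr_gt0 // subr_gt0.
  by rewrite ge_min lexx; split=> //; rewrite -ler_pdivlMr // ge_min lexx orbT.
move: cC; rewrite le_min => /andP[cC1 cCd].
exists c => // J m x m0 mJ /andP[x0 xpi] mx; have J0 := leq_trans m0 mJ.
have [x1|x1] := leP 1 x.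
  have -> : m = 1%N.
    case: mx => // h; apply/eqP; rewrite eqn_leq m0 andbT -(ler_nat R).
    by apply: le_trans h; rewrite ler_peMr.
  rewrite (tsum1 a_part) mulr1.
  have := symbol_away J0 (introT andP (conj x1 xpi)).
  by apply: le_trans; rewrite ler_pM2r.
have [n [n0 nx1 nx2 nmax]] := inverse_floor (introT andP (conj x0 x1)).
have mn : (m <= n)%N by case: mx => [/nmax//|->].
have red k : (m <= k)%N -> (k <= n)%N -> c * x * T m <= c * C * t k.+1.
  move=> mk kn; have k0 := leq_trans m0 mk.
  apply: (@le_trans _ _ (c * x * (C * (k%:R * t k.+1)))).
    apply: ler_wpM2l; first by rewrite mulr_ge0 // ltW.
    exact: le_trans (tsum_le a_part mk) (HC k k0).
  rewrite (_ : c * x * _ = c * C * (k%:R * x * t k.+1)); last by ring.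
  apply: ler_wpM2l; first by rewrite mulr_ge0 // ltW.
  rewrite ger_pMl ?(tail_gt0 a_part) //.
  by apply: le_trans nx1; rewrite ler_pM2r // ler_nat.
have [Jn|nJ] := leqP J n.
  apply: le_trans (red J mJ Jn) _; apply: le_trans (gsym_ge a_part _ _).
  by rewrite ler_piMl // (tail_ge0 a_part).
apply: le_trans (red n mn (leqnn n)) _.
have [p [pn p2 np]] := half_ceil n0.
apply: le_trans (cos_terms x (ltnW pn) (ltnW nJ)).
(* On this range the argument y of the cosine is at least 1/4, and y^2 / 8 is then at least
   1/128. *)
apply: (@le_trans _ _ (t J.+1 + (t p.+1 - t n.+1) / 128)); last first.
  rewrite lerD2l -(tail_sum a_part (ltnW pn)) mulr_suml.
  apply: ler_sum_nat => i /andP[pi1 pi2].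
  have ai := partition_gt0 a_part (ltn0Sn i); rewrite ler_pM2l //.
  have ix1 : i.+1%:R * x <= 1 by apply: le_trans nx1; rewrite ler_pM2r // ler_nat.
  have ix0 : n%:R * x <= 2 * (i.+1%:R * x).
    rewrite mulrA ler_pM2r // -natrM ler_nat; apply: leq_trans np _.
    by rewrite leq_mul2l.
  have q0 : 1 / 4 <= i.+1%:R * x by lra.
  have := cos_le_quad (_ : 0 <= i.+1%:R * x <= 2); rewrite (_ : 0 <= _ <= _); last by lra.
  by move=> /(_ isT); nra.
have tJ := tail_ge0 a_part (ltn0Sn J).
have tn := tail_ge0 a_part (ltn0Sn n).
have h1 := Hd p.+1 (ltn0Sn p).
have h2 := tail_le a_part (isT : (0 < 2 * p.+1)%N) p2.
have h3 := tail_le a_part (ltn0Sn p) (leqW pn).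
have h4 := ler_wpM2r tn cCd.
by nra.
Qed.

Let first_moment n : T n = \sum_(i < n) i.+1%:R * a i.+1 + n%:R * t n.+1.
Proof.
elim: n => [|n IHn]; first by rewrite tsum0 big_ord0 mul0r addr0.
rewrite tsumS IHn big_ord_recr /= [t n.+1](tailS a_part) // -natr1; ring.
Qed.

(** Up to n, about 1/x, one has sin(ix) >= ix/2, and the first moment is T n - n t_(n+1); the terms
    beyond n weigh at most t_(n+1), which is small against x T n. If n <= N + 1, then x is bounded
    below and the first cosine term suffices. *)
Lemma symbol_lower_Im : theta = 1 -> exists2 c : R, 0 < c &
  forall J m x, (0 < m)%N -> (m <= J)%N -> 0 < x <= pi ->
  m%:R * x <= 1 \/ m = 1%N -> c * x * T m <= normc (g J x).
Proof.
(* Of x T n / 2 the term n t_(n+1) takes at most x T n / 20 and the terms beyond n at most x T n /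
   5, which leaves x T n / 4. *)
move=> th1; have e0 : 0 < 1 / 10 :> R by rewrite divr_gt0.
have [N HN] := tail_negligible th1 e0.
have a1 := partition_gt0 a_part (ltn0Sn 0).
have TN := tsum_gt0 a_part (ltn0Sn N).
have [c c0 [ca cN c4]] : exists2 c : R, 0 < c &
    [/\ c <= a 1 / 32, c * T N.+1 <= a 1 / (16 * N.+1%:R) & c <= 1 / 4].
  exists (Num.min (a 1 / 32) (Num.min (a 1 / (16 * N.+1%:R) / T N.+1) (1 / 4))).
    by rewrite !lt_min !divr_gt0 // mulr_gt0.
  split; rewrite -?ler_pdivlMr // !ge_min ?lexx ?orbT //.
exists c => // J m x m0 mJ /andP[x0 xpi] mx; have J0 := leq_trans m0 mJ.
have [x1|x1] := leP 1 x.
  have -> : m = 1%N.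
    case: mx => // h; apply/eqP; rewrite eqn_leq m0 andbT -(ler_nat R).
    by apply: le_trans h; rewrite ler_peMr.
  rewrite (tsum1 a_part) mulr1.
  have := symbol_away J0 (introT andP (conj x1 xpi)).
  by apply: le_trans; rewrite ler_pM2r.
have [n [n0 nx1 nx2 nmax]] := inverse_floor (introT andP (conj x0 x1)).
have mn : (m <= n)%N by case: mx => [/nmax//|->].
have cx : 0 <= c * x by rewrite mulr_ge0 ?ltW.
have [nN|Nn] := leqP n N.+1.
  apply: le_trans (first_term x J0).
  apply: (@le_trans _ _ (a 1 * (x ^+ 2 / 8))); last first.
    by rewrite ler_pM2l // cos_le_quad // (ltW x0) /=; lra.
  apply: (@le_trans _ _ (c * x * T N.+1)).
    by rewrite ler_wpM2l // (tsum_le a_part) // (leq_trans mn).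
  rewrite mulrAC; apply: (@le_trans _ _ (a 1 / (16 * N.+1%:R) * x)); first by rewrite ler_pM2r.
  have Nr : 0 < N.+1%:R :> R by rewrite ltr0n.
  rewrite mulrAC ler_pdivrMr ?mulr_gt0 //.
  have h : 1 <= 2 * (N.+1%:R * x) by apply: le_trans nx2 _; rewrite ler_pM2l // ler_pM2r // ler_nat.
  have := ler_wpM2l (mulr_ge0 (ltW a1) (ltW x0)) h; lra.
have sum_sin k : (k <= n)%N ->
    x / 2 * (T k - k%:R * t k.+1) <= \sum_(i < k) a i.+1 * sin (i.+1%:R * x).
  move=> kn; rewrite first_moment addrK mulr_sumr; apply: ler_sum => i _.
  have ai := partition_gt0 a_part (ltn0Sn i).
  have ik : i.+1%:R * x <= 1.
    apply: le_trans nx1; rewrite ler_pM2r // ler_nat; exact: leq_trans (ltn_ord i) kn.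
  rewrite [i.+1%:R * a _]mulrC mulrCA ler_pM2l //.
  by rewrite mulrAC [x * _]mulrC sin_ge_half // ik mulr_ge0 // ltW.
have img : \sum_(i < J) a i.+1 * sin (i.+1%:R * x) <= normc (g J x).
  by apply: le_trans (Im_le_normc _); rewrite Im_gsym normrN ler_norm.
have reg := gsym_ge a_part J x.
have tJ := tail_ge0 a_part (ltn0Sn J).
have tn := tail_ge0 a_part (ltn0Sn n).
have fin k X : (m <= k)%N -> x * T k <= 4 * X -> c * x * T m <= X.
  move=> mk h; apply: (@le_trans _ _ (c * x * T k)).
    by rewrite ler_wpM2l // (tsum_le a_part).
  have : 0 <= x * T k by rewrite mulr_ge0 ?(ltW x0) // (tsum_ge0 a_part).
  by rewrite -mulrA; have := c4; nra.
(* If the sum stops at J, the loss J x t_(J+1) is at most t_(J+1), which [gsym_ge] bounds by the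
   modulus itself. *)
have [Jn|nJ] := leqP J n.
  apply: (fin J) => //; have := sum_sin J Jn.
  have : J%:R * x * t J.+1 <= t J.+1.
    by rewrite ler_piMl // (le_trans _ nx1) // ler_pM2r // ler_nat.
  by lra.
apply: (fin n) => //; have := sum_sin n (leqnn n).
have : - (t n.+1 - t J.+1) <= \sum_(n <= i < J) a i.+1 * sin (i.+1%:R * x).
  rewrite -(tail_sum a_part (ltnW nJ)) -sumrN; apply: ler_sum => i _.
  have ai := partition_gt0 a_part (ltn0Sn i).
  by rewrite -mulrN1 ler_pM2l // sin_geN1.
move: img; rewrite -(big_mkord xpredT (fun i => a i.+1 * sin (i.+1%:R * x))).
rewrite (@big_cat_nat _ _ _ n) ?(ltnW nJ) //= big_mkord => h1 h2 h3.
have h4 := HN n (leq_trans (leqnSn N) (ltnW Nn)).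
have h5 := ler_wpM2r tn nx2.
have h6 := ler_wpM2l (ltW x0) h4.
by lra.
Qed.

End SymbolBounds.

(** * The strong renewal law *)

(** A quantitative derivative of x^theta at 1 with step 1/q: it turns the constant K of the weak law
    into K theta. *)
Lemma powR_difference_quotient (R : realType) (theta q : R) : 0 <= theta <= 1 -> 2 <= q ->
  `|q * (((q + 1) / q) `^ theta - 1) - theta| <= 2 / q.
Proof.
move=> /andP[th0 th1] q2.
have q0 : 0 < q by lra.
have x0 : 0 < (q + 1) / q by rewrite divr_gt0 //; lra.
have xE : (q + 1) / q = 1 + q^-1 by field; rewrite gt_eqF.
have l1 : ln ((q + 1) / q) <= q^-1.
  rewrite xE; apply: le_ln1Dx; rewrite (lt_trans (_ : -1 < 0)) ?invr_gt0 //; lra.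
have l2 : (q + 1)^-1 <= ln ((q + 1) / q).
  have -> : (q + 1) / q = (1 + - (q + 1)^-1)^-1 by field; rewrite !gt_eqF //; lra.
  have i1 : (q + 1)^-1 < 1 by rewrite invf_lt1; lra.
  rewrite lnV ?posrE ?subr_gt0 // lerNr; apply: le_ln1Dx.
  by rewrite ltrN2.
have e1 := expR_ge1Dx (theta * ln ((q + 1) / q)).
have e2 := expR_ge1Dx (- (theta * ln ((q + 1) / q))).
have p0 := powR_gt0 theta x0.
have e3 : (1 - theta * q^-1) * ((q + 1) / q) `^ theta <= 1.
  have : (1 - theta * q^-1) <= expR (- (theta * ln ((q + 1) / q))).
    by apply: le_trans e2; rewrite lerD2l lerN2 ler_wpM2l.
  rewrite expRN => h; rewrite -ler_pdivlMr // mul1r; apply: le_trans h _.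
  by rewrite /powR gt_eqF.
have e4 : 1 + theta * (q + 1)^-1 <= ((q + 1) / q) `^ theta.
  by rewrite /powR gt_eqF //; apply: le_trans e1; rewrite lerD2l ler_wpM2l.
move: e3 e4; set P := _ `^ _ => e3 e4.
have iq : q * q^-1 = 1 by rewrite divff // gt_eqF.
have iq1 : (q + 1) * (q + 1)^-1 = 1 by rewrite divff // gt_eqF //; lra.
have i0 : 0 < q^-1 by rewrite invr_gt0.
have i1 : 0 < (q + 1)^-1 by rewrite invr_gt0; lra.
have i2 : (q + 1)^-1 <= q^-1 by rewrite lef_pV2 ?posrE //; lra.
rewrite ler_norml; apply/andP; split.
  have : q * (theta * (q + 1)^-1) <= q * (P - 1) by apply: ler_wpM2l; lra.
  have -> : q * (theta * (q + 1)^-1) = theta - theta * (q + 1)^-1.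
    by rewrite mulrCA -{2}[theta]mulr1 -{2}iq1; ring.
  by nra.
have e5 : (q - theta) * P <= q.
  have := ler_wpM2l (ltW q0) e3; rewrite mulr1.
  have -> // : q * ((1 - theta * q^-1) * P) = (q - theta) * P.
  by rewrite mulrA mulrBr mulr1 mulrCA iq mulr1.
rewrite ler_pdivlMr //.
have h : (q - theta) * ((q * (P - 1) - theta) * q) <= (q - theta) * 2.
  have h1 : (q - theta) * (q * (P - 1)) <= q * theta.
    by have := ler_wpM2l (ltW q0) e5; lra.
  have h2 : (q - theta) * (q * (P - 1) - theta) <= theta ^+ 2 by lra.
  have h3 := ler_wpM2r (ltW q0) h2.
  nra.
by rewrite ler_pM2l // in h; lra.
Qed.

Section StrongLaw.
Variables (R : realType) (a : nat -> R).
Hypothesis a_part : is_partition a.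
Local Notation u := (renewal a).
Local Notation T := (tsum a).
Local Notation W := (wsum a).
Local Notation U := (renewal_sum a).
Variable theta : R.
Hypothesis th01 : 1 / 2 < theta <= 1.
Hypothesis ex : expansive a theta.

Let th01' : 0 <= theta <= 1. Proof. by have /andP[h1 h2] := th01; apply/andP; lra. Qed.

Let rho01 : 0 <= 1 - theta <= 1. Proof. by have /andP[h1 h2] := th01'; apply/andP; lra. Qed.

Lemma renewal_oscillation_expansive (e : R) : 0 < e -> exists q n1, (0 < q)%N /\
  forall n k, (n1 <= n)%N -> (k * q <= n)%N -> `|u n - u (n + k)| <= e / T n.
Proof.
move=> e0; have /andP[th2 th1] := th01.
have th0 : 0 < theta by lra.
have [b [Cp [b01 Cp0 HP]]] := tsum_potter a_part th01' ex th2.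
have [c c0 HL] : exists2 c : R, 0 < c & forall J m x, (0 < m)%N -> (m <= J)%N ->
    0 < x <= pi -> m%:R * x <= 1 \/ m = 1%N -> c * x * T m <= normc (gsym a J x).
  move: th1; rewrite le_eqVlt => /predU1P[th1|th1].
    exact (symbol_lower_Im a_part th01' ex th1).
  exact (symbol_lower_Re a_part th01' ex th0 th1).
exact (renewal_oscillation a_part c0 Cp0 b01 HP HL e0).
Qed.

Lemma quotient_cvg q : (0 < q)%N -> (fun n => n%:R / (n %/ q)%:R) @ \oo --> (q%:R : R).
Proof.
move=> q0; apply: dist_lt_cvgn => e e0.
have qr : 0 < q%:R :> R by rewrite ltr0n.
have [N [N0 HN]] := nat_large (2 * q%:R / e).
exists (N * q)%N => n Nn; have Mn : (N <= n %/ q)%N by rewrite leq_divRL.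
have M0 : (0 < n %/ q)%N by exact: leq_trans Mn.
have Mr : 0 < (n %/ q)%:R :> R by rewrite ltr0n.
have h1 : (n %/ q)%:R * q%:R <= n%:R :> R by rewrite -natrM ler_nat leq_divM.
have h2 : n%:R < ((n %/ q)%:R + 1) * q%:R :> R by rewrite natr1 -natrM ltr_nat ltn_ceil.
have h3 : 2 * q%:R <= (n %/ q)%:R * e.
  have : 2 * q%:R / e <= (n %/ q)%:R by apply: le_trans HN _; rewrite ler_nat.
  by rewrite ler_pdivrMr.
have -> : n%:R / (n %/ q)%:R - q%:R = (n%:R - (n %/ q)%:R * q%:R) / (n %/ q)%:R :> R.
  by field; rewrite gt_eqF.
rewrite ger0_norm ?divr_ge0 ?subr_ge0 // ltr_pdivrMr //.
by lra.
Qed.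

(** With M the integer part of n / q, compare n with q M and n + M with (q + 1) M. As W is
    nondecreasing and W n / n nonincreasing, each replacement costs a relative error of order 1 / M,
    and regular variation gives the remaining ratio. *)
Lemma wsum_shift_ratio q : (0 < q)%N ->
  (fun n => W (n + n %/ q) / W n) @ \oo --> ((q%:R + 1) / q%:R) `^ theta.
Proof.
move=> q0; apply: dist_lt_cvgn => e e0.
have qr : 0 < q%:R :> R by rewrite ltr0n.
have rat : (fun k => W (q.+1 * k) / W (q * k)) @ \oo --> ((q%:R + 1) / q%:R) `^ theta.
  have T_rv m := @tsum_regular _ _ a_part _ th01' ex m.
  have h1 := wsum_ratio a_part T_rv (m:=q.+1).
  have h2 := wsum_ratio a_part T_rv (m:=q).
  have E m : (0 < m)%N -> pow0 (1 - (1 - theta)) m%:R = m%:R `^ theta :> R.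
    by move=> m0; rewrite /pow0 ltr0n m0 opprB addrCA subrr addr0.
  rewrite E // in h1; rewrite E // in h2.
  have q2 : q%:R `^ theta != 0 :> R by rewrite gt_eqF // powR_gt0.
  have h3 : (fun k => W (q.+1 * k) / W k * (W (q * k) / W k)^-1) @ \oo -->
      q.+1%:R `^ theta * (q%:R `^ theta)^-1 by exact: cvgM h1 (cvgV q2 h2).
  have -> : ((q%:R + 1) / q%:R) `^ theta = q.+1%:R `^ theta * (q%:R `^ theta)^-1 :> R.
    rewrite natr1 powRM ?invr_ge0 //; congr (_ * _).
    by rewrite -powR_inv1 // powRAC powR_inv1 // powR_ge0.
  apply: cvg_trans h3; apply: near_eq_cvg; exists 1%N => // k /= k0.
  have w1 := wsum_gt0 a_part k0.
  have w2 : 0 < W (q * k) by apply: (wsum_gt0 a_part); rewrite muln_gt0 q0.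
  by rewrite /=; field; rewrite !gt_eqF.
have e20 : 0 < e / 2 by rewrite divr_gt0.
have [N1 HN1] := cvgn_dist_lt rat e20.
have [N2 [N20 HN2]] := nat_large (8 / e).
exists ((N1 + N2) * q)%N => n Nn.
have Mn : (N1 + N2 <= n %/ q)%N by rewrite leq_divRL.
have Mq : (n %/ q * q <= n)%N by exact: leq_divM.
have nM : (n < (n %/ q).+1 * q)%N by exact: ltn_ceil.
move: Mn Mq nM; set M := (n %/ q)%N; clearbody M => Mn Mq nM.
have M0 : (0 < M)%N by apply: leq_trans Mn; rewrite addn_gt0 N20 orbT.
have n0 : (0 < n)%N by apply: leq_trans Mq; rewrite muln_gt0 M0.
have := HN1 M (leq_trans (leq_addr _ _) Mn).
set L := (_ / _) `^ _.
have Mr : 0 < M%:R :> R by rewrite ltr0n.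
have Me : 8 <= e * M%:R.
  rewrite mulrC -ler_pdivrMr //; apply: le_trans HN2 _; rewrite ler_nat.
  exact: leq_trans (leq_addl _ _) Mn.
have Mq' : M%:R * q%:R <= n%:R :> R by rewrite -natrM ler_nat.
have nM' : n%:R <= (M%:R + 1) * q%:R :> R by rewrite natr1 -natrM ler_nat ltnW.
have qM0 : (0 < q * M)%N by rewrite muln_gt0 q0.
have q1M0 : (0 < q.+1 * M)%N by rewrite muln_gt0.
have qMn : (q * M <= n)%N by rewrite mulnC.
have q1Mn : (q.+1 * M <= n + M)%N by rewrite mulSn addnC leq_add2r.
have wn := wsum_gt0 a_part n0; have wq := wsum_gt0 a_part qM0.
have wq1 := wsum_gt0 a_part q1M0.
have a1 : W (q.+1 * M) <= W (n + M) := wsum_le a_part q1Mn.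
have a2 : W (q * M) <= W n := wsum_le a_part qMn.
have a3 : M%:R * W (n + M) <= (M%:R + 1) * W (q.+1 * M).
  rewrite -ler_pdivlMl // mulrA; apply: le_trans (wsum_scale a_part q1M0 q1Mn) _.
  rewrite ler_pM2r // ler_pdivrMr ?ltr0n // natrD natrM -natr1.
  rewrite (_ : _ * ((q%:R + 1) * M%:R) = (M%:R + 1) * (q%:R + 1)); last first.
    by field; rewrite gt_eqF.
  by lra.
have a4 : M%:R * W n <= (M%:R + 1) * W (q * M).
  rewrite -ler_pdivlMl // mulrA; apply: le_trans (wsum_scale a_part qM0 qMn) _.
  rewrite ler_pM2r // ler_pdivrMr ?ltr0n // natrM.
  rewrite (_ : _ * (q%:R * M%:R) = (M%:R + 1) * q%:R); last first.
    by field; rewrite gt_eqF.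
  by lra.
have a5 : W (q.+1 * M) <= 2 * W (q * M).
  have qq : (q * M <= q.+1 * M)%N by rewrite leq_mul2r leqnSn orbT.
  apply: le_trans (wsum_scale a_part qM0 qq) _; rewrite ler_pM2r //.
  rewrite ler_pdivrMr ?ltr0n // -natrM ler_nat mulnA leq_mul2r mul2n -addnn -addn1.
  by rewrite leq_add2l q0 orbT.
rewrite !ltr_norml => /andP[b1 b2].
have r1 : W (q.+1 * M) / W (q * M) * W (q * M) = W (q.+1 * M) by rewrite divfK // gt_eqF.
have r2 : W (q.+1 * M) / W (q * M) <= 2 by rewrite ler_pdivrMr.
have r0 : 0 < W (q.+1 * M) / W (q * M) by rewrite divr_gt0.
move: b1 b2 r1 r2 r0; set r := W (q.+1 * M) / _ => b1 b2 r1 r2 r0.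
have up : W (n + M) / W n <= r + 2 / M%:R.
  rewrite ler_pdivrMr //; apply: (@le_trans _ _ ((r + 2 / M%:R) * W (q * M))); last first.
    by rewrite ler_pM2l // addr_gt0 // divr_gt0.
  rewrite -(ler_pM2l Mr); apply: le_trans a3 _; rewrite -r1.
  rewrite (_ : _ * ((r + _) * _) = (M%:R * r + 2) * W (q * M)); last by field; rewrite gt_eqF.
  by rewrite mulrA ler_pM2r // mulrDl mul1r lerD2l.
have lo : r - 2 / M%:R <= W (n + M) / W n.
  rewrite ler_pdivlMr // -(ler_pM2l Mr).
  rewrite (_ : _ * ((r - _) * _) = r * (M%:R * W n) - 2 * W n); last by field; rewrite gt_eqF.
  have h1 := ler_wpM2l (ltW r0) a4.
  have h2 := ler_wpM2l (ltW Mr) a1.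
  have h3 : r * ((M%:R + 1) * W (q * M)) = (M%:R + 1) * W (q.+1 * M) by rewrite -r1; ring.
  by lra.
have Me' : 2 / M%:R <= e / 4 by rewrite ler_pdivrMr //; lra.
by apply/andP; split; lra.
Qed.

End StrongLaw.

Section StrongRenewal.
Variables (R : realType) (a : nat -> R).
Hypothesis a_part : is_partition a.
Local Notation u := (renewal a).
Local Notation T := (tsum a).
Local Notation W := (wsum a).
Local Notation U := (renewal_sum a).

Lemma renewal_sum_add n M : U (n + M) = U n + \sum_(i < M) u (n + i.+1).
Proof.
elim: M => [|M IHM]; first by rewrite addn0 big_ord0 addr0.
by rewrite addnS renewal_sumS IHM big_ord_recr /= addrA addnS.
Qed.

Variable theta : R.
Hypothesis th01 : 1 / 2 < theta <= 1.
Hypothesis ex : expansive a theta.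

Let th01' : 0 <= theta <= 1. Proof. by have /andP[h1 h2] := th01; apply/andP; lra. Qed.

Lemma wsum_increment_cvg q : (0 < q)%N ->
  (fun n => (W (n + n %/ q) - W n) * T n / (n %/ q)%:R) @ \oo -->
  q%:R * (((q%:R + 1) / q%:R) `^ theta - 1).
Proof.
move=> q0; have h : (fun n => n%:R / (n %/ q)%:R * (W (n + n %/ q) / W n - 1)) @ \oo -->
    q%:R * (((q%:R + 1) / q%:R) `^ theta - 1).
  apply: cvgM; first exact: quotient_cvg.
  by apply: cvgB; [exact: (wsum_shift_ratio a_part th01 ex q0)|exact: cvg_cst].
apply: cvg_trans h; apply: near_eq_cvg; exists 1%N => // n /= n0.
have Wn := wsum_gt0 a_part n0; rewrite -(tsum_wsum a_part n).
have -> : W (n + n %/ q) / W n - 1 = (W (n + n %/ q) - W n) / W n.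
  by rewrite mulrBl divff // gt_eqF.
by rewrite mulrAC; congr (_ / _); field; rewrite gt_eqF.
Qed.

Variable K : R.
Hypothesis KE : K * beta (1 - theta) = 2^-1.

(** Four errors of e / 5: u n against its mean over the next M indices, U against K W, the increment
    of W against its limit for fixed q, and that limit against theta. *)
Lemma strong_renewal : (fun n => u n * T n) @ \oo --> K * theta.
Proof.
have rho01 : 0 <= 1 - theta <= 1 by have /andP[h1 h2] := th01'; apply/andP; lra.
have K0 : 0 < K by rewrite -(pmulr_lgt0 _ (beta_gt0 rho01)) KE invr_gt0.
apply: dist_lt_cvgn => e e0.
have e1 : 0 < e / 5 by rewrite divr_gt0.
have [q0 [n1 [q00 Hosc]]] := renewal_oscillation_expansive a_part th01 ex e1.
have [q1 [q10 Hq1]] := nat_large (10 * K / e).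
pose q := (q0 + q1 + 2)%N.
have qq0 : (q0 <= q)%N by rewrite /q -addnA leq_addr.
have qq1 : 10 * K / e <= q%:R.
  by apply: le_trans Hq1 _; rewrite ler_nat /q addnAC leq_addl.
have q2 : 2 <= q%:R :> R by rewrite ler_nat /q leq_addl.
have qpos : (0 < q)%N by apply: leq_trans qq0.
clearbody q; have qr : 0 < q%:R :> R by rewrite ltr0n.
have e2 : 0 < e / (5 * K) by rewrite divr_gt0 // mulr_gt0.
have [n2 Hinc] := cvgn_dist_lt (wsum_increment_cvg qpos) e2.
(* Dividing by M costs n / M <= 2 q, and W(n + M) + W n <= 3 W n; together a factor 6 q. *)
have e3 : 0 < e / (30 * q%:R) by rewrite divr_gt0 // mulr_gt0.
have T_rv m := @tsum_regular _ _ a_part _ th01' ex m.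
have [n3 Hweak] := weak_renewal a_part rho01 T_rv KE e3.
exists (n1 + n2 + n3 + q)%N => n nn.
have nq : (q <= n)%N by exact: leq_trans (leq_addl _ _) nn.
have nn3 : (n3 <= n)%N by apply: leq_trans nn; rewrite -addnA addnCA leq_addr.
have nn2 : (n2 <= n)%N by apply: leq_trans nn; rewrite -!addnA addnCA leq_addr.
have nn1 : (n1 <= n)%N by apply: leq_trans nn; rewrite -!addnA leq_addr.
have n0 : (0 < n)%N by exact: leq_trans nq.
have := Hinc n nn2.
have M0 : (0 < n %/ q)%N by rewrite divn_gt0.
have Mq : (n %/ q * q <= n)%N by exact: leq_divM.
have Mn : (n < (n %/ q).+1 * q)%N by exact: ltn_ceil.
move: M0 Mq Mn; set M := (n %/ q)%N; clearbody M => M0 Mq Mn hinc.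
have Mr : 0 < M%:R :> R by rewrite ltr0n.
have Tn := tsum_gt0 a_part n0; have Wn := wsum_gt0 a_part n0.
have MnN : (M <= n)%N by apply: leq_trans Mq; rewrite leq_pmulr.
have osc : `|U (n + M) - U n - M%:R * u n| <= M%:R * (e / 5 / T n).
  rewrite renewal_sum_add [U n + _]addrC addrK sum_const_ord -sumrB sum_const_ord.
  apply: le_trans (ler_norm_sum _ _ _) _; apply: ler_sum => i _.
  rewrite distrC; apply: Hosc => //.
  apply: leq_trans Mq; apply: leq_mul => //; exact: ltn_ord.
have w1 := Hweak n nn3; have w2 := Hweak (n + M)%N (leq_trans nn3 (leq_addr _ _)).
have W2 : W (n + M) <= 2 * W n.
  apply: le_trans (wsum_scale a_part n0 (leq_addr M n)) _.
  rewrite ler_pM2r // ler_pdivrMr ?ltr0n // -natrM ler_nat mul2n -addnn.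
  by rewrite leq_add2l.
have nM : n%:R <= 2 * (q%:R * M%:R) :> R.
  rewrite -!natrM ler_nat; apply: leq_trans (ltnW Mn) _.
  by rewrite mulnC mulnA [(2 * q)%N]mulnC -mulnA leq_mul2l mul2n -addnn -addn1 leq_add2l M0 orbT.
have TW := tsum_wsum a_part n.
have TM : 0 < T n / M%:R by rewrite divr_gt0.
have i1 : `|(U (n + M) - U n) * T n / M%:R - u n * T n| <= e / 5.
  have -> : (U (n + M) - U n) * T n / M%:R - u n * T n =
    (U (n + M) - U n - M%:R * u n) * (T n / M%:R) by field; rewrite gt_eqF.
  rewrite normrM (gtr0_norm TM); apply: le_trans (ler_wpM2r (ltW TM) osc) _.
  by rewrite le_eqVlt; apply/orP; left; apply/eqP; field; rewrite !gt_eqF.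
have i2 : `|(U (n + M) - U n) * T n / M%:R - K * ((W (n + M) - W n) * T n / M%:R)| <= e / 5.
  have -> : (U (n + M) - U n) * T n / M%:R - K * ((W (n + M) - W n) * T n / M%:R) =
    ((U (n + M) - K * W (n + M)) - (U n - K * W n)) * (T n / M%:R) by ring.
  rewrite normrM (gtr0_norm TM).
  apply: (@le_trans _ _ (e / (30 * q%:R) * (3 * W n) * (T n / M%:R))).
    rewrite ler_pM2r //; apply: le_trans (ler_normB _ _) _; apply: le_trans (lerD w2 w1) _.
    by rewrite -mulrDr ler_pM2l //; lra.
  have -> : e / (30 * q%:R) * (3 * W n) * (T n / M%:R) = e / (10 * q%:R) * n%:R / M%:R.
    by rewrite -TW; field; rewrite !gt_eqF.
  rewrite ler_pdivrMr // mulrAC ler_pdivrMr ?mulr_gt0 //.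
  by have := ler_wpM2l (ltW e0) nM; lra.
have i3 : `|K * ((W (n + M) - W n) * T n / M%:R) -
    K * (q%:R * (((q%:R + 1) / q%:R) `^ theta - 1))| <= e / 5.
  rewrite -mulrBr normrM (gtr0_norm K0) mulrC -ler_pdivlMr //.
  by rewrite (_ : e / 5 / K = e / (5 * K)); [exact: ltW|rewrite invfM mulrA].
have i4 : `|K * (q%:R * (((q%:R + 1) / q%:R) `^ theta - 1)) - K * theta| <= e / 5.
  rewrite -mulrBr normrM (gtr0_norm K0).
  apply: le_trans (ler_wpM2l (ltW K0) (powR_difference_quotient th01' q2)) _.
  by move: qq1; rewrite ler_pdivrMr // mulrA ler_pdivrMr //; lra.
move: i1 i2 i3 i4; clear -e0.
set x1 := _ * T n / _; set x2 := K * (_ / _); set x3 := K * (_ * (_ - 1)).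
rewrite !ler_norml ltr_norml => /andP[h1 h2] /andP[h3 h4] /andP[h5 h6] /andP[h7 h8].
by apply/andP; split; lra.
Qed.

End StrongRenewal.

(** * Transfer to the sum-level sets *)

Section Asymptotics.
Variables (R : realType) (a : nat -> R).
Hypothesis a_part : is_partition a.
Local Notation u := (renewal a).
Local Notation T := (tsum a).
Local Notation W := (wsum a).
Local Notation U := (renewal_sum a).

Lemma lam_sumlevel_sum n : \sum_(1 <= k < n.+1) lam_sumlevel a k = U n - 1.
Proof.
elim: n => [|n IHn].
  by rewrite big_geq // /renewal_sum big_ord1 renewal0 subrr.
by rewrite big_nat_recr //= IHn (lam_sumlevelE a_part) // renewal_sumS addrAC.
Qed.

Lemma lam_sumlevel_cvg (l : R) : u @ \oo --> l -> lam_sumlevel a @ \oo --> l.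
Proof.
move=> h; apply: cvg_trans h; apply: near_eq_cvg; exists 1%N => // n /= n0.
by rewrite (lam_sumlevelE a_part).
Qed.

Lemma wsum_unbounded (A : R) : exists N, forall n, (N <= n)%N -> A <= W n.
Proof.
have [N0 [N00 HN0]] := nat_large A; have Nr : 0 < N0%:R :> R by rewrite ltr0n.
have Ni : 0 < N0%:R^-1 :> R by rewrite invr_gt0.
have [N HN] := tsum_over_n a_part Ni; exists N.+1 => n Nn.
have Tn := tsum_gt0 a_part (leq_ltn_trans (leq0n N) Nn).
apply: le_trans HN0 _; rewrite /wsum ler_pdivlMr // mulrC -ler_pdivlMr // mulrC.
exact: HN (ltnW Nn).
Qed.

(** The sums of measures lack the term u_0 = 1 of U, which is negligible because W is unbounded. *)
Lemma weak_asymp (rho K : R) : 0 <= rho <= 1 ->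
  (forall m, (0 < m)%N -> (fun k => T (m * k) / T k) @ \oo --> m%:R `^ rho) ->
  K * beta rho = 2^-1 ->
  asymp (fun n => \sum_(1 <= k < n.+1) lam_sumlevel a k) (fun n => K * n%:R / T n).
Proof.
move=> rho01 T_rv KE.
have K0 : 0 < K by rewrite -(pmulr_lgt0 _ (beta_gt0 rho01)) KE invr_gt0.
apply: dist_lt_cvgn => e e0; have e1 : 0 < e * K / 3 by rewrite divr_gt0 // mulr_gt0.
have [N1 HN1] := weak_renewal a_part rho01 T_rv KE e1.
have [N2 HN2] := wsum_unbounded (e * K / 3)^-1.
exists (N1 + N2).+1 => n Nn; have n0 : (0 < n)%N by exact: leq_ltn_trans Nn.
have := HN1 n (leq_trans (leq_addr _ _) (ltnW Nn)).
have := HN2 n (leq_trans (leq_addl _ _) (ltnW Nn)).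
have Wn := wsum_gt0 a_part n0; have KW : 0 < K * W n by rewrite mulr_gt0.
rewrite lam_sumlevel_sum (_ : K * n%:R / T n = K * W n) => [h1|]; last by rewrite /wsum mulrA.
have h2 : 1 <= e * K / 3 * W n by rewrite mulrC -ler_pdivrMr // div1r.
rewrite -(ltr_pM2r KW) -[X in `|_| * X](gtr0_norm KW) -normrM.
rewrite (_ : ((U n - 1) / (K * W n) - 1) * (K * W n) = U n - 1 - K * W n); last first.
  by field; rewrite !gt_eqF.
rewrite ler_norml ltr_norml => /andP[h3 h4].
have h5 : 0 < e * (K * W n) by rewrite mulr_gt0.
by apply/andP; split; lra.
Qed.

End Asymptotics.

Theorem theorem1p1 (R : realType) (a : nat -> R) :
  is_partition a ->
  (* (1) divergence of the series and the limit of lambda(L_n) *)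
  ((fun N => \sum_(1 <= n < N.+1) lam_sumlevel a n) @ \oo --> +oo /\
   (~ finite_type a -> lam_sumlevel a @ \oo --> (0 : R)) /\
   (finite_type a -> lam_sumlevel a @ \oo --> (limn (tsum a))^-1)) /\
  (* (2)(i) weak renewal law *)
  ((forall theta : R, 0 <= theta <= 1 -> expansive a theta ->
      asymp (fun n => \sum_(1 <= k < n.+1) lam_sumlevel a k)
            (fun n => (Gamma (2 - theta) * Gamma (1 + theta))^-1 * n%:R / tsum a n)) /\
   (finite_type a ->
      asymp (fun n => \sum_(1 <= k < n.+1) lam_sumlevel a k)
            (fun n => 1 * n%:R / tsum a n))) /\
  (* (2)(ii) strong renewal law *)
  ((forall theta : R, 1/2 < theta <= 1 -> expansive a theta ->
      asymp (lam_sumlevel a)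
            (fun n => (Gamma (2 - theta) * Gamma theta)^-1 / tsum a n)) /\
   (finite_type a ->
      asymp (lam_sumlevel a) (fun n => 1 / tsum a n))).
Proof.
move=> a_part.
have finite_cvg : finite_type a -> lam_sumlevel a @ \oo --> (limn (tsum a))^-1.
  by move=> fin; apply: (lam_sumlevel_cvg a_part); apply: (renewal_cvg_finite a_part).
have constE (theta : R) : 0 <= theta <= 1 ->
    (Gamma (2 - theta) * Gamma (1 + theta))^-1 * beta (1 - theta) = 2^-1.
  move=> th01; have r01 : 0 <= 1 - theta <= 1 by lra.
  have := Gamma_beta r01.
  rewrite (_ : 1 + (1 - theta) = 2 - theta); last by ring.
  rewrite (_ : 2 - (1 - theta) = 1 + theta); last by ring.
  by move=> ->; have := beta_gt0 r01 => b0; field; rewrite gt_eqF.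
split; [|split].
- split; [|split=> // inf].
    apply/cvgryPge => A; have [N HN] := renewal_sum_unbounded a_part (A + 1).
    by exists N => // n /= /HN; rewrite lam_sumlevel_sum //; lra.
  by apply: (lam_sumlevel_cvg a_part); exact: (renewal_cvg_infinite a_part).
- split=> [theta th01 ex|fin].
    apply: (weak_asymp a_part (rho := 1 - theta)); first by lra.
      by move=> m m0; exact: (tsum_regular a_part th01 ex).
    exact: constE.
  apply: (weak_asymp a_part (rho := 0)); first by rewrite lexx ler01.
    by move=> m m0; rewrite powRr0; exact: (tsum_ratio_finite a_part).
  (* The index rho = 0 corresponds to theta = 1, where the Gamma constant is 1. *)
  have := constE 1; rewrite subrr lexx ler01 => /(_ isT) <-; congr (_ * _).
  have g1 : Gamma (1 : R) = 1 by rewrite GammaE gammaE1.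
  rewrite (Gamma_rec ltr01) (_ : 2 - 1 = 1 :> R); last by ring.
  by rewrite g1 !mul1r invr1.
- split=> [theta th2 ex|fin].
    have th01 : 0 <= theta <= 1 by lra.
    have th0 : 0 < theta by lra.
    have su := strong_renewal a_part th2 ex (constE theta th01).
    rewrite (Gamma_rec th0) in su.
    set k := (_ * Gamma theta)^-1.
    have kE : (Gamma (2 - theta) * (theta * Gamma theta))^-1 * theta = k.
      rewrite mulrCA invfM -/k mulrAC mulVf ?mul1r // gt_eqF //.
    (* Otherwise the product with [beta] in [constE] would be 0 instead of 1/2. *)
    have k0 : k != 0.
      apply/eqP => k0; have := constE theta th01.
      rewrite (Gamma_rec th0) mulrCA invfM -/k k0 mulr0 mul0r => /esym/eqP.
      by rewrite invr_eq0 pnatr_eq0.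
    rewrite kE in su; have h : (fun n => renewal a n * tsum a n / k) @ \oo --> k / k.
      by apply: cvgM; [exact: su|exact: cvg_cst].
    rewrite divff // in h; apply: cvg_trans h; apply: near_eq_cvg; exists 1%N => // n /= n0.
    have Tn := tsum_gt0 a_part n0.
    by rewrite (lam_sumlevelE a_part) //=; field; rewrite k0 gt_eqF.
  have mu1 : 1 <= limn (tsum a).
    by apply: (cvgr_to_ge fin); exists 1%N => // n /= n0; exact: (tsum_ge1 a_part).
  have mu0 : limn (tsum a) != 0 by rewrite gt_eqF // (lt_le_trans ltr01).
  have h : (fun n => lam_sumlevel a n * tsum a n) @ \oo --> (limn (tsum a))^-1 * limn (tsum a).
    by apply: cvgM; [exact: finite_cvg|exact: fin].
  rewrite mulVf // in h; apply: cvg_trans h; apply: near_eq_cvg; exists 1%N => // n /= n0.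
  by rewrite div1r invrK.
Qed.
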